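(* Let $A$ be a unital semisimple commutative Banach algebra and $B$ a unital commutative Banach algebra. Suppose that $T$ is a map from $A^{-1}$ onto $B^{-1}$ and $\alpha$ is a non-zero complex number such that $$\mathrm{r}(Tf\,Tg-\alpha)=\mathrm{r}(fg-\alpha)$$ holds for every pair $f$ and $g$ in $A^{-1}$. Then $B$ is semisimple, and $T$ is extended to a map $T_E$ from $\mathrm{cl}\,A$ onto $\mathrm{cl}\,B$ such that $T_EA=B$, and there exist an element $\eta\in B^{-1}$ with $\eta^2=1$, a homeomorphism $\phi$ from $\mathrm{Ch}(\mathrm{cl}\,B)$ onto $\mathrm{Ch}(\mathrm{cl}\,A)$ and a clopen subset $K$ of $\mathrm{Ch}(\mathrm{cl}\,B)$ such that $$T_Ef(y)=\eta(y)\times\begin{cases} f(\phi(y)), & y\in K,\\ \frac{\alpha}{|\alpha|}\overline{f(\phi(y))}, & y\in\mathrm{Ch}(\mathrm{cl}\,B)\setminus K\end{cases}$$ holds for every $f\in\mathrm{cl}\,A$. Furthermore, if $T1=1$, then $$T_Ef(y)=\begin{cases} f(\phi(y)), & y\in K,\\ \overline{f(\phi(y))}, & y\in\mathrm{Ch}(\mathrm{cl}\,B)\setminus K\end{cases}$$ holds for every $f\in\mathrm{cl}\,A$. Thus the equality $$\|T_Ef\,T_Eg-\alpha\|_{\infty(M_B)}=\|fg-\alpha\|_{\infty(M_A)}$$ holds for every pair $f$ and $g$ in $\mathrm{cl}\,A$, and $T_E((\mathrm{cl}\,A)^{-1})=(\mathrm{cl}\,B)^{-1}$ holds. Furthermore,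 if $T1=1$, and in addition either $\alpha\in\mathbb{C}\setminus\mathbb{R}$ or there exists $\lambda\in\mathbb{C}\setminus\mathbb{R}$ such that $T\lambda=\lambda$, then $$T_Ef(y)=f(\phi(y)),\quad y\in\mathrm{Ch}(\mathrm{cl}\,B)$$ holds for every $f\in\mathrm{cl}\,A$; in this case, $T_E$ is a complex-algebra isomorphism from $\mathrm{cl}\,A$ onto $\mathrm{cl}\,B$ with $T_EA=B$.
   Context: Banach algebras are over $\mathbb{C}$. $A^{-1}$ is the group of invertible elements of $A$; $\mathrm{r}(\cdot)$ is the spectral radius; $M_A$ is the maximal ideal space of $A$. $\mathrm{cl}\,A$ is the closure, in the supremum norm $\|\cdot\|_{\infty(M_A)}$, of the Gelfand transform $\hat A$ in $C(M_A)$; it is a uniform algebra on $M_A$, i.e. a uniformly closed subalgebra of $C(M_A)$ containing the constants and separating points. If $A$ is semisimple, elements of $A$ are identified with their Gelfand transforms, so that $A\subset\mathrm{cl}\,A\subset C(M_A)$. $\mathrm{Ch}(\mathrm{cl}\,A)\subset M_A$ is the Choquet boundary of $\mathrm{cl}\,A$. $T$ is not assumed to be linear or multiplicative. *)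

(* Defs.v *)
From HB Require Import structures.
From mathcomp Require Import all_boot all_order all_algebra.
From mathcomp Require Import ring_quotient.
From mathcomp Require Import complex.
From mathcomp Require Import all_classical all_reals topology normedtype.

Set Implicit Arguments.
Unset Strict Implicit.
Unset Printing Implicit Defensive.

Import Order.TTheory GRing.Theory Num.Theory.
Import numFieldNormedType.Exports.

Local Open Scope classical_set_scope.
Local Open Scope ring_scope.

(* The norm is a separate operation because HB refuses a structure joining
   rings and normed modules other than the ones below [numDomainType].
   [GRing.unit] is the group of invertible elements.  The normalization
   ||1|| = 1 is not required. *)
Record comBanachAlgType (R : realType) := ComBanachAlgebra {
  carrier :> comUnitAlgType R[i];
  bnorm : carrier -> R;
  bnormD : forall x y, bnorm (x + y) <= bnorm x + bnorm y;
  bnormZ : forall (c : R[i]) x, bnorm (c *: x) = complex.Re `|c| * bnorm x;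
  bnorm_eq0 : forall x, bnorm x = 0 -> x = 0;
  bnormM : forall x y, bnorm (x * y) <= bnorm x * bnorm y;
  bnorm_complete : forall u : nat -> carrier,
    (forall e : R, 0 < e -> \forall m & n \near \oo, bnorm (u m - u n) < e) ->
    exists l, bnorm (u n - l) @[n --> \oo] --> (0 : R)
}.

Section Algebras.
Variables (R : realType) (A : comBanachAlgType R).
Implicit Types (a : A) (I J : {pred A}).

Definition invertibles : set A := [set a | a \is a GRing.unit].

Definition spectrum a : set R[i] := [set z | a - z%:A \isn't a GRing.unit].

Definition spectral_radius a : R :=
  sup [set complex.Re `|z| | z in spectrum a].

(* [idealr_closed] includes properness. *)
Definition maximal_ideal I : Prop :=
  idealr_closed I /\
  forall J, idealr_closed J -> {subset I <= J} -> {subset J <= I}.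

Definition semisimple : Prop :=
  forall a, (forall I, maximal_ideal I -> a \in I) -> a = 0.

(* The maximal ideal space is realized, as usual, as the set of nonzero
   multiplicative linear functionals with the topology of pointwise
   convergence on A (the Gelfand topology). *)
Definition characters : set {ptws A -> R[i]^o} :=
  [set chi | scalar chi /\ monoid_morphism chi].

Definition max_ideal_space : topologicalType := set_type characters.

Definition gelfand a : max_ideal_space -> R[i] := fun chi => \val chi a.

Definition cl : set (max_ideal_space -> R[i]) :=
  [set f | continuous (f : max_ideal_space -> R[i]^o)] `&`
  closure (range gelfand : set {uniform max_ideal_space -> R[i]^o}).

End Algebras.

Arguments invertibles {R} A.
Arguments semisimple {R} A.
Arguments characters {R} A.
Arguments max_ideal_space {R} A.
Arguments gelfand {R A} a.
Arguments cl {R} A.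

Section FunctionAlgebras.
Variables (R : realType) (X : Type).
Implicit Types (f g : X -> R[i]) (F : set (X -> R[i])).

Definition sup_norm f : R := sup [set complex.Re `|f x| | x in [set: X]].

Definition fun_invertibles F : set (X -> R[i]) :=
  [set f | F f /\ exists2 g, F g & f \* g = cst 1].

(* States of F: linear functionals L on F with L 1 = 1 and norm at most 1;
   only the values of L on F matter. *)
Definition state F (L : (X -> R[i]) -> R[i]) : Prop :=
  [/\ forall c f g, F f -> F g -> L (c \*: f \+ g) = c * L f + L g,
      L (cst 1) = 1
    & forall f, F f -> complex.Re `|L f| <= sup_norm f].

(* x is in the Choquet boundary when the evaluation at x is an extreme point
   of the state space of F. *)
Definition choquet_boundary F : set X :=
  [set x | forall (L1 L2 : (X -> R[i]) -> R[i]) (t : R),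
    state F L1 -> state F L2 -> 0 < t < 1 ->
    (forall f, F f -> f x = t%:C%C * L1 f + (1 - t)%:C%C * L2 f) ->
    forall f, F f -> L1 f = f x /\ L2 f = f x].

End FunctionAlgebras.

Definition Ch (R : realType) (A : comBanachAlgType R) : topologicalType :=
  set_type (choquet_boundary (cl A)).

Definition homeomorphism (X Y : topologicalType) (h : X -> Y) : Prop :=
  continuous h /\
  exists k : Y -> X, [/\ continuous k, cancel h k & cancel k h].

Definition complex_algebra_isomorphism (R : realType) (X Y : Type)
    (F : set (X -> R[i])) (G : set (Y -> R[i]))
    (S : (X -> R[i]) -> (Y -> R[i])) : Prop :=
  [/\ set_bij F G S,
      forall c f g, F f -> F g -> S (c \*: f \+ g) = c \*: S f \+ S g,
      forall f g, F f -> F g -> S (f \* g) = S f \* S g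
    & S (cst 1) = cst 1].

(* Main.v *)
Require Import Defs.
From mathcomp Require Import all_boot all_order all_algebra.
From mathcomp Require Import ring_quotient.
From mathcomp Require Import complex.
From mathcomp Require Import all_classical all_reals topology normedtype sequences.
From mathcomp Require Import ring lra zify.

(* The hypothesis with [g = alpha / h] shows that [r (f / h - 1)] is preserved, so
   that [T] is an isometry for the multiplicative metric [ln (1 + max (r (f / h - 1))
   (r (h / f - 1)))] on the units.  Vaisala's reflection proof of the Mazur-Ulam
   theorem, applied locally, makes [f -> T f / T 1] multiplicative on the subgroup
   generated by a neighbourhood of [1].  Its derivative at [1] is a
   real-linear isometry from [A] onto a dense subspace of [cl B]; its transpose maps
   extreme functionals to extreme functionals, and those are the rotated evaluations
   at points of the Choquet boundaries.  Hence the derivative at [y] is the evaluation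
   at some point [phi y] or its conjugate, and a telescoping product integrates this
   formula to the subgroup.  For an arbitrary unit [f], comparing [f] with elements
   [c (1 - u)] of the subgroup, where [u] vanishes at [phi y] and has very negative real
   part where [f] is not close to [f (phi y)], puts [T f / T 1] at [y] into the closed
   disc with diameter from [0] to the expected value; doing the same for [alpha / f]
   gives equality.  Continuity of the resulting representation and its extension to
   [cl A] follow from the Choquet boundary being norming. *)

Set Implicit Arguments.
Unset Strict Implicit.
Unset Printing Implicit Defensive.

Import Order.TTheory GRing.Theory Num.Theory.
Import numFieldNormedType.Exports.

Local Open Scope classical_set_scope.
Local Open Scope ring_scope.

From mathcomp Require Import all_classical all_reals topology normedtype.
From mathcomp Require Import ring lra.

(** The group of units may be disconnected, and squaring expands [dist] by a factor close to 2 only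
    at small distances. So multiplicativity is obtained on a subgroup only, and the other units are
    reached through inequalities with elements where the representation is already known. Extreme
    functionals, their identification with rotated evaluations and the peaking elements [u] all come
    from sublinear functionals and one multiplier argument, which takes the place of representing
    measures: if [M] extends an extreme [l] to the bounded functions without increasing the norm,
    then inserting a real weight inside [M] multiplies [l] by a scalar. Semisimplicity of [B] comes
    before all this: a unit of [A] is determined by the Gelfand transform of its image, so that [1]
    and [1 + b] have the same preimage when [b] lies in the radical. *)

Section Complex.
Variable R : realType.
Implicit Types (z w : R[i]) (r : R).

Definition modc z : R := complex.Re `|z|.

Lemma modcE z : (modc z)%:C%C = `|z|.
Proof. by rewrite RRe_real ?normr_real. Qed.

Lemma modc_ge0 z : 0 <= modc z.
Proof. by rewrite -lecR modcE normr_ge0. Qed.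

Lemma modc0 : modc 0 = 0. Proof. by rewrite /modc normr0. Qed.

Lemma modc1 : modc 1 = 1. Proof. by rewrite /modc normr1. Qed.

Lemma modcM z w : modc (z * w) = modc z * modc w.
Proof. by apply: complexI; rewrite rmorphM /= !modcE normrM. Qed.

Lemma modcD z w : modc (z + w) <= modc z + modc w.
Proof. by rewrite -lecR rmorphD /= !modcE ler_normD. Qed.

Lemma modcN z : modc (- z) = modc z.
Proof. by rewrite /modc normrN. Qed.

Lemma modcB z w : modc (z - w) = modc (w - z).
Proof. by rewrite -modcN opprB. Qed.

Lemma modc_eq0 z : (modc z == 0) = (z == 0).
Proof. by rewrite -(inj_eq (@complexI R)) /= modcE normr_eq0. Qed.

Lemma modc_gt0 z : (0 < modc z) = (z != 0).
Proof. by rewrite lt_def modc_ge0 andbT modc_eq0. Qed.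

Lemma modcX z n : modc (z ^+ n) = modc z ^+ n.
Proof. by apply: complexI; rewrite rmorphXn /= !modcE normrX. Qed.

Lemma modcV z : modc z^-1 = (modc z)^-1.
Proof. by apply: complexI; rewrite fmorphV /= !modcE normfV. Qed.

Lemma modc_conj z : modc z^* = modc z.
Proof. by rewrite /modc norm_conjC. Qed.

Lemma modcR r : modc r%:C%C = `|r|.
Proof. by apply: complexI; rewrite modcE normc_def /= expr0n addr0 sqrtr_sqr. Qed.

Lemma sqr_modc z : modc z ^+ 2 = complex.Re z ^+ 2 + complex.Im z ^+ 2.
Proof. by apply: complexI; rewrite rmorphXn /= modcE add_Re2_Im2. Qed.

Lemma Re_le_modc z : complex.Re z <= modc z.
Proof.
by rewrite -lecR modcE; apply: le_trans (normc_ge_Re z); rewrite lecR ler_norm.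
Qed.

Lemma normRe_le z : `|complex.Re z| <= modc z.
Proof.
rewrite -ler_sqr ?nnegrE ?modc_ge0 // sqr_modc real_normK ?num_real //.
by rewrite lerDl sqr_ge0.
Qed.

Lemma normIm_le z : `|complex.Im z| <= modc z.
Proof.
rewrite -ler_sqr ?nnegrE ?modc_ge0 // sqr_modc real_normK ?num_real //.
by rewrite lerDr sqr_ge0.
Qed.

Lemma modc_i : modc 'i%C = 1 :> R.
Proof. by rewrite /modc normc_def /= expr0n expr1n add0r sqrtr1. Qed.

Lemma modc_le_ReIm z : modc z <= `|complex.Re z| + `|complex.Im z|.
Proof.
rewrite {1}[z]complexE; apply: le_trans (modcD _ _) _.
by rewrite modcM modc_i mul1r !modcR.
Qed.

Lemma conjE z : z^* = (complex.Re z -i* complex.Im z)%C.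
Proof. by case: z. Qed.

Lemma modcNB z w : modc z - modc w <= modc (z - w).
Proof. by rewrite lerBlDr -[X in modc X <= _](subrK w) modcD. Qed.

Lemma mul_conjE z : z * z^* = (modc z ^+ 2)%:C%C.
Proof. by rewrite rmorphXn /= modcE normCK. Qed.

Lemma exp_half_lt (e : R) : 0 < e -> exists k0 : nat, forall k, (k0 <= k)%N -> (2^-1) ^+ k < e.
Proof.
move=> e0; exists (Num.bound e^-1) => k hk.
by rewrite exprVn invf_plt ?posrE ?exprn_gt0 //; exact: upper_nthrootP.
Qed.

End Complex.

(** * Gelfand-Mazur for a seminorm, by Rickart's averages over roots of unity *)

Section Rickart.
Variables (R : realType) (A : comUnitAlgType R[i]) (N : A -> R).
Hypothesis ND : forall x y, N (x + y) <= N x + N y.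
Hypothesis NZ : forall (c : R[i]) x, N (c *: x) = modc c * N x.
Hypothesis NM : forall x y, N (x * y) <= N x * N y.
Hypothesis N1 : 0 < N 1.

Lemma seminorm0 : N 0 = 0.
Proof. by rewrite -(scale0r 0) NZ modc0 mul0r. Qed.

Lemma seminormN x : N (- x) = N x.
Proof. by rewrite -scaleN1r NZ modcN modc1 mul1r. Qed.

Lemma seminorm_ge0 x : 0 <= N x.
Proof. by have := ND x (- x); rewrite subrr seminorm0 seminormN; lra. Qed.

Lemma seminormB x y : N (x - y) = N (y - x).
Proof. by rewrite -seminormN opprB. Qed.

Lemma seminorm_le x y : N x <= N (x - y) + N y.
Proof. by rewrite -{1}(subrK y x). Qed.

(** Equality modulo [null] stands for equality in a quotient algebra: [N] will be the quotient
    seminorm of a maximal ideal, and [x - z] will be inverted by [c z] only modulo that ideal. *)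
Definition null x := N x = 0.

Lemma nullP x : N x <= 0 -> null x.
Proof. by move=> h; apply/eqP; rewrite eq_le h seminorm_ge0. Qed.

Lemma nullD x y : null x -> null y -> null (x + y).
Proof. by move=> hx hy; apply: nullP; rewrite (le_trans (ND _ _)) ?hx ?hy ?addr0. Qed.

Lemma nullN x : null x -> null (- x).
Proof. by rewrite /null seminormN. Qed.

Lemma nullMl x y : null y -> null (x * y).
Proof. by move=> hy; apply: nullP; rewrite (le_trans (NM _ _)) ?hy ?mulr0. Qed.

Lemma nullZ c x : null x -> null (c *: x).
Proof. by rewrite /null NZ => ->; rewrite mulr0. Qed.

Lemma null_eq x y : null (x - y) -> N x = N y.
Proof.
move=> h; apply/eqP; rewrite eq_le.
have := seminorm_le x y; have := seminorm_le y x.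
by rewrite seminormB h !add0r => -> ->.
Qed.

Variables (x : A) (c : R[i] -> A).
Hypothesis cP : forall z, null (c z * (x - z%:A) - 1).

(** The resolvent identity [c z - c w = (z - w) c z c w] holds modulo [null]. *)
Lemma resolvent z w : N (c z - c w) <= modc (z - w) * (N (c z) * N (c w)).
Proof.
have -> : N (c z - c w) = N ((z - w) *: (c z * c w)).
  apply: null_eq.
  have -> : c z - c w - (z - w) *: (c z * c w) =
     c w * (c z * (x - z%:A) - 1) - c z * (c w * (x - w%:A) - 1).
    by rewrite -[(z - w) *: _]mulr_algl scalerBl; ring.
  by apply: nullD; [exact: nullMl|apply/nullN/nullMl].
by rewrite NZ ler_wpM2l ?modc_ge0.
Qed.

Lemma resolvent_local_bound z w :
  modc (z - w) * N (c w) <= 2^-1 -> N (c z) <= 2 * N (c w).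
Proof.
move=> h; have := seminorm_le (c z) (c w); have := resolvent z w.
have := seminorm_ge0 (c z); have := seminorm_ge0 (c w).
set a := N (c z); set b := N (c w) in h *; set d := N _; set e := modc _ in h *.
move=> hb ha h1 h2.
have : a * (e * b) <= a * 2^-1 by rewrite ler_wpM2l.
nra.
Qed.

(** By the local bound, the resolvent near [w] is at most twice its size at [w]; the square
    containing the disc is compact. Taking bounds along [pinfty_nbhs] turns the finite subcover into
    one common bound. *)
Lemma resolvent_bound r : exists B, forall z, modc z <= r -> N (c z) <= B.
Proof.
have cK : compact (`[- r, r]%classic `*` `[- r, r]%classic : set (R * R)).
  by apply: compact_setX; apply: segment_compact.
have /compact_near_coveringP cov := cK.
have [] := cov R (pinfty_nbhs R) (fun M p => N (c (p.1 +i* p.2)%C) <= M) _.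
  move=> [a b] _ /=.
  set w := (a +i* b)%C.
  (* Points of the ball satisfy [modc (z - w) <= 2 d], and [2 d * N (c w) <= 2^-1]. *)
  pose d : R := (4 * (N (c w) + 1))^-1.
  have d0 : 0 < d by rewrite invr_gt0; have := seminorm_ge0 (c w); lra.
  exists (ball ((a, b) : R * R) d, [set M | 2 * N (c w) <= M]).
    split; first exact: nbhsx_ballx.
    by apply: nbhs_pinfty_ge; rewrite num_real.
  move=> [[a' b'] M] /= [[/= ha hb] hM].
  apply: le_trans hM; apply: resolvent_local_bound.
  have {}ha : `|a' - a| < d by rewrite distrC.
  have {}hb : `|b' - b| < d by rewrite distrC.
  have : modc ((a' +i* b')%C - w) <= d + d.
    have -> : (a' +i* b')%C - w = (a' - a)%:C%C + 'i%C * (b' - b)%:C%C.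
      by rewrite /w; simpc.
    apply: le_trans (modcD _ _) _; rewrite modcM !modcR.
    have -> : modc ('i%C : R[i]) = 1.
      by rewrite /modc normc_def /= expr0n expr1n add0r sqrtr1.
    by rewrite mul1r lerD // ltW.
  move=> h; apply: le_trans (ler_wpM2r (seminorm_ge0 _) h) _.
  rewrite /d; have h0 := seminorm_ge0 (c w).
  set n := N (c w) in h0 *.
  have -> : ((4 * (n + 1))^-1 + (4 * (n + 1))^-1) * n = 2^-1 * (n / (n + 1)) by field; lra.
  by rewrite ler_piMr ?invr_ge0 // ler_pdivrMr; lra.
move=> M [_ hM]; exists (M + 1) => z hz.
have := hM (M + 1); rewrite ltrDl ltr01 => /(_ isT (complex.Re z, complex.Im z)) /=.
have -> : (complex.Re z +i* complex.Im z)%C = z by case: z {hz}.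
apply; split => /=; rewrite in_itv /= -ler_norml.
  by apply: le_trans hz; exact: normRe_le.
by apply: le_trans hz; exact: normIm_le.
Qed.

(** A [2 ^ m]-th root of [-1]: multiplying the [2 ^ m]-th roots of unity by it gives the remaining
    [2 ^ m.+1]-th roots of unity, whence the recursion of [rickart]. *)
Fixpoint neg_root m : R[i] := if m is m'.+1 then sqrtc (neg_root m') else -1.

Lemma neg_rootX m : neg_root m ^+ (2 ^ m) = -1.
Proof.
elim: m => [|m IH]; first by rewrite expn0 expr1.
by rewrite expnS exprM sqr_sqrtc.
Qed.

Lemma modc_neg_root m : modc (neg_root m) = 1.
Proof.
have h : modc (neg_root m) ^+ (2 ^ m) = 1 by rewrite -modcX neg_rootX modcN modc1.
by apply/eqP; move/eqP: h; rewrite pexpr_eq1 ?modc_ge0 ?expn_gt0.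
Qed.

(* [rickart m z] is the average of [(1 - x / (w z))^-1] over the [2 ^ m]-th
   roots of unity [w], i.e. [(1 - (x / z) ^ 2 ^ m)^-1], modulo [null]. *)
Fixpoint rickart m z : A :=
  if m is m'.+1 then 2^-1 *: (rickart m' z + rickart m' (neg_root m' * z))
  else - z *: c z.

Lemma rickartE m z : z != 0 ->
  null ((1 - (z^-1 *: x) ^+ (2 ^ m)) * rickart m z - 1).
Proof.
elim: m z => [|m IH] z z0 /=.
  have -> : (1 - (z^-1 *: x) ^+ (2 ^ 0)) * (- z *: c z) - 1 = c z * (x - z%:A) - 1.
    rewrite expn0 expr1 -scalerAr mulrBl mul1r -scalerAl scalerBr scalerA.
    by rewrite mulNr divff // scaleN1r opprK mulrBr mulr_algr scaleNr [x * _]mulrC [- _ + _]addrC.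
  exact: cP.
set y := (z^-1 *: x) ^+ (2 ^ m).
have w0 : neg_root m != 0 by rewrite -modc_gt0 modc_neg_root.
have := IH _ (mulf_neq0 w0 z0); have := IH _ z0; rewrite -/y.
have -> : ((neg_root m * z)^-1 *: x) ^+ (2 ^ m) = - y.
  rewrite invfM -scalerA exprZn exprVn neg_rootX invrN1 scaleN1r.
  by [].
set g := rickart m z; set g' := rickart m _ => h h'.
have -> : (z^-1 *: x) ^+ (2 ^ m.+1) = y ^+ 2 by rewrite expnSr exprM.
(* This is [1 / (1 - y^2) = (1 / (1 - y) + 1 / (1 + y)) / 2], where [g] and [g'] invert [1 - y] and
   [1 + y] modulo [null]. *)
have -> : (1 - y ^+ 2) * (2^-1 *: (g + g')) - 1 =
    2^-1 *: ((1 + y) * ((1 - y) * g - 1) + (1 - y) * ((1 - - y) * g' - 1)).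
  apply: (@scalerI _ _ 2); first by rewrite pnatr_eq0.
  rewrite -scalerAr scalerBr !scalerA divff ?pnatr_eq0 // !scale1r.
  by rewrite scaler_nat; ring.
by apply: nullZ; apply: nullD; apply: nullMl.
Qed.

(** An average of quantities of size at most [e] has size at most [e]. The point is that the bound
    does not depend on [m]. *)
Lemma rickart_lip e r r' :
  (forall w, modc w = 1 -> N (rickart 0 (w * r%:C%C) - rickart 0 (w * r'%:C%C)) <= e) ->
  forall m w, modc w = 1 ->
    N (rickart m (w * r%:C%C) - rickart m (w * r'%:C%C)) <= e.
Proof.
move=> h; elim=> [|m IH] w w1; first exact: h.
rewrite /= -scalerBr NZ modcV.
have -> : modc 2 = 2 :> R.
  by have := modcR (2 : R); rewrite rmorph_nat ger0_norm.
rewrite ler_pdivrMl //.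
rewrite opprD addrACA; apply: le_trans (ND _ _) _.
rewrite !mulrA.
have := IH _ w1; have := IH (neg_root m * w); rewrite modcM w1 modc_neg_root mulr1.
by move=> /(_ erefl); set a := N _; set b := N _; lra.
Qed.

(** Once a power is below one half, repeated squaring drives its norm to 0. *)
Lemma null_pow_bound y m : N (y ^+ (2 ^ m)) < 2^-1 -> forall e, 0 < e ->
  exists m', N (y ^+ (2 ^ m')) < e.
Proof.
move=> h e e0.
have hk k : N (y ^+ (2 ^ (m + k))) <= (2^-1) ^+ k.+1.
  elim: k => [|k IH]; first by rewrite addn0 expr1 ltW.
  rewrite addnS expnSr exprM expr2 (le_trans (NM _ _)) //.
  have n0 := seminorm_ge0 (y ^+ (2 ^ (m + k))).
  apply: (@le_trans _ _ ((2^-1) ^+ k.+1 * (2^-1) ^+ k.+1)).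
    by rewrite ler_pM.
  rewrite [leRHS]exprSr ler_wpM2l ?exprn_ge0 ?invr_ge0 //.
  by rewrite exprS ler_piMr ?invr_ge0 // exprn_ile1 ?invr_ge0 // invf_le1 // ler1n.
have [k0 /(_ k0.+1 (leqnSn _)) hk'] := exp_half_lt e0.
by exists (m + k0)%N; apply: le_lt_trans hk'.
Qed.

(** [E] consists of the radii [r] for which the powers of [x / r] become small. For [r] in [E] the
    averages [G m r] come close to 1, and conversely an average close to 1 puts [r] in [E]. As the
    averages vary with [r] uniformly in [m], membership in [E] passes to slightly smaller radii;
    finitely many such steps lead from [R0] to a radius so small that all averages are close to
    0. *)
Lemma resolvent_false : False.
Proof.
pose G m (r : R) := rickart m (1 * r%:C%C).
pose R0 := 2 * N x + 1.
have x0 := seminorm_ge0 x.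
have R00 : 0 < R0 by rewrite /R0; lra.
have [B0 hB0] := resolvent_bound R0.
pose B := Num.max B0 1.
have B1 : 1 <= B by rewrite le_max lexx orbT.
have hB z : modc z <= R0 -> N (c z) <= B by move=> h; rewrite le_max hB0.
have modr w r : modc w = 1 -> 0 <= r -> modc (w * r%:C%C) = r.
  by move=> w1 r0; rewrite modcM w1 mul1r modcR ger0_norm.
pose E := [set r : R | 0 < r /\ exists m, N ((r%:C%C^-1 *: x) ^+ (2 ^ m)) < 2^-1].
have nz (r : R) : 0 < r -> r%:C%C != 0 :> R[i] by move=> r0; rewrite -modc_gt0 modcR normr_gt0 gt_eqF.
have GE m r : 0 < r -> null ((1 - (r%:C%C^-1 *: x) ^+ (2 ^ m)) * G m r - 1).
  by move=> r0; rewrite /G mul1r; apply: rickartE; exact: nz.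
have G1 r : E r -> forall e, 0 < e -> exists m, N (G m r - 1) <= e.
  move=> [r0 [m hm]] e e0.
  have [] := null_pow_bound hm (e := Num.min 2^-1 (e / (2 * N 1))).
    by rewrite lt_min invr_gt0 /= ltr0n /= divr_gt0 // mulr_gt0.
  move=> m'; rewrite lt_min => /andP[h1 h2]; exists m'.
  set Y := _ ^+ _ in h1 h2; have := GE m' r r0; rewrite -/Y; set g := G m' r => hn.
  have : N (g - 1) = N (Y * g).
    by apply: null_eq; congr null: hn; ring.
  have := NM Y g; have := seminorm_le g 1; have := seminorm_ge0 (g - 1).
  have := seminorm_ge0 Y; have := seminorm_ge0 g.
  move: h2; rewrite ltr_pdivlMr ?mulr_gt0 //.
  move: (N (g - 1)) (N g) (N Y) (N 1) (N (Y * g)) h1 => a b y o t h1 h2 b0 y0 a0 h3 h4 h5.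
  have : y * b <= y * (a + o) by rewrite ler_wpM2l.
  have : y * a <= 2^-1 * a by rewrite ler_wpM2r // ltW.
  lra.
have GE' m r : 0 < r -> N (G m r - 1) <= 4^-1 -> E r.
  move=> r0 h; split=> //; exists m.
  have := GE m r r0; set g := G m r in h *; set Y := _ ^+ _ => hn.
  (* From [(1 - Y) g = 1] one gets [Y = (1 - Y) (g - 1)], so [N Y <= (1 + N Y) / 4]. *)
  have : N Y = N ((g - 1) - Y * (g - 1)).
    apply: null_eq; have := nullN hn; congr null.
    ring.
  have := ND (g - 1) (- (Y * (g - 1))); rewrite seminormN.
  have := NM Y (g - 1); have := seminorm_ge0 Y; have := seminorm_ge0 (g - 1).
  set y := N Y; set a := N (g - 1) in h *; nra.
have low r : 0 < r -> r <= R0 -> r * B <= N 1 / 4 -> ~ E r.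
  move=> r0 rR hr Er.
  have [|m hm] := G1 _ Er (N 1 / 4); first by rewrite divr_gt0.
  have hG : forall m' w, modc w = 1 -> N (rickart m' (w * r%:C%C)) <= N 1 / 4.
    elim=> [|m' IH] w w1 /=.
      rewrite NZ modcN modr ?(ltW r0) //; apply: le_trans hr.
      by rewrite ler_wpM2l ?(ltW r0) // hB // modr ?(ltW r0).
    rewrite NZ modcV.
    have -> : modc 2 = 2 :> R.
      by have := modcR (2 : R); rewrite rmorph_nat ger0_norm.
    rewrite ler_pdivrMl //; apply: le_trans (ND _ _) _.
    have := IH _ w1; have := IH (neg_root m' * w).
    rewrite modcM modc_neg_root w1 mulr1 mulrA => /(_ erefl).
    by set u := N _; set v := N _; lra.
  have := hG m 1 (modc1 R); rewrite -/(G m r).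
  have := seminorm_le 1 (G m r); rewrite seminormB.
  have := N1; lra.
(* A Lipschitz constant of [z -> z c z] on the disc of radius [R0], from the resolvent identity. *)
pose L := B + R0 * (B * B).
have L0 : 0 < L.
  rewrite /L ltr_pwDl ?(lt_le_trans ltr01) //.
  by rewrite !mulr_ge0 ?(ltW R00) // (le_trans ler01).
have step r r' : E r -> r <= R0 -> 0 < r' -> r' <= r -> (r - r') * L <= 8^-1 -> E r'.
  move=> Er rR r'0 rr' hr; have [r0 _] := Er.
  have [] := G1 _ Er 8^-1; first by rewrite invr_gt0.
  move=> m hm; apply: (GE' m) => //.
  have : N (G m r - G m r') <= 8^-1.
    apply: rickart_lip (modc1 R) => w w1 /=.
    set z := w * r%:C%C; set z' := w * r'%:C%C.
    have -> : - z *: c z - - z' *: c z' = - ((z - z') *: c z + z' *: (c z - c z')).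
      by rewrite scalerBl scalerBr !scaleNr; ring.
    rewrite seminormN; apply: le_trans (ND _ _) _; rewrite !NZ.
    have zz' : modc (z - z') = r - r'.
      by rewrite -mulrBr -rmorphB /= modr // subr_ge0.
    have z1 : modc z <= R0 by rewrite modr // ltW.
    have z2 : modc z' <= R0 by rewrite modr ?(ltW r'0) //; apply: le_trans rR.
    have := resolvent z z'; rewrite zz' => hres.
    apply: le_trans hr; rewrite /L mulrDr; apply: lerD.
      by rewrite ler_wpM2l ?subr_ge0 // hB.
    apply: le_trans (_ : R0 * ((r - r') * (B * B)) <= _); last by rewrite mulrCA.
    apply: ler_pM; rewrite ?modc_ge0 ?seminorm_ge0 //.
    apply: le_trans hres _; rewrite ler_wpM2l ?subr_ge0 //.
    by apply: ler_pM; rewrite ?seminorm_ge0 ?hB.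
  have := seminorm_le (G m r' - 1) (G m r - 1).
  have -> : G m r' - 1 - (G m r - 1) = - (G m r - G m r') by ring.
  rewrite seminormN; lra.
have E0 : E R0.
  split=> //; exists 0%N; rewrite expn0 expr1 NZ modcV modcR ger0_norm ?(ltW R00) //.
  rewrite mulrC ltr_pdivrMr // /R0; lra.
(* The first summand makes one step of length [R0 / n] admissible in [step], the second makes the
   last radius [R0 / n] satisfy [low]. *)
have [n hn] : exists n : nat, 8 * (R0 * L) + 4 * (R0 * B) / N 1 < n%:R.
  by exists (Num.trunc (8 * (R0 * L) + 4 * (R0 * B) / N 1)).+1; exact: truncnS_gt.
have p1 : 0 <= 8 * (R0 * L) by rewrite !mulr_ge0 ?(ltW R00) ?(ltW L0).
have p2 : 0 <= 4 * (R0 * B) / N 1.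
  by rewrite divr_ge0 ?(ltW N1) // !mulr_ge0 ?(ltW R00) // (le_trans ler01).
have n0 : 0 < n%:R :> R by lra.
have Ek k : (k < n)%N -> E (R0 * ((n - k)%:R / n%:R)).
  elim: k => [_|k IH kn]; first by rewrite subn0 divff ?mulr1 // gt_eqF.
  have {IH} := IH (ltnW kn).
  move=> Er; apply: step Er _ _ _ _.
  - rewrite ler_piMr ?(ltW R00) // ler_pdivrMr // mul1r ler_nat leq_subr //.
  - by rewrite mulr_gt0 // divr_gt0 // ltr0n subn_gt0.
  - rewrite ler_wpM2l ?(ltW R00) // ler_wpM2r ?invr_ge0 ?(ltW n0) //.
    by rewrite ler_nat leq_sub2l.
  rewrite -mulrBr -mulrBl -natrB ?leq_sub2l //.
  have -> : (n - k - (n - k.+1) = 1)%N by lia.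
  rewrite mul1r mulrAC ler_pdivrMr //; lra.
have n1 : (0 < n)%N by rewrite -(ltr0n R).
have := Ek n.-1; rewrite prednK // leqnn => /(_ isT).
have -> : (n - n.-1 = 1)%N by lia.
apply: low.
- by rewrite mulr_gt0 // divr_gt0.
- rewrite ler_piMr ?(ltW R00) // ler_pdivrMr // mul1r ler_nat //.
rewrite mul1r mulrAC ler_pdivrMr // mulrAC.
have : 4 * (R0 * B) / N 1 <= n%:R by lra.
rewrite ler_pdivrMr //; lra.
Qed.

End Rickart.

(** * Gelfand theory: maximal ideals, characters and the spectrum *)

Section BanachAlgebra.
Variables (R : realType) (A : comBanachAlgType R).
Implicit Types (x y a : A) (I J : {pred A}).

Local Notation N := (@bnorm R A).

Lemma bnorm0 : N 0 = 0.
Proof. by rewrite -(scale0r 0) bnormZ normr0 mul0r. Qed.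

Lemma bnormN x : N (- x) = N x.
Proof. by rewrite -scaleN1r bnormZ normrN normr1 mul1r. Qed.

Lemma bnorm_ge0 x : 0 <= N x.
Proof. by have := bnormD x (- x); rewrite subrr bnorm0 bnormN; lra. Qed.

Lemma bnormX x n : N (x ^+ n) <= N 1 * N x ^+ n.
Proof.
elim: n => [|n IH]; first by rewrite !expr0 mulr1.
rewrite !exprSr mulrA; apply: le_trans (bnormM _ _) _.
by rewrite ler_wpM2r ?bnorm_ge0.
Qed.

(** The partial sums of the geometric series are Cauchy, and their limit inverts [1 - y]. The factor
    [N 1] in the estimates comes from the norm of [1] being arbitrary. *)
Lemma neumann y : N y < 1 -> 1 - y \is a GRing.unit.
Proof.
move=> y1; have y0 := bnorm_ge0 y.
pose s n := \sum_(i < n) y ^+ i.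
have sE n : (1 - y) * s n = 1 - y ^+ n.
  by rewrite -[in RHS](expr1n A n) subrXX; congr (_ * _); apply: eq_bigr => i _; rewrite expr1n mul1r.
have one0 := bnorm_ge0 1.
have tail m k : N (s (m + k) - s m) <= N 1 * N y ^+ m / (1 - N y).
  rewrite /s big_split_ord /= [X in N (X - _)]addrC addrK.
  rewrite ler_pdivlMr ?subr_gt0 //.
  have h : N (\sum_(i < k) y ^+ (m + i)) <= N 1 * N y ^+ m * \sum_(i < k) N y ^+ i.
    elim: k => [|k IH]; first by rewrite !big_ord0 bnorm0 mulr0.
    rewrite !big_ord_recr /= mulrDr; apply: le_trans (bnormD _ _) _.
    by rewrite lerD // -mulrA -exprD bnormX.
  apply: le_trans (ler_wpM2r _ h) _; first by rewrite subr_ge0 ltW.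
  rewrite -(mulrA (N 1 * N y ^+ m)); apply: ler_piMr; rewrite ?mulr_ge0 ?exprn_ge0 //.
  have := subrXX (1 : R) (N y) k; rewrite expr1n.
  under eq_bigr do rewrite expr1n mul1r.
  by move=> e; rewrite mulrC -e gerBl exprn_ge0.
have small e : 0 < e -> \forall n \near \oo, N 1 * N y ^+ n / (1 - N y) < e.
  move=> e0.
  have h : (N 1 * N y ^+ n / (1 - N y)) @[n --> \oo] --> (0 : R).
    rewrite -[X in _ --> X](mul0r (1 - N y)^-1) -[X in X * _](mulr0 (N 1)).
    apply: cvgMl; apply: cvgMr; apply: cvg_expr; rewrite ger0_norm //.
  by have /cvgrPdist_lt /(_ e e0) := h; apply: filterS => n; rewrite sub0r normrN; exact/le_lt_trans/ler_norm.
have [] := @bnorm_complete R A s.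
  move=> e e0.
  have e20 : 0 < e / 2 by rewrite divr_gt0.
  have [M _ hM] := small _ e20.
  exists ([set n | (M <= n)%N], [set n | (M <= n)%N]).
    by split; exists M.
  have key n : (M <= n)%N -> N (s n - s M) < e / 2.
    move=> hn; rewrite -(subnKC hn); apply: le_lt_trans (tail _ _) _.
    by apply: hM => /=.
  move=> [m n] /= [hm hn].
  have -> : s m - s n = (s m - s M) - (s n - s M) by ring.
  apply: le_lt_trans (bnormD _ _) _; rewrite bnormN.
  by rewrite (splitr e) ltrD // key.
move=> l hl.
apply/unitrP; exists l.
suff e : l * (1 - y) - 1 = 0.
  by move/eqP: e; rewrite subr_eq0 => /eqP e; rewrite [(1 - y) * l]mulrC.
apply: bnorm_eq0; apply/eqP; rewrite eq_le bnorm_ge0 andbT.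
apply/ler_addgt0Pr => e e0; rewrite add0r.
pose K := N (1 - y) + 1.
have K0 : 0 < K by rewrite /K ltr_wpDl ?bnorm_ge0.
have d0 : 0 < e / 2 / K by rewrite !divr_gt0.
have /cvgrPdist_lt /(_ _ d0) h1 := hl.
have h2 := small (e / 2).
have {h2}[|M _ h2] := h2; first by rewrite divr_gt0.
case: h1 => M' _ h1.
pose n := maxn M M'.
have {}h1 : N (s n - l) < e / 2 / K.
  have := h1 n; rewrite /= leq_maxr sub0r normrN => /(_ isT).
  exact/le_lt_trans/ler_norm.
have {}h2 := h2 n; rewrite /= leq_maxl in h2; have {}h2 := h2 isT.
have -> : l * (1 - y) - 1 = - ((1 - y) * (s n - l)) - y ^+ n.
  by rewrite [(1 - y) * (s n - l)]mulrBr sE; ring.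
apply: le_trans (bnormD _ _) _; rewrite !bnormN.
have := bnormM (1 - y) (s n - l); have := bnormX y n.
have : N (1 - y) * N (s n - l) <= e / 2.
  apply: le_trans (_ : K * (e / 2 / K) <= _); last by rewrite mulrCA divff ?mulr1 // gt_eqF.
  by rewrite ler_pM ?bnorm_ge0 ?(ltW h1) // lerDl.
have : N 1 * N y ^+ n <= e / 2.
  apply: le_trans (ltW h2); rewrite ler_pdivlMr ?subr_gt0 //.
  by apply: ler_piMr; rewrite ?mulr_ge0 ?exprn_ge0 // gerBl.
lra.
Qed.

Section Ideal.
Variable I : {pred A}.
Hypothesis cI : idealr_closed I.

Lemma ideal0 : 0 \in I. Proof. by have [] := cI. Qed.

Lemma idealMD a x y : x \in I -> y \in I -> a * x + y \in I.
Proof. by case: cI => _ _ h xI yI; exact: h. Qed.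

Lemma idealM a x : x \in I -> a * x \in I.
Proof. by move=> xI; rewrite -[_ * _]addr0 idealMD // ideal0. Qed.

Lemma idealD x y : x \in I -> y \in I -> x + y \in I.
Proof. by move=> xI yI; rewrite -[x]mul1r idealMD. Qed.

Lemma idealN x : x \in I -> - x \in I.
Proof. by move=> xI; rewrite -mulN1r idealM. Qed.

Lemma idealB x y : x \in I -> y \in I -> x - y \in I.
Proof. by move=> xI yI; rewrite idealD ?idealN. Qed.

Lemma idealr_unit x : x \in I -> x \isn't a GRing.unit.
Proof.
move=> xI; apply/negP => xu; have [_ /negP I1 _] := cI; apply: I1.
by rewrite -(mulVr xu) idealM.
Qed.

Lemma scalar_unit (z : R[i]) : z != 0 -> (z%:A : A) \is a GRing.unit.
Proof.
move=> z0; apply/unitrP; exists (z^-1)%:A.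
by rewrite !mulr_algl !scalerA mulVf ?divff // scale1r.
Qed.

Lemma ideal_scalar (z : R[i]) : (z%:A : A) \in I -> z = 0.
Proof.
by move=> zI; apply/eqP/negPn/negP => /scalar_unit; apply/negP/idealr_unit.
Qed.

(** The norm of the quotient by [I], kept as a seminorm on [A] so that no quotient algebra has to be
    formed. *)
Definition quotient_norm x : R := inf [set N (x + i) | i in [set i | i \in I]].

Lemma quotient_norm_le x i : i \in I -> quotient_norm x <= N (x + i).
Proof.
move=> iI; apply: ge_inf; last by exists i.
by exists 0 => _ [j _ <-]; exact: bnorm_ge0.
Qed.

Lemma quotient_norm_ge x (r : R) :
  (forall i, i \in I -> r <= N (x + i)) -> r <= quotient_norm x.
Proof.
move=> h; apply: lb_le_inf; last by move=> _ [j jI <-]; exact: h.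
by exists (N (x + 0)), 0 => //; exact: ideal0.
Qed.

Lemma quotient_norm_ge0 x : 0 <= quotient_norm x.
Proof. by apply: quotient_norm_ge => i _; exact: bnorm_ge0. Qed.

Lemma quotient_normD x y : quotient_norm (x + y) <= quotient_norm x + quotient_norm y.
Proof.
rewrite -lerBlDr; apply: quotient_norm_ge => i iI.
rewrite lerBlDr -lerBlDl; apply: quotient_norm_ge => j jI.
rewrite lerBlDl; apply: le_trans (bnormD _ _).
by rewrite addrACA; apply: quotient_norm_le; rewrite idealD.
Qed.

Lemma quotient_norm_geM x (r b : R) : 0 <= b ->
  (forall i, i \in I -> r <= N (x + i) * b) -> r <= quotient_norm x * b.
Proof.
rewrite le_eqVlt => /predU1P[<-|b0] h.
  by have := h _ ideal0; rewrite !mulr0.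
rewrite -ler_pdivrMr //; apply: quotient_norm_ge => i iI.
by rewrite ler_pdivrMr // h.
Qed.

Lemma quotient_normM x y : quotient_norm (x * y) <= quotient_norm x * quotient_norm y.
Proof.
apply: quotient_norm_geM (quotient_norm_ge0 _) _ => i iI.
rewrite [leRHS]mulrC; apply: quotient_norm_geM (bnorm_ge0 _) _ => j jI.
rewrite [leRHS]mulrC; apply: le_trans (bnormM _ _).
have -> : (x + i) * (y + j) = x * y + ((x + i) * j + y * i) by ring.
by apply: quotient_norm_le; rewrite idealD ?idealM.
Qed.

Lemma quotient_normZ (c : R[i]) x : quotient_norm (c *: x) = modc c * quotient_norm x.
Proof.
have le z y : quotient_norm (z *: y) <= modc z * quotient_norm y.
  rewrite mulrC; apply: quotient_norm_geM (modc_ge0 _) _ => i iI.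
  rewrite mulrC -bnormZ scalerDr; apply: quotient_norm_le.
  by rewrite -mulr_algl idealM.
apply/eqP; rewrite eq_le le /=; have [->|c0] := eqVneq c 0.
  by rewrite modc0 mul0r quotient_norm_ge0.
rewrite -ler_pdivlMl ?modc_gt0 // -modcV; apply: le_trans (le _ _).
by rewrite scalerA mulVf // scale1r.
Qed.

(** If [N (1 + i) < 1], then [- i = 1 - (1 + i)] would be a unit in the ideal. *)
Lemma quotient_norm1 : 0 < quotient_norm 1.
Proof.
apply: lt_le_trans ltr01 _; apply: quotient_norm_ge => i iI.
rewrite leNgt; apply/negP => /neumann.
rewrite opprD addNKr; apply/negP; apply: idealr_unit; exact: idealN.
Qed.

Lemma quotient_norm_ideal x : x \in I -> quotient_norm x = 0.
Proof.
move=> xI; apply/eqP; rewrite eq_le quotient_norm_ge0 andbT.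
by apply: le_trans (quotient_norm_le _ (idealN xI)) _; rewrite subrr bnorm0.
Qed.

End Ideal.

(** Otherwise the ideal generated by [I] and [x] would be proper, against maximality. *)
Lemma maximal_ideal_inv I x : maximal_ideal I -> x \notin I ->
  exists c, c * x - 1 \in I.
Proof.
move=> [cI mI] xI; apply: contrapT => h.
pose J : {pred A} := [pred v | `[< exists a i, i \in I /\ v = a * x + i >]].
have JP v : reflect (exists a i, i \in I /\ v = a * x + i) (v \in J) by exact: asboolP.
have cJ : idealr_closed J.
  split.
  - by apply/JP; exists 0, 0; rewrite mul0r addr0; split=> //; exact: ideal0.
  - apply/negP => /JP[a [i [iI e]]]; apply: h; exists a.
    by rewrite e opprD addNKr; exact: idealN.
  move=> b u v /JP[a [i [iI ->]]] /JP[a' [i' [iI' ->]]]; apply/JP.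
  by exists (b * a + a'), (b * i + i'); split; [exact: idealMD|ring].
have IJ : {subset I <= J}.
  by move=> v vI; apply/JP; exists 0, v; rewrite mul0r add0r.
move/negP: xI; apply; apply: (mI J) => //; apply/JP; exists 1, 0.
by rewrite mul1r addr0; split=> //; exact: ideal0.
Qed.

(** If no scalar worked, [x - z] would be invertible modulo [I] for every [z], which
    [resolvent_false] excludes. *)
Lemma maximal_ideal_scalar I x : maximal_ideal I -> exists z, x - z%:A \in I.
Proof.
move=> mI; have [cI _] := mI; apply: contrapT => /forallNP h.
have /choice[c cP] : forall z : R[i], exists c, c * (x - z%:A) - 1 \in I.
  by move=> z; apply: maximal_ideal_inv => //; apply/negP/h.
apply: (@resolvent_false R A (quotient_norm I) _ _ _ _ x c).
- exact: quotient_normD.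
- exact: quotient_normZ.
- exact: quotient_normM.
- exact: quotient_norm1.
by move=> z; exact: quotient_norm_ideal.
Qed.

Lemma charP (chi : max_ideal_space A) :
  scalar (\val chi : A -> R[i]) /\ monoid_morphism (\val chi : A -> R[i]).
Proof. by have := set_mem (valP chi). Qed.

Lemma gelfandZD (c : R[i]) x y (chi : max_ideal_space A) :
  gelfand (c *: x + y) chi = c * gelfand x chi + gelfand y chi.
Proof. by have [h _] := charP chi; exact: h. Qed.

Lemma gelfand1 (chi : max_ideal_space A) : gelfand 1 chi = 1.
Proof. by have [_ [h _]] := charP chi. Qed.

Lemma gelfandM x y (chi : max_ideal_space A) :
  gelfand (x * y) chi = gelfand x chi * gelfand y chi.
Proof. by have [_ [_ h]] := charP chi; exact: h. Qed.

Lemma gelfandD x y (chi : max_ideal_space A) :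
  gelfand (x + y) chi = gelfand x chi + gelfand y chi.
Proof. by rewrite -{1}[x]scale1r gelfandZD mul1r. Qed.

Lemma gelfand0 (chi : max_ideal_space A) : gelfand 0 chi = 0.
Proof. by apply: (addIr (gelfand 0 chi)); rewrite -gelfandD !add0r. Qed.

Lemma gelfandZ (c : R[i]) x (chi : max_ideal_space A) :
  gelfand (c *: x) chi = c * gelfand x chi.
Proof. by rewrite -[_ *: _]addr0 gelfandZD gelfand0 addr0. Qed.

Lemma gelfandN x (chi : max_ideal_space A) : gelfand (- x) chi = - gelfand x chi.
Proof. by rewrite -scaleN1r gelfandZ mulN1r. Qed.

Lemma gelfandB x y (chi : max_ideal_space A) :
  gelfand (x - y) chi = gelfand x chi - gelfand y chi.
Proof. by rewrite gelfandD gelfandN. Qed.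

Lemma gelfand_scalar (c : R[i]) (chi : max_ideal_space A) : gelfand c%:A chi = c.
Proof. by rewrite gelfandZ gelfand1 mulr1. Qed.

Lemma gelfandX x n (chi : max_ideal_space A) : gelfand (x ^+ n) chi = gelfand x chi ^+ n.
Proof. by elim: n => [|n IH]; rewrite ?gelfand1 // !exprS gelfandM IH. Qed.

Lemma gelfand_unit x (chi : max_ideal_space A) :
  x \is a GRing.unit -> gelfand x chi != 0.
Proof.
move=> xu; apply/eqP => x0; have := gelfandM x x^-1 chi.
by rewrite divrr // gelfand1 x0 mul0r => /eqP; rewrite oner_eq0.
Qed.

Lemma gelfandV x (chi : max_ideal_space A) :
  x \is a GRing.unit -> gelfand x^-1 chi = (gelfand x chi)^-1.
Proof.
move=> xu; apply: (mulfI (gelfand_unit chi xu)).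
by rewrite -gelfandM divrr // gelfand1 divff // gelfand_unit.
Qed.

Lemma mk_char (f : A -> R[i]) : scalar f -> monoid_morphism f ->
  exists chi : max_ideal_space A, forall x, gelfand x chi = f x.
Proof.
move=> lf mf; have fC : (f : {ptws A -> R[i]^o}) \in characters A by rewrite inE; split.
by exists (exist _ (f : {ptws A -> R[i]^o}) fC).
Qed.

(** The character sends [x] to the scalar congruent to it modulo [I]; uniqueness of that scalar
    yields linearity and multiplicativity. *)
Lemma maximal_ideal_char I : maximal_ideal I ->
  exists chi : max_ideal_space A, forall x, (x \in I) = (gelfand x chi == 0).
Proof.
move=> mI; have [cI _] := mI.
have /choice[f fP] : forall x, exists z, x - z%:A \in I.
  by move=> x; exact: maximal_ideal_scalar.
have fE x z : x - z%:A \in I -> f x = z.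
  move=> h; apply/eqP; rewrite -subr_eq0; apply/eqP; apply: (ideal_scalar cI).
  have -> : (f x - z)%:A = (x - z%:A) - (x - (f x)%:A) :> A by rewrite scalerBl; ring.
  by rewrite idealB.
have [] := @mk_char f.
- move=> c u v; apply: fE.
  have -> : c *: u + v - (c * f u + f v)%:A = c%:A * (u - (f u)%:A) + (v - (f v)%:A).
    by rewrite scalerDl -scalerA mulrBr !mulr_algl; ring.
  exact: idealMD.
- split; first by apply: fE; rewrite scale1r subrr; exact: ideal0.
  move=> u v; apply: fE.
  have -> : u * v - (f u * f v)%:A = v * (u - (f u)%:A) + (f u)%:A * (v - (f v)%:A).
    by rewrite -scalerA !mulrBr !mulr_algl mulr_algr; ring.
  by rewrite idealD ?idealM.
move=> chi chiE; exists chi => x; rewrite chiE; apply/idP/eqP => [xI|fx0].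
  by apply: fE; rewrite scale0r subr0.
by have := fP x; rewrite fx0 scale0r subr0.
Qed.

Lemma maximal_ideal_exists x : x \isn't a GRing.unit ->
  exists2 I : {pred A}, maximal_ideal I & x \in I.
Proof.
move=> xu.
(* Zorn's lemma on the proper ideals containing [x]. The principal ideal [I0] bounds the empty
   chain. *)
pose T := {I : A -> bool | idealr_closed [pred v | I v] /\ I x}.
pose r (s t : T) := `[< forall v, projT1 s v -> projT1 t v >].
pose I0 : A -> bool := fun v => `[< exists a, v = a * x >].
have I0P v : reflect (exists a, v = a * x) (I0 v) by exact: asboolP.
have I0c : idealr_closed [pred v | I0 v] /\ I0 x.
  split; last by apply/I0P; exists 1; rewrite mul1r.
  split; first by apply/I0P; exists 0; rewrite mul0r.
    apply/negP => /I0P[a e]; move/negP: xu; apply; apply/unitrP; exists a.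
    by rewrite [x * a]mulrC -e.
  by move=> b u v /I0P[a ->] /I0P[a' ->]; apply/I0P; exists (b * a + a'); ring.
have [] := @ZL_preorder T (exist _ I0 I0c) r.
- by move=> t; apply/asboolP.
- by move=> a b c /asboolP h1 /asboolP h2; apply/asboolP => v /h1/h2.
- move=> C tot; have [[s0 Cs0]|C0] := pselect (exists s, C s); last first.
    by exists (exist _ I0 I0c) => s Cs; case: C0; exists s.
  pose J : A -> bool := fun v => `[< exists2 s : T, C s & projT1 s v >].
  have JP v : reflect (exists2 s : T, C s & projT1 s v) (J v) by exact: asboolP.
  have Jc : idealr_closed [pred v | J v] /\ J x.
    split; last by apply/JP; exists s0 => //; have [] := projT2 s0.
    split.
    - by apply/JP; exists s0 => //; have [[]] := projT2 s0.
    - by apply/negP => /JP[s _]; have [[_ /negP h _] _] := projT2 s.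
    move=> b u v /JP[s Cs us] /JP[t Ct vt]; apply/JP.
    have [[_ _ cs] _] := projT2 s; have [[_ _ ct] _] := projT2 t.
    have [/asboolP h|/asboolP h] := tot _ _ Cs Ct.
      by exists t => //; apply: ct => //; exact: h.
    by exists s => //; apply: cs => //; exact: h.
  by exists (exist _ J Jc) => s Cs; apply/asboolP => v vs /=; apply/JP; exists s.
move=> [I [cI xI]] mI; exists (I : {pred A}) => //; split=> // J cJ IJ.
have xJ := IJ _ xI.
have cJ' : idealr_closed [pred v | (v \in J)] by [].
by have /asboolP :=
  mI (exist (fun I => idealr_closed [pred v | I v] /\ I x) (fun v => v \in J) (conj cJ' xJ)) (asboolT IJ).
Qed.

Lemma unit_char x :
  (forall chi : max_ideal_space A, gelfand x chi != 0) -> x \is a GRing.unit.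
Proof.
move=> h; apply/negPn/negP => /maximal_ideal_exists[I /maximal_ideal_char[chi hchi] xI].
by have := h chi; rewrite -hchi xI.
Qed.

Lemma char_exists : exists chi : max_ideal_space A, True.
Proof.
have /maximal_ideal_exists[I /maximal_ideal_char[chi _] _] : (0 : A) \isn't a GRing.unit.
  by rewrite unitr0.
by exists chi.
Qed.

(** If [z = chi x] exceeded [N x], then [1 - x / z] would be a unit by the Neumann series, although
    [chi] kills it. *)
Lemma char_bound x (chi : max_ideal_space A) : modc (gelfand x chi) <= N x.
Proof.
rewrite leNgt; apply/negP => h; set z := gelfand x chi in h.
have z0 : z != 0 by rewrite -modc_gt0; apply: le_lt_trans h; exact: bnorm_ge0.
have /neumann/(gelfand_unit chi) : N (z^-1 *: x) < 1.
  by rewrite bnormZ -/(modc _) modcV mulrC ltr_pdivrMr ?modc_gt0 // mul1r.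
by rewrite gelfandB gelfand1 gelfandZ mulVf // subrr eqxx.
Qed.

Lemma spectrumE x : spectrum x = range (gelfand x).
Proof.
apply/seteqP; split=> [z /= h|z [chi _ <-]].
  apply: contrapT => h'; move/negP: h; apply; apply: unit_char => chi.
  by rewrite gelfandB gelfand_scalar subr_eq0; apply/eqP => e; apply: h'; exists chi.
apply/negP => /= /(gelfand_unit chi).
by rewrite gelfandB gelfand_scalar subrr eqxx.
Qed.

Lemma kernel_maximal (chi : max_ideal_space A) :
  maximal_ideal [pred x | gelfand x chi == 0].
Proof.
split.
  split; rewrite ?inE ?gelfand0 ?gelfand1 ?oner_eq0 //.
  move=> a u v; rewrite !inE => /eqP hu /eqP hv.
  by rewrite gelfandD gelfandM hu hv mulr0 addr0.
move=> J cJ kJ x xJ; rewrite inE.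
have h : x - (gelfand x chi)%:A \in J.
  by apply: kJ; rewrite inE gelfandB gelfand_scalar subrr.
apply/eqP/(ideal_scalar cJ).
by rewrite -[_%:A](subKr x) idealB.
Qed.

Lemma semisimpleP : semisimple A <->
  forall x, (forall chi : max_ideal_space A, gelfand x chi = 0) -> x = 0.
Proof.
split=> h x hx.
  by apply: h => I /maximal_ideal_char[chi ->]; rewrite hx.
by apply: h => chi; have /eqP := hx _ (kernel_maximal chi).
Qed.

End BanachAlgebra.

(** * Sup norms *)

Section SupNorm.
Variables (R : realType) (X : Type) (x0 : X).
Implicit Types f g : X -> R[i].

Definition fbounded f := exists M : R, forall x, modc (f x) <= M.

Lemma sup_norm_ge f x : fbounded f -> modc (f x) <= sup_norm f.
Proof.
move=> [M hM]; apply: ub_le_sup; last by exists x.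
by exists M => _ [y _ <-]; exact: hM.
Qed.

Lemma sup_norm_le f (M : R) : (forall x, modc (f x) <= M) -> sup_norm f <= M.
Proof.
move=> h; apply: ge_sup; last by move=> _ [y _ <-]; exact: h.
by exists (modc (f x0)), x0.
Qed.

End SupNorm.

(** * The spectral radius as a seminorm, and the uniform algebra [cl A] *)

Section SpectralNorm.
Variables (R : realType) (A : comBanachAlgType R).
Implicit Types (a b : A) (x : max_ideal_space A).

Lemma gelfand_bounded a : fbounded (@gelfand R A a).
Proof. by exists (bnorm a); exact: char_bound. Qed.

Lemma spectral_radiusE a : spectral_radius a = sup_norm (gelfand a).
Proof.
rewrite /spectral_radius spectrumE /sup_norm; congr sup; apply/seteqP; split.
  by move=> _ [_ [x _ <-] <-]; exists x.
by move=> _ [x _ <-]; exists (gelfand a x) => //; exists x.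
Qed.

Local Notation r := (@spectral_radius R A).

Lemma gelfand_le a x : modc (gelfand a x) <= r a.
Proof. by rewrite spectral_radiusE; apply: sup_norm_ge; exact: gelfand_bounded. Qed.

Lemma radius_le a (M : R) : (forall x, modc (gelfand a x) <= M) -> r a <= M.
Proof. by have [x0 _] := char_exists A; rewrite spectral_radiusE; exact: sup_norm_le. Qed.

Lemma radius_ge0 a : 0 <= r a.
Proof. by have [x0 _] := char_exists A; apply: le_trans (gelfand_le a x0); exact: modc_ge0. Qed.

Lemma radiusD a b : r (a + b) <= r a + r b.
Proof.
apply: radius_le => x; rewrite gelfandD; apply: le_trans (modcD _ _) _.
by rewrite lerD ?gelfand_le.
Qed.

Lemma radiusM a b : r (a * b) <= r a * r b.
Proof.
by apply: radius_le => x; rewrite gelfandM modcM ler_pM ?modc_ge0 ?gelfand_le.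
Qed.

Lemma radiusN a : r (- a) = r a.
Proof.
apply/eqP; rewrite eq_le; apply/andP; split; apply: radius_le => x.
  by rewrite gelfandN modcN gelfand_le.
by rewrite -modcN -gelfandN gelfand_le.
Qed.

Lemma radiusB a b : r (a - b) = r (b - a).
Proof. by rewrite -radiusN opprB. Qed.

Lemma radiusZ (c : R[i]) a : r (c *: a) = modc c * r a.
Proof.
have le z b : r (z *: b) <= modc z * r b.
  by apply: radius_le => x; rewrite gelfandZ modcM ler_wpM2l ?modc_ge0 ?gelfand_le.
apply/eqP; rewrite eq_le le /=; have [->|c0] := eqVneq c 0.
  by rewrite modc0 mul0r radius_ge0.
rewrite -ler_pdivlMl ?modc_gt0 // -modcV; apply: le_trans (le _ _).
by rewrite scalerA mulVf // scale1r.
Qed.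

Lemma spectral_radius0 : r 0 = 0.
Proof. by rewrite -(scale0r 0) radiusZ modc0 mul0r. Qed.

Lemma radius1 : r 1 = 1.
Proof.
have [x0 _] := char_exists A; apply/eqP; rewrite eq_le; apply/andP; split.
  by apply: radius_le => x; rewrite gelfand1 modc1.
by have := gelfand_le 1 x0; rewrite gelfand1 modc1.
Qed.

Lemma radius_le_sub a b : r a <= r (a - b) + r b.
Proof. by rewrite -{1}(subrK b a) radiusD. Qed.

Lemma radiusX a n : r (a ^+ n) <= r a ^+ n.
Proof.
by apply: radius_le => x; rewrite gelfandX modcX lerXn2r ?nnegrE ?modc_ge0 ?radius_ge0 ?gelfand_le.
Qed.

Lemma radius_unit a : r a < 1 -> 1 + a \is a GRing.unit.
Proof.
move=> ra; apply: unit_char => x; rewrite gelfandD gelfand1.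
apply/eqP => /eqP; rewrite addr_eq0 => /eqP e.
by have := gelfand_le a x; rewrite -modcN -e modc1 leNgt ra.
Qed.

Lemma radius_eq0 a : semisimple A -> r a = 0 -> a = 0.
Proof.
move=> /semisimpleP ss ra; apply: ss => x; apply/eqP; rewrite -modc_eq0.
by rewrite eq_le modc_ge0 andbT -ra gelfand_le.
Qed.

Lemma gelfand_inj a b : semisimple A -> (forall x, gelfand a x = gelfand b x) -> a = b.
Proof.
move=> /semisimpleP ss h; apply/eqP; rewrite -subr_eq0; apply/eqP/ss => x.
by rewrite gelfandB h subrr.
Qed.

Lemma char_sep x y : x <> y -> exists a, gelfand a x = 1 /\ gelfand a y = 0.
Proof.
move=> xy; have [a axy] : exists a, gelfand a x <> gelfand a y.
  apply: contrapT => /forallNP h; apply: xy.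
  apply: eq_sig_hprop => [? ? ?|]; first exact: Prop_irrelevance.
  by apply/funext => a; exact: contrapT (h a).
have d0 : gelfand a x - gelfand a y != 0 by rewrite subr_eq0; exact/eqP.
exists ((gelfand a x - gelfand a y)^-1 *: (a - (gelfand a y)%:A)).
by rewrite !gelfandZ !gelfandB !gelfand_scalar subrr mulr0 mulVf.
Qed.

Lemma gelfand_continuous a : continuous (gelfand a : max_ideal_space A -> R[i]^o).
Proof.
move=> x; apply: (@continuous_comp _ _ _ (\val : max_ideal_space A -> {ptws A -> R[i]^o}) (fun f => f a)).
  exact: initial_continuous.
exact: (@proj_continuous A (fun=> R[i]^o : topologicalType) a).
Qed.

(** The universal property of the Gelfand topology, which is initial for the transforms. *)
Lemma continuous_max_ideal (Z : topologicalType) (phi : Z -> max_ideal_space A) :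
  (forall a, continuous (fun z => gelfand a (phi z) : R[i]^o)) -> continuous phi.
Proof.
move=> h z U /= [_ [[W oW <-] Wz] WU].
suff : nbhs z (fun z => W (\val (phi z))) by apply: filterS => z' hz; exact: WU.
suff : (fun z => \val (phi z) : {ptws A -> R[i]^o}) @ z --> (\val (phi z) : {ptws A -> R[i]^o}).
  by apply; exact: open_nbhs_nbhs.
apply/cvg_sup => a V [_ [[B oB <-] Bz] BV].
apply: filterS BV _; apply: (h a z); exact: open_nbhs_nbhs.
Qed.

Lemma continuous_Ch (Z : topologicalType) (phi : Z -> Ch A) :
  (forall a, continuous (fun z => gelfand a (\val (phi z)) : R[i]^o)) -> continuous phi.
Proof.
move=> h z U /= [_ [[W oW <-] Wz] WU].
have hc : continuous (fun z => \val (phi z) : max_ideal_space A) by exact: continuous_max_ideal.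
apply: filterS WU _; apply: (hc z); exact: open_nbhs_nbhs.
Qed.

Lemma Ch_val_continuous (f : max_ideal_space A -> R[i]^o) : continuous f ->
  continuous (fun y : Ch A => f (\val y)).
Proof.
move=> cf y; apply: (@continuous_comp _ _ _ (\val : Ch A -> max_ideal_space A) f).
  exact: initial_continuous.
exact: cf.
Qed.

Implicit Types f g : max_ideal_space A -> R[i].

Lemma cl_approx f (e : R) : cl A f -> 0 < e -> exists a, forall x, modc (f x - gelfand a x) < e.
Proof.
move=> [_ cf] e0.
have : nbhs (f : {uniform max_ideal_space A -> R[i]^o})
    [set g | forall x, modc (f x - g x) < e].
  apply/uniform_nbhs; exists [set p | ball (p.1 : R[i]^o) e%:C%C p.2]; split.
    by rewrite -entourage_ballE; exists e%:C%C => //=; rewrite ltcR.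
  move=> g /= hg x; have := hg x I; rewrite /ball /= => h.
  by rewrite -ltcR modcE.
by move=> /cf [_ [[a _ <-] ha]]; exists a.
Qed.

(** Together with [cl_approx] this replaces the uniform topology by explicit estimates. Continuity
    of [f] results from uniform approximation by continuous transforms. *)
Lemma clP f : (forall e : R, 0 < e -> exists a, forall x, modc (f x - gelfand a x) < e) ->
  cl A f.
Proof.
move=> h; split.
  move=> x; have FF : Filter (nbhs (x : max_ideal_space A)) by exact: nbhs_filter.
  apply/cvgrPdist_lt => e e0.
  (* The radii of the normed space [R[i]^o] are complex numbers; positive ones are real. *)
  have [e1 e1E] : exists e1 : R, e = e1%:C%C by exists (complex.Re e); rewrite RRe_real ?gtr0_real.
  have e10 : 0 < e1 by rewrite -ltcR -e1E.
  have e30 : 0 < e1 / 3 by rewrite divr_gt0.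
  have [a ha] := h _ e30.
  have := @gelfand_continuous a x; move/cvgrPdist_lt => /(_ (e1 / 3)%:C%C).
  rewrite ltcR => /(_ e30); apply: filterS => y hy.
  rewrite e1E -modcE ltcR.
  have -> : f x - f y = (f x - gelfand a x) + (gelfand a x - gelfand a y) - (f y - gelfand a y) by ring.
  apply: le_lt_trans (modcD _ _) _; rewrite modcN.
  have {}hy : modc (gelfand a x - gelfand a y) < e1 / 3 by rewrite -ltcR modcE.
  have := ha x; have := ha y; have := modcD (f x - gelfand a x) (gelfand a x - gelfand a y).
  lra.
move=> U /uniform_nbhs[E [/= entE EU]].
have [e e0 eE] : exists2 e : R, 0 < e & forall p : R[i]^o * R[i]^o, modc (p.1 - p.2) < e -> E p.
  move: entE; rewrite -entourage_ballE => -[e /= e0 eE].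
  have eE' : (complex.Re e)%:C%C = e by rewrite RRe_real ?gtr0_real.
  exists (complex.Re e); first by rewrite -ltcR eE'.
  move=> p hp; apply: eE; rewrite /= /ball /=.
  by rewrite -modcE -eE' ltcR.
have [a ha] := h _ e0.
by exists (gelfand a); split; [exists a|apply: EU => x _; apply: eE; exact: ha].
Qed.

Lemma cl_gelfand a : cl A (gelfand a).
Proof. by apply: clP => e e0; exists a => x; rewrite subrr modc0. Qed.

Lemma cl_bounded f : cl A f -> fbounded f.
Proof.
move=> /cl_approx/(_ (@ltr01 R))[a ha]; exists (1 + bnorm a) => x.
rewrite -(subrK (gelfand a x) (f x)); apply: le_trans (modcD _ _) _.
by rewrite lerD ?char_bound // ltW.
Qed.

Lemma cl_ZD (c : R[i]) f g : cl A f -> cl A g -> cl A (c \*: f \+ g).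
Proof.
move=> cf cg; apply: clP => e e0.
have d0 : 0 < e / 2 / (modc c + 1) by rewrite !divr_gt0 // ltr_wpDl ?modc_ge0.
have e20 : 0 < e / 2 by rewrite divr_gt0.
have [a ha] := cl_approx cf d0; have [b hb] := cl_approx cg e20.
exists (c *: a + b) => x; rewrite gelfandZD /=.
have -> : c * f x + g x - (c * gelfand a x + gelfand b x) =
  c * (f x - gelfand a x) + (g x - gelfand b x) by ring.
apply: le_lt_trans (modcD _ _) _; rewrite (splitr e) modcM.
rewrite ltr_leD ?(ltW (hb x)) //.
apply: le_lt_trans (_ : (modc c + 1) * modc (f x - gelfand a x) < _).
  by rewrite ler_wpM2r ?modc_ge0 // lerDl.
by rewrite -ltr_pdivlMl ?ltr_wpDl ?modc_ge0 // mulrC.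
Qed.

Lemma cl_M f g : cl A f -> cl A g -> cl A (f \* g).
Proof.
move=> cf cg; have [M hM] := cl_bounded cf; have [M' hM'] := cl_bounded cg.
have [x0 _] := char_exists A.
have M0 : 0 <= M by apply: le_trans (hM x0); exact: modc_ge0.
have M'0 : 0 <= M' by apply: le_trans (hM' x0); exact: modc_ge0.
apply: clP => e e0.
pose K := M + M' + 1.
have K0 : 0 < K by rewrite /K; lra.
pose d := Num.min 1 (e / 2 / K).
have d0 : 0 < d by rewrite /d lt_min ltr01 !divr_gt0.
have [a ha] := cl_approx cf d0; have [b hb] := cl_approx cg d0.
exists (a * b) => x; rewrite gelfandM /=.
have -> : f x * g x - gelfand a x * gelfand b x =
  f x * (g x - gelfand b x) + (f x - gelfand a x) * (g x - (g x - gelfand b x)) by ring.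
apply: le_lt_trans (modcD _ _) _; rewrite !modcM.
have h1 : modc (g x - (g x - gelfand b x)) <= M' + 1.
  apply: le_trans (modcD _ _) _; rewrite modcN lerD // ltW //.
  by apply: lt_le_trans (hb x) _; rewrite ge_min lexx.
have dE : d <= e / 2 / K by rewrite ge_min lexx orbT.
have : modc (f x) * modc (g x - gelfand b x) <= M * d by rewrite ler_pM ?modc_ge0 // ltW.
have : modc (f x - gelfand a x) * modc (g x - (g x - gelfand b x)) <= d * (M' + 1).
  by rewrite ler_pM ?modc_ge0 // ltW.
have : d * K <= e / 2 by rewrite -ler_pdivlMr.
rewrite /K; lra.
Qed.

Lemma cl_cst (c : R[i]) : cl A (cst c).
Proof.
have -> : cst c = gelfand (c%:A : A) by apply/funext => x; rewrite gelfand_scalar.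
exact: cl_gelfand.
Qed.

Lemma cl_limit (u : nat -> max_ideal_space A -> R[i]) f : (forall n, cl A (u n)) ->
  (forall e : R, 0 < e -> exists n, forall x, modc (f x - u n x) < e) -> cl A f.
Proof.
move=> cu h; apply: clP => e e0; have e20 : 0 < e / 2 by rewrite divr_gt0.
have [n hn] := h _ e20; have [a ha] := cl_approx (cu n) e20; exists a => x.
rewrite -(subrK (u n x) (f x)) -addrA; apply: le_lt_trans (modcD _ _) _.
by rewrite (splitr e) ltrD.
Qed.

End SpectralNorm.

(** * Extreme linear functionals below a sublinear one *)

Section Sublinear.
Variables (R : realType) (W : lmodType R[i]) (D : set W).
Hypothesis D0 : D 0.
Hypothesis DD : forall x y, D x -> D y -> D (x + y).
Hypothesis DZ : forall (t : R) x, D x -> D (t%:C%C *: x).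

(** Everything is relative to [D] because [W] will be the space of all functions on a set, where
    [sup_norm] is meaningful on the bounded ones only. The inequality for scalars improves to an
    equality in [sublinearZ]. *)
Definition sublinear (p : W -> R) :=
  (forall x y, D x -> D y -> p (x + y) <= p x + p y) /\
  (forall (t : R) x, 0 < t -> D x -> p (t%:C%C *: x) <= t * p x).

Definition rlinear (l : W -> R) :=
  (forall x y, D x -> D y -> l (x + y) = l x + l y) /\
  (forall (t : R) x, D x -> l (t%:C%C *: x) = t * l x).

Definition dominated (p q : W -> R) := forall x, D x -> p x <= q x.

(** When [p] is a seminorm, the functionals below [p] form the unit ball of the real dual, and these
    are its extreme points. *)
Definition extreme_dominated (p l : W -> R) :=
  forall l1 l2 (t : R), rlinear l1 -> rlinear l2 -> dominated l1 p -> dominated l2 p ->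
  0 < t < 1 -> (forall x, D x -> l x = t * l1 x + (1 - t) * l2 x) ->
  forall x, D x -> l1 x = l x.

Lemma DN x : D x -> D (- x).
Proof. by move=> Dx; have := DZ (-1) Dx; rewrite rmorphN1 scaleN1r. Qed.

Lemma sublinear0 p : sublinear p -> p 0 = 0.
Proof.
move=> [pD pZ]; have := pD 0 0 D0 D0; have := @pZ 2^-1 0 _ D0.
rewrite scaler0 addr0 invr_gt0 ltr0n => /(_ isT); lra.
Qed.

Lemma sublinearZ p t x : sublinear p -> 0 < t -> D x -> p (t%:C%C *: x) = t * p x.
Proof.
move=> [pD pZ] t0 Dx; apply/eqP; rewrite eq_le pZ //=.
have := pZ t^-1 (t%:C%C *: x); rewrite invr_gt0 => /(_ t0 (DZ _ Dx)).
by rewrite scalerA -rmorphM mulVf ?gt_eqF // scale1r ler_pdivlMl.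
Qed.

Lemma sublinear_geN p x : sublinear p -> D x -> - p (- x) <= p x.
Proof.
move=> sp Dx; have [pD _] := sp; have := pD x (- x) Dx (DN Dx).
by rewrite subrr sublinear0 //; lra.
Qed.

Lemma rlinear0 l : rlinear l -> l 0 = 0.
Proof. by move=> [lD _]; have := lD 0 0 D0 D0; rewrite addr0; lra. Qed.

Lemma rlinearN l x : rlinear l -> D x -> l (- x) = - l x.
Proof.
move=> lin Dx; have [lD _] := lin; have := lD x (- x) Dx (DN Dx).
by rewrite subrr rlinear0 //; lra.
Qed.

(* The linear functionals below [peak_part q v] are those below [q] attaining
   the value [q v] at [v]. *)
Definition peak_part (q : W -> R) v w : R := inf [set q (w + t%:C%C *: v) - t * q v | t in [set t : R | 0 <= t]].

Section Support.
Variables (q : W -> R) (v : W).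
Hypotheses (sq : sublinear q) (Dv : D v).

(** This lower bound, independent of [t], makes the infimum defining [peak_part] meaningful. *)
Lemma peak_part_lb w t : 0 <= t -> D w -> - q (- w) <= q (w + t%:C%C *: v) - t * q v.
Proof.
rewrite le_eqVlt => /predU1P[<-|t0] Dw.
  by rewrite scale0r addr0 mul0r subr0 sublinear_geN.
have [qD _] := sq; have := qD (w + t%:C%C *: v) (- w).
rewrite addrAC subrr add0r sublinearZ // => /(_ (DD Dw (DZ _ Dv)) (DN Dw)).
lra.
Qed.

Lemma peak_part_le w t : 0 <= t -> D w -> peak_part q v w <= q (w + t%:C%C *: v) - t * q v.
Proof.
move=> t0 Dw; apply: ge_inf; last by exists t.
by exists (- q (- w)) => _ [s s0 <-]; exact: peak_part_lb.
Qed.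

Lemma peak_part_ge w r : (forall t, 0 <= t -> r <= q (w + t%:C%C *: v) - t * q v) -> r <= peak_part q v w.
Proof.
move=> h; apply: lb_le_inf; last by move=> _ [t t0 <-]; exact: h.
by exists (q (w + 0%:C%C *: v) - 0 * q v), 0 => /=.
Qed.

Lemma peak_part_sublinear : sublinear (peak_part q v).
Proof.
have [qD _] := sq; split=> [x y Dx Dy|a x a0 Dx].
  rewrite -lerBlDr; apply: peak_part_ge => t t0; rewrite lerBlDr -lerBlDl.
  apply: peak_part_ge => s s0; rewrite lerBlDl.
  apply: le_trans (peak_part_le (addr_ge0 t0 s0) (DD Dx Dy)) _.
  have := qD (x + t%:C%C *: v) (y + s%:C%C *: v) (DD Dx (DZ _ Dv)) (DD Dy (DZ _ Dv)).
  rewrite addrACA -scalerDl -rmorphD /=; lra.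
rewrite -ler_pdivrMl //; apply: peak_part_ge => t t0; rewrite ler_pdivrMl //.
apply: le_trans (peak_part_le (mulr_ge0 (ltW a0) t0) (DZ _ Dx)) _.
rewrite rmorphM /= -scalerA -scalerDr sublinearZ //; last exact: DD _ (DZ _ _).
by rewrite mulrBr mulrA.
Qed.

Lemma peak_part_dominated : dominated (peak_part q v) q.
Proof.
move=> x Dx; apply: le_trans (peak_part_le (lexx 0) Dx) _.
by rewrite scale0r addr0 mul0r subr0.
Qed.

Lemma peak_partN : peak_part q v (- v) <= - q v.
Proof.
have := peak_part_le ler01 (DN Dv); rewrite rmorph1 scale1r addNr sublinear0 //.
by rewrite mul1r sub0r.
Qed.

(** Evaluating at [- v] shows that the combination is at least [q v] at [v], while each term is at
    most [q v]; so [l1] attains [q v] there. *)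
Lemma peak_part_face l1 l2 t : rlinear l1 -> rlinear l2 -> dominated l1 q -> dominated l2 q ->
  0 < t < 1 -> (forall x, D x -> t * l1 x + (1 - t) * l2 x <= peak_part q v x) ->
  dominated l1 (peak_part q v).
Proof.
move=> lin1 lin2 h1 h2 /andP[t0 t1] h x Dx.
have e : l1 v = q v.
  have := le_trans (h _ (DN Dv)) peak_partN; rewrite !rlinearN //.
  have := h1 _ Dv; have := h2 _ Dv => a b c.
  have : (1 - t) * l2 v <= (1 - t) * q v by rewrite ler_wpM2l // subr_ge0 ltW.
  move=> d; apply/eqP; rewrite eq_le b /=.
  rewrite -(ler_pM2l t0); lra.
apply: peak_part_ge => s s0; rewrite lerBrDr -e.
have [l1D l1Z] := lin1.
by have := h1 _ (DD Dx (DZ s Dv)); rewrite l1D ?l1Z //; exact: DZ.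
Qed.

End Support.

(** The functionals below [q] form a face of the convex set of those below [p]. *)
Definition face (p q : W -> R) := forall l1 l2 t, rlinear l1 -> rlinear l2 ->
  dominated l1 p -> dominated l2 p -> 0 < t < 1 ->
  (forall x, D x -> t * l1 x + (1 - t) * l2 x <= q x) -> dominated l1 q.

Lemma face_swap p q l1 l2 t : face p q -> rlinear l1 -> rlinear l2 ->
  dominated l1 p -> dominated l2 p -> 0 < t < 1 ->
  (forall x, D x -> t * l1 x + (1 - t) * l2 x <= q x) -> dominated l2 q.
Proof.
move=> f h1 h2 d1 d2 /andP[t0 t1] h.
apply: (f l2 l1 (1 - t)) => //; first by rewrite subr_gt0 t1 gtrBl.
by move=> x Dx; rewrite subKr addrC h.
Qed.

Lemma face_peak_part p q v : sublinear q -> D v -> face p q -> dominated q p ->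
  face p (peak_part q v).
Proof.
move=> sq Dv f qp l1 l2 t lin1 lin2 d1 d2 t01 h.
have hq x : D x -> t * l1 x + (1 - t) * l2 x <= q x.
  by move=> Dx; apply: le_trans (h _ Dx) _; exact: peak_part_dominated.
apply: (@peak_part_face q v sq Dv l1 l2 t) => //; first exact: f hq.
exact: (face_swap f lin1 lin2 d1 d2 t01 hq).
Qed.

(** A form of the Krein-Milman theorem with prescribed value [p v]. Zorn's lemma gives a minimal
    sublinear [q] below [peak_part p v] whose functionals form a face; minimality makes [q] linear,
    and a face with a single element is an extreme point. *)
Lemma extreme_dominated_exists p v : sublinear p -> D v ->
  exists l, [/\ rlinear l, dominated l p, l v = p v & extreme_dominated p l].
Proof.
move=> sp Dv.
pose T := {q : W -> R | [/\ sublinear q, dominated q (peak_part p v) & face p q]}.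
pose r (s t : T) := `[< dominated (projT1 t) (projT1 s) >].
have t0P : [/\ sublinear (peak_part p v), dominated (peak_part p v) (peak_part p v) & face p (peak_part p v)].
  split; [exact: peak_part_sublinear|by []|].
  by apply: face_peak_part => //; move=> l1 l2 t.
pose t0 : T := exist _ _ t0P.
have [] := @ZL_preorder T t0 r.
- by move=> t; apply/asboolP.
- move=> a b c /asboolP h1 /asboolP h2; apply/asboolP => x Dx.
  exact: le_trans (h2 _ Dx) (h1 _ Dx).
- move=> C tot; have [[s0 Cs0]|C0] := pselect (exists s, C s); last first.
    by exists t0 => s Cs; case: C0; exists s.
  (* The pointwise infimum of a chain is subadditive because two members can be compared and the
     smaller one used for both summands. *)
  pose q x := inf [set projT1 s x | s in C].
  have lb (s : T) x : D x -> - peak_part p v (- x) <= projT1 s x.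
    move=> Dx; have [ss ds _] := projT2 s.
    by apply: le_trans (sublinear_geN ss Dx); rewrite lerN2 ds //; exact: DN.
  have qle (s : T) x : C s -> D x -> q x <= projT1 s x.
    move=> Cs Dx; apply: ge_inf; last by exists s.
    by exists (- peak_part p v (- x)) => _ [u _ <-]; exact: lb.
  have qge (x : W) (b : R) : (forall s, C s -> b <= projT1 s x) -> b <= q x.
    move=> h; apply: lb_le_inf; last by move=> _ [s Cs <-]; exact: h.
    by exists (projT1 s0 x), s0.
  have qP : [/\ sublinear q, dominated q (peak_part p v) & face p q].
    split.
    - split=> [x y Dx Dy|a x a0 Dx].
        rewrite -lerBlDr; apply: (qge) => s Cs; rewrite lerBlDr -lerBlDl.
        apply: (qge) => s' Cs'; rewrite lerBlDl.
        have [/asboolP h|/asboolP h] := tot _ _ Cs Cs'.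
          apply: le_trans (qle _ _ Cs' (DD Dx Dy)) _.
          have [[sD _] _ _] := projT2 s'; apply: le_trans (sD _ _ Dx Dy) _.
          by rewrite lerD2r h.
        apply: le_trans (qle _ _ Cs (DD Dx Dy)) _.
        have [[sD _] _ _] := projT2 s; apply: le_trans (sD _ _ Dx Dy) _.
        by rewrite lerD2l h.
      rewrite -ler_pdivrMl //; apply: (qge) => s Cs; rewrite ler_pdivrMl //.
      apply: le_trans (qle _ _ Cs (DZ _ Dx)) _.
      by have [[_ sZ] _ _] := projT2 s; exact: sZ.
    - move=> x Dx; apply: le_trans (qle _ _ Cs0 Dx) _.
      by have [_ ds _] := projT2 s0; exact: ds.
    move=> l1 l2 t lin1 lin2 d1 d2 t01 h x Dx; apply: (qge) => s Cs.
    have [_ _ fs] := projT2 s; apply: (fs l1 l2 t) => // y Dy.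
    exact: le_trans (h _ Dy) (qle _ _ Cs Dy).
  by exists (exist _ q qP) => s Cs; apply/asboolP => x Dx; exact: qle.
move=> [q [sq dq fq]] mq.
have dqp : dominated q p.
  by move=> x Dx; apply: le_trans (dq _ Dx) _; exact: peak_part_dominated.
(* By minimality [q] lies below [peak_part q x], whose value at [- x] is at most [- q x]. *)
have qN x : D x -> q (- x) = - q x.
  move=> Dx; apply/eqP; rewrite eq_le; apply/andP; split; last first.
    by have := sublinear_geN sq (DN Dx); rewrite opprK.
  have dP : [/\ sublinear (peak_part q x), dominated (peak_part q x) (peak_part p v) & face p (peak_part q x)].
    split; [exact: peak_part_sublinear| |exact: face_peak_part].
    by move=> y Dy; apply: le_trans (dq _ Dy); exact: peak_part_dominated.
  have /asboolP h := mq (exist _ _ dP) (asboolT (peak_part_dominated sq Dx)).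
  by apply: le_trans (h _ (DN Dx)) _ => /=; exact: peak_partN.
have [qD _] := sq.
have lq : rlinear q.
  split=> [x y Dx Dy|t x Dx].
    apply/eqP; rewrite eq_le qD //=.
    have := qD (x + y) (- y) (DD Dx Dy) (DN Dy); rewrite addrK qN //; lra.
  have [t_lt0|t_gt0|->] := ltrgt0P t.
  - exact: sublinearZ.
  - have tN : 0 < - t by rewrite oppr_gt0.
    have := sublinearZ sq tN Dx.
    by rewrite rmorphN scaleNr qN ?mulNr; [move/oppr_inj|exact: DZ].
  by rewrite scale0r mul0r (sublinear0 sq).
exists q; split=> //.
  apply/eqP; rewrite eq_le dqp //=.
  have := le_trans (dq _ (DN Dv)) (peak_partN sp Dv); rewrite qN //; lra.
move=> l1 l2 t lin1 lin2 d1 d2 t01 h.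
have h1 : dominated l1 q.
  by apply: (fq l1 l2 t) => // x Dx; rewrite h.
move=> x Dx; apply/eqP; rewrite eq_le h1 //=.
by have := h1 _ (DN Dx); rewrite qN // rlinearN //; lra.
Qed.

End Sublinear.

(** * Hahn-Banach extension along a real-linear map *)

Section HahnBanach.
Variables (R : realType) (V W : lmodType R[i]) (D : set W).
Hypothesis D0 : D 0.
Hypothesis DD : forall x y, D x -> D y -> D (x + y).
Hypothesis DZ : forall (t : R) x, D x -> D (t%:C%C *: x).
Variable s : V -> W.
Hypothesis sDom : forall v, D (s v).
Hypothesis sD : forall u v, s (u + v) = s u + s v.
Hypothesis sZ : forall (t : R) v, s (t%:C%C *: v) = t%:C%C *: s v.

(* The last conjunct makes the extension as large as possible at [w0]. *)
Lemma hahn_banach (P : W -> R) (l : V -> R) (w0 : W) : sublinear D P ->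
  rlinear setT l -> (forall v, l v <= P (s v)) -> D w0 ->
  exists M, [/\ rlinear D M, dominated D M P, forall v, M (s v) = l v
    & forall e, 0 < e -> exists v, P (w0 - s v) + l v < M w0 + e].
Proof.
move=> sP [lD lZ] lP Dw0; have [PD PZ] := sP.
have sN v : s (- v) = - s v.
  by have := sZ (-1) v; rewrite rmorphN1 !scaleN1r.
have s0 : s 0 = 0 by have := sZ 0 0; rewrite !scale0r.
have DN' x : D x -> D (- x) by exact: DN.
have lN v : l (- v) = - l v.
  by have := lZ (-1) v I; rewrite rmorphN1 scaleN1r mulN1r.
have l0 : l 0 = 0 by have := lZ 0 0 I; rewrite scale0r mul0r.
(* The linear functionals below [q] are exactly those below [P] that extend [l] along [s]; one with
   the value [q w0] at [w0] is then picked by [extreme_dominated_exists]. *)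
pose S w := [set P (w - s v) + l v | v in setT].
pose q w := inf (S w).
have qle w v : D w -> q w <= P (w - s v) + l v.
  move=> Dw; apply: ge_inf; last by exists v.
  exists (- P (- w)) => _ [u _ <-].
  have := PD (w - s u) (- w) (DD Dw (DN' _ (sDom u))) (DN' _ Dw).
  have := lP (- u); rewrite sN lN addrAC subrr add0r; lra.
have qge (w : W) (b : R) : (forall v, b <= P (w - s v) + l v) -> b <= q w.
  move=> h; apply: lb_le_inf; last by move=> _ [v _ <-]; exact: h.
  by exists (P (w - s 0) + l 0), 0.
have sq : sublinear D q.
  split=> [x y Dx Dy|a x a0 Dx].
    rewrite -lerBlDr; apply: (qge) => u; rewrite lerBlDr -lerBlDl.
    apply: (qge) => v; rewrite lerBlDl.
    apply: le_trans (qle _ (u + v) (DD Dx Dy)) _.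
    have := PD (x - s u) (y - s v) (DD Dx (DN' _ (sDom u))) (DD Dy (DN' _ (sDom v))).
    by rewrite sD lD // opprD addrACA; lra.
  rewrite -ler_pdivrMl //; apply: (qge) => v; rewrite ler_pdivrMl //.
  apply: le_trans (qle _ (a%:C%C *: v) (DZ _ Dx)) _.
  rewrite sZ lZ // -scalerBr (sublinearZ DZ sP) //; last exact: DD _ (DN' _ _).
  by rewrite mulrDr.
have [M [linM domM Mw0 _]] := extreme_dominated_exists D0 DD DZ sq Dw0.
have Mle v : M (s v) <= l v.
  apply: le_trans (domM _ (sDom v)) _; apply: le_trans (qle _ v (sDom v)) _.
  by rewrite subrr (sublinear0 D0 sP) add0r.
exists M; split=> //.
- move=> x Dx; apply: le_trans (domM _ Dx) _; apply: le_trans (qle _ 0 Dx) _.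
  by rewrite s0 subr0 l0 addr0.
- move=> v; apply/eqP; rewrite eq_le Mle /=.
  by have := Mle (- v); rewrite sN lN (rlinearN D0 DZ linM) // lerN2.
move=> e e0; rewrite Mw0.
have [_ [v _ <-] h] : exists2 x, S w0 x & x < q w0 + e.
  apply: inf_adherent => //; split; first by exists (P (w0 - s 0) + l 0), 0.
  by exists (q w0) => _ [v _ <-]; exact: qle.
by exists v.
Qed.

End HahnBanach.

(** * Bounded functions and complexification of real functionals *)

Section BoundedFunctions.
Variables (R : realType) (X : Type) (x0 : X).
Implicit Types (f g w : X -> R[i]).

Local Notation D := (@fbounded R X).

Lemma scalefE (c : R[i]) f x : (c *: f) x = c * f x. Proof. by []. Qed.
Lemma mulfE f g x : (f * g) x = f x * g x. Proof. by []. Qed.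
Lemma addfE f g x : (f + g) x = f x + g x. Proof. by []. Qed.
Definition pointwiseE := (scalefE, mulfE, addfE).

Lemma bounded0 : D 0.
Proof. by exists 0 => x; rewrite modc0. Qed.

Lemma boundedD f g : D f -> D g -> D (f + g).
Proof.
move=> [M hM] [M' hM']; exists (M + M') => x.
by apply: le_trans (modcD _ _) _; rewrite lerD.
Qed.

Lemma boundedM f g : D f -> D g -> D (f * g).
Proof.
move=> [M hM] [M' hM']; exists (M * M') => x.
by rewrite modcM ler_pM ?modc_ge0.
Qed.

Lemma boundedZ (c : R[i]) f : D f -> D (c *: f).
Proof.
move=> [M hM]; exists (modc c * M) => x.
by rewrite modcM ler_wpM2l ?modc_ge0.
Qed.

Lemma boundedRZ (t : R) f : D f -> D (t%:C%C *: f).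
Proof. exact: boundedZ. Qed.

Lemma sup_normD f g : D f -> D g -> sup_norm (f + g) <= sup_norm f + sup_norm g.
Proof.
move=> Df Dg; apply: sup_norm_le => // x; apply: le_trans (modcD _ _) _.
by rewrite lerD ?sup_norm_ge.
Qed.

Lemma sup_normZ (c : R[i]) f : D f -> sup_norm (c *: f) <= modc c * sup_norm f.
Proof.
move=> Df; apply: sup_norm_le => // x.
by rewrite modcM ler_wpM2l ?modc_ge0 ?sup_norm_ge.
Qed.

Lemma sup_norm_sublinear : sublinear D (@sup_norm R X).
Proof.
split; first exact: sup_normD.
move=> t f t0 Df; apply: le_trans (sup_normZ _ Df) _.
by rewrite modcR gtr0_norm.
Qed.

Definition sup_Re f : R := sup [set complex.Re (f x) | x in setT].

Lemma sup_Re_ge f x : D f -> complex.Re (f x) <= sup_Re f.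
Proof.
move=> [M hM]; apply: ub_le_sup; last by exists x.
by exists M => _ [y _ <-]; apply: le_trans (hM y); exact: Re_le_modc.
Qed.

Lemma sup_Re_le f (M : R) : (forall x, complex.Re (f x) <= M) -> sup_Re f <= M.
Proof.
move=> h; apply: ge_sup; last by move=> _ [y _ <-]; exact: h.
by exists (complex.Re (f x0)), x0.
Qed.

Lemma sup_Re_sublinear : sublinear D sup_Re.
Proof.
split=> [f g Df Dg|t f t0 Df]; apply: sup_Re_le => x.
  by rewrite raddfD lerD ?sup_Re_ge.
have -> : complex.Re ((t%:C%C *: f) x) = t * complex.Re (f x).
  by rewrite /GRing.scale /=; case: (f x) => a b /=; rewrite mul0r subr0.
by rewrite ler_pM2l // sup_Re_ge.
Qed.

Lemma sup_Re_le_norm f : D f -> sup_Re f <= sup_norm f.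
Proof.
move=> Df; apply: sup_Re_le => x.
by apply: le_trans (sup_norm_ge x Df); exact: Re_le_modc.
Qed.

Section Complexification.
Variable m : (X -> R[i]) -> R.
Hypotheses (lin_m : rlinear D m) (dom_m : dominated D m (@sup_norm R X)).

Definition complexify f : R[i] := (m f)%:C%C - 'i%C * (m ('i%C *: f))%:C%C.

Lemma Re_complexify f : complex.Re (complexify f) = m f.
Proof. by rewrite /complexify; simpc. Qed.

Lemma complexifyD f g : D f -> D g -> complexify (f + g) = complexify f + complexify g.
Proof.
move=> Df Dg; have [mD _] := lin_m.
rewrite /complexify scalerDr !mD //; try exact: boundedZ.
by rewrite !rmorphD /=; ring.
Qed.

Lemma complexifyZ (c : R[i]) f : D f -> complexify (c *: f) = c * complexify f.
Proof.
move=> Df; have [mD mZ] := lin_m; case: c => u v.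
have e : (u +i* v)%C *: f = u%:C%C *: f + v%:C%C *: ('i%C *: f).
  by rewrite scalerA -scalerDl; congr (_ *: _); simpc.
have Dif : D ('i%C *: f) by exact: boundedZ.
have e2 : 'i%C *: ('i%C *: f) = (-1)%:C%C *: f.
  by rewrite scalerA -expr2 sqr_i rmorphN1.
have e1 : 'i%C *: ((u +i* v)%C *: f) = u%:C%C *: ('i%C *: f) + (- v)%:C%C *: f.
  rewrite e scalerDr !scalerA; congr (_ *: _ + _ *: _); first by rewrite mulrC.
  by rewrite mulrAC -expr2 sqr_i rmorphN mulN1r.
rewrite /complexify e1 e !mD ?mZ //; try exact: boundedZ.
by simpc; congr (_ +i* _)%C; ring.
Qed.

(** Rotating [f] by the unimodular [t] makes the value real and non-negative, hence equal to the
    value of [m]. *)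
Lemma complexify_le f : D f -> modc (complexify f) <= sup_norm f.
Proof.
move=> Df; set z := complexify f; have [->|z0] := eqVneq z 0.
  by rewrite modc0; apply: le_trans (sup_norm_ge x0 Df); exact: modc_ge0.
pose t := (modc z)%:C%C / z.
have t1 : modc t = 1.
  by rewrite modcM modcV modcR ger0_norm ?modc_ge0 // divff // modc_eq0.
have : complexify (t *: f) = (modc z)%:C%C.
  by rewrite complexifyZ // -/z /t divfK.
move=> /(congr1 (@complex.Re R)); rewrite Re_complexify /= => <-.
apply: le_trans (dom_m (boundedZ _ Df)) _.
by apply: le_trans (sup_normZ _ Df) _; rewrite t1 mul1r.
Qed.

End Complexification.

End BoundedFunctions.

(** * Real weights act as scalars on extreme functionals *)

Section Extreme.
Variables (R : realType) (A : comBanachAlgType R).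
Implicit Types (a b : A) (x : max_ideal_space A).

Local Notation X := (max_ideal_space A).
Local Notation D := (@fbounded R X).
Local Notation r := (@spectral_radius R A).

Lemma radius_sublinear : sublinear setT r.
Proof.
split=> [a b _ _|t a t0 _]; first exact: radiusD.
by rewrite radiusZ modcR gtr0_norm.
Qed.

Lemma gelfand_addE a b : gelfand (a + b) = (gelfand a + gelfand b : X -> R[i]).
Proof. by apply/funext => x; exact: gelfandD. Qed.

Lemma gelfand_scaleE (c : R[i]) a : gelfand (c *: a) = (c *: gelfand a : X -> R[i]).
Proof. by apply/funext => x; exact: gelfandZ. Qed.

Section Weight.
Variables (l : A -> R) (M : (X -> R[i]) -> R).
Hypothesis ext_l : extreme_dominated setT r l.
Hypotheses (lin_M : rlinear D M) (dom_M : dominated D M (@sup_norm R X)).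
Hypothesis Ml : forall a, M (gelfand a) = l a.

Definition weight (w : X -> R) : X -> R[i] := fun x => (w x)%:C%C.

Lemma weight_bounded w (K : R) : (forall x, `|w x| <= K) -> D (weight w).
Proof. by move=> h; exists K => x; rewrite modcR. Qed.

(* Since the norms of [M (w * _)] and [M ((1 - w) * _)] add up to at most one,
   extremality makes both of them multiples of [l]. *)
Lemma weight_unit w : (forall x, 0 <= w x <= 1) ->
  exists c : R, forall a, M (weight w * gelfand a) = c * l a.
Proof.
move=> w01; have [x0 _] := char_exists A.
pose w' x := 1 - w x.
have w'01 x : 0 <= w' x <= 1.
  by have /andP[h1 h2] := w01 x; rewrite /w' subr_ge0 h2 gerBl h1.
pose m1 a := M (weight w * gelfand a); pose m2 a := M (weight w' * gelfand a).
have Dw v a : (forall x, 0 <= v x <= 1) -> D (weight v * gelfand a).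
  move=> h; apply: boundedM; last exact: gelfand_bounded.
  apply: (@weight_bounded _ 1) => x; have /andP[h1 h2] := h x.
  by rewrite ger0_norm.
have lin v : (forall x, 0 <= v x <= 1) -> rlinear setT (fun a => M (weight v * gelfand a)).
  move=> h; have [MD MZ] := lin_M; split=> [a b _ _|t a _].
    by rewrite gelfand_addE mulrDr MD //; exact: Dw.
  rewrite -MZ; last exact: Dw.
  by congr M; apply/funext => x; rewrite !pointwiseE gelfandZ mulrCA.
have lin1 : rlinear setT m1 by exact: lin.
have lin2 : rlinear setT m2 by exact: lin.
have m12 a : m1 a + m2 a = l a.
  have [MD _] := lin_M; rewrite -Ml -MD; try exact: Dw.
  congr M; apply/funext => x; rewrite !pointwiseE /weight /w'.
  by rewrite rmorphB rmorph1 /=; ring.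
(* Pointwise, [w |a| + (1 - w) |b| <= 1]. *)
have comb a b : r a <= 1 -> r b <= 1 -> m1 a + m2 b <= 1.
  move=> ha hb; have [MD _] := lin_M; rewrite -MD; try exact: Dw.
  apply: le_trans (dom_M _) _; first by apply: boundedD; exact: Dw.
  apply: (sup_norm_le x0) => x.
  apply: le_trans (modcD _ _) _; rewrite !modcM !modcR.
  have /andP[h1 h2] := w01 x; have /andP[h3 h4] := w'01 x.
  rewrite !ger0_norm //.
  apply: le_trans (_ : w x * 1 + w' x * 1 <= _); last by rewrite /w'; lra.
  rewrite lerD // ler_wpM2l //.
    exact: le_trans (gelfand_le a x) ha.
  exact: le_trans (gelfand_le b x) hb.
have z0 (m : A -> R) : rlinear setT m -> m 0 = 0 by move=> h; exact: (rlinear0 (D := setT) I h).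
have r0 : r 0 <= 1 by rewrite spectral_radius0.
pose S := [set m1 a | a in [set a | r a <= 1]].
have ubS : has_ubound S.
  by exists 1 => _ [a /= ha <-]; have := comb a 0 ha r0; rewrite (z0 m2) // addr0.
pose nu := sup S.
have nuS a : r a <= 1 -> m1 a <= nu by move=> ha; apply: ub_le_sup => //; exists a.
have nu0 : 0 <= nu by have := nuS 0 r0; rewrite z0.
have nule (b : R) : (forall a, r a <= 1 -> m1 a <= b) -> nu <= b.
  move=> h; apply: ge_sup; first by exists (m1 0), 0.
  by move=> _ [a ha <-]; exact: h.
have nu1 : nu <= 1.
  by apply: nule => a ha; have := comb a 0 ha r0; rewrite (z0 m2) // addr0.
have scale m (b : R) : rlinear setT m -> (forall a, m a <= r a) ->
    (forall a, r a <= 1 -> m a <= b) -> forall a, m a <= b * r a.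
  move=> [_ mZ] mr h a; have := radius_ge0 a; rewrite le_eqVlt => /predU1P[e|ra].
    by have := mr a; rewrite -e mulr0.
  have := h ((r a)^-1%:C%C *: a); rewrite radiusZ modcR normfV (gtr0_norm ra).
  rewrite mulVf ?gt_eqF // lexx => /(_ isT); rewrite mZ // mulrC.
  by rewrite ler_pdivrMr.
have mr v a : (forall x, 0 <= v x <= 1) -> M (weight v * gelfand a) <= r a.
  move=> h; apply: le_trans (dom_M (Dw _ _ h)) _; apply: (sup_norm_le x0) => x.
  rewrite modcM modcR; have /andP[h1 h2] := h x; rewrite ger0_norm //.
  by apply: le_trans (gelfand_le a x); rewrite ler_piMl ?modc_ge0.
have b1 a : m1 a <= nu * r a by apply: scale => // b; exact: mr.
have b2 a : m2 a <= (1 - nu) * r a.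
  apply: scale => // [b|b hb]; first exact: mr.
  rewrite lerBrDr -lerBrDl; apply: nule => c hc.
  by rewrite lerBrDr; exact: comb.
have zero m a : rlinear setT m -> (forall b, m b <= 0) -> m a = 0.
  move=> hm h; apply/eqP; rewrite eq_le h /=.
  by have := h (- a); rewrite (rlinearN (D := setT) I (fun _ _ _ => I) hm I) oppr_le0.
(* In the two degenerate cases [m1] or [m2] vanishes; otherwise [l] is the convex combination, with
   weights [nu] and [1 - nu], of [m1 / nu] and [m2 / (1 - nu)]. *)
have [nuE0|nu_gt0] := eqVneq nu 0.
  exists 0 => a; rewrite mul0r; apply: (zero m1) => // b.
  by have := b1 b; rewrite nuE0 mul0r.
have [nuE1|nu_lt1] := eqVneq nu 1.
  exists 1 => a; rewrite mul1r -m12 (zero m2) ?addr0 // => b.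
  by have := b2 b; rewrite nuE1 subrr mul0r.
have {}nu_gt0 : 0 < nu by rewrite lt_def nu_gt0.
have {}nu_lt1 : 0 < 1 - nu by rewrite subr_gt0 lt_def eq_sym nu_lt1.
have linZ m (k : R) : rlinear setT m -> rlinear setT (fun a => k * m a).
  by move=> [mD mZ]; split=> [a b _ _|t a _]; rewrite ?mD ?mZ // ?mulrDr // mulrCA.
exists nu => a.
rewrite -(@ext_l (fun a => nu^-1 * m1 a) (fun a => (1 - nu)^-1 * m2 a) nu _ _ _ _ _ _ a I) //.
- by rewrite mulrA mulfV ?gt_eqF // mul1r.
- exact: linZ.
- exact: linZ.
- by move=> b _; rewrite ler_pdivrMl.
- by move=> b _; rewrite ler_pdivrMl.
- by rewrite nu_gt0 -subr_gt0.
by move=> b _; rewrite !mulrA !mulfV ?gt_eqF // !mul1r m12.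
Qed.

(** An affine change of the weight moves its values into [[0, 1]]. *)
Lemma weight_real w (K : R) : (forall x, `|w x| <= K) ->
  exists c : R, forall a, M (weight w * gelfand a) = c * l a.
Proof.
move=> wK; have [x0 _] := char_exists A.
have K0 : 0 < K + 1 by apply: le_lt_trans (ltr_pwDr ltr01 (wK x0)); exact: normr_ge0.
pose k := 2 * (K + 1); have k0 : 0 < k by rewrite mulr_gt0.
have [] := @weight_unit (fun x => (w x + (K + 1)) / k).
  move=> x; have := wK x; rewrite ler_norml => /andP[h1 h2].
  rewrite divr_ge0 ?(ltW k0) //=; last lra.
  rewrite ler_pdivrMr // /k; lra.
move=> c hc; exists (k * c - (K + 1)) => a.
have [MD MZ] := lin_M.
have Da : D (gelfand a) by exact: gelfand_bounded.
have Dw : D (weight w) by exact: weight_bounded wK.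
have := hc a.
have -> : weight (fun x => (w x + (K + 1)) / k) * gelfand a =
   (k^-1)%:C%C *: (weight w * gelfand a + (K + 1)%:C%C *: gelfand a).
  apply/funext => x; rewrite !pointwiseE /weight.
  by rewrite rmorphM rmorphD /=; ring.
rewrite MZ; last by apply: boundedD; [exact: boundedM|exact: boundedZ].
rewrite MD; [|exact: boundedM|exact: boundedZ].
rewrite MZ // Ml => e.
have -> : M (weight w * gelfand a) = k * (k^-1 * (M (weight w * gelfand a) + (K + 1) * l a)) - (K + 1) * l a.
  by rewrite mulrA mulfV ?gt_eqF // mul1r addrK.
by rewrite e; ring.
Qed.

End Weight.

End Extreme.

(** * Extreme functionals as rotated evaluations; the Choquet boundary is norming *)

Section Choquet.
Variables (R : realType) (A : comBanachAlgType R).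
Implicit Types (a b : A) (x : max_ideal_space A).

Local Notation X := (max_ideal_space A).
Local Notation D := (@fbounded R X).
Local Notation r := (@spectral_radius R A).

Lemma Re_scale (t : R) (z : R[i]) : complex.Re (t%:C%C * z) = t * complex.Re z.
Proof. by case: z => u v /=; rewrite mul0r subr0. Qed.

Lemma Re_eval_linear (c : R[i]) x : rlinear setT (fun a => complex.Re (c * gelfand a x)).
Proof.
split=> [a b _ _|t a _]; first by rewrite gelfandD mulrDr raddfD.
by rewrite gelfandZ mulrCA Re_scale.
Qed.

Lemma Re_eval_le (c : R[i]) x a : modc c <= 1 -> complex.Re (c * gelfand a x) <= r a.
Proof.
move=> c1; apply: le_trans (Re_le_modc _) _; rewrite modcM.
by apply: le_trans (gelfand_le a x); rewrite ler_piMl ?modc_ge0.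
Qed.

Lemma bounded_gelfand a : D (gelfand a).
Proof. exact: gelfand_bounded. Qed.

Lemma combE (c : R[i]) (f g : X -> R[i]) x : (c \*: f \+ g) x = c * f x + g x.
Proof. by []. Qed.

Lemma state0 (L : (X -> R[i]) -> R[i]) : state (cl A) L -> L (cst 0) = 0.
Proof.
move=> [linL _ _].
have e : cst 0 = 1 \*: cst 0 \+ cst 0 :> (X -> R[i]).
  by apply/funext => y; rewrite combE mulr0 addr0.
have := linL 1 (cst 0) (cst 0) (cl_cst _ _) (cl_cst _ _).
by rewrite -e mul1r => /eqP; rewrite -subr_eq0 opprD addNKr oppr_eq0 => /eqP.
Qed.

Lemma state_gelfandD (L : (X -> R[i]) -> R[i]) a b : state (cl A) L ->
  L (gelfand (a + b)) = L (gelfand a) + L (gelfand b).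
Proof.
move=> [linL _ _]; have := linL 1 _ _ (cl_gelfand a) (cl_gelfand b); rewrite mul1r => <-.
by congr L; apply/funext => y; rewrite combE gelfandD mul1r.
Qed.

Lemma state_gelfandZ (L : (X -> R[i]) -> R[i]) (c : R[i]) a : state (cl A) L ->
  L (gelfand (c *: a)) = c * L (gelfand a).
Proof.
move=> sL; have [linL _ _] := sL.
have := linL c _ _ (cl_gelfand a) (cl_cst _ 0); rewrite state0 // addr0 => <-.
by congr L; apply/funext => y; rewrite combE gelfandZ addr0.
Qed.

Section ExtremePoint.
Variable l : A -> R.
Hypotheses (lin_l : rlinear setT l) (dom_l : dominated setT l r).
Hypothesis ext_l : extreme_dominated setT r l.

(** The zero functional is the midpoint of plus and minus the real part of any character. *)
Lemma extreme_neq0 : ~ (forall a, l a = 0).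
Proof.
move=> l0; have [x0 _] := char_exists A.
have := @ext_l (fun a => complex.Re (1 * gelfand a x0))
  (fun a => complex.Re (- 1 * gelfand a x0)) 2^-1 (Re_eval_linear _ _) (Re_eval_linear _ _).
have h1 : dominated setT (fun a => complex.Re (1 * gelfand a x0)) r.
  by move=> a _; apply: Re_eval_le; rewrite modc1.
have h2 : dominated setT (fun a => complex.Re (- 1 * gelfand a x0)) r.
  by move=> a _; apply: Re_eval_le; rewrite modcN modc1.
have h3 : 0 < (2^-1 : R) < 1 by rewrite invr_gt0 ltr0n invf_lt1 ?ltr1n ?ltr0n.
move=> /(_ h1 h2 h3) h.
have h4 : forall a, setT a -> l a = 2^-1 * complex.Re (1 * gelfand a x0) +
    (1 - 2^-1) * complex.Re (- 1 * gelfand a x0).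
  move=> a _; rewrite l0 mulNr mul1r raddfN /=; lra.
by have := h h4 1 I; rewrite l0 gelfand1 mulr1 /= => /eqP; rewrite oner_eq0.
Qed.

(** Let [L] be the complexification of [l]. The real and imaginary parts of the transform of [g] are
    real weights, so [L (g * a)] is a scalar multiple of [L a]; hence [L / L 1] is a character. *)
Lemma extreme_char : exists x, exists2 mu : R[i], modc mu = 1 &
  forall a, l a = complex.Re (mu * gelfand a x).
Proof.
have [x0 _] := char_exists A.
have sZ (t : R) a : gelfand (t%:C%C *: a) = t%:C%C *: gelfand a :> (X -> R[i]).
  exact: gelfand_scaleE.
have lr a : l a <= sup_norm (gelfand a) by rewrite -spectral_radiusE; exact: dom_l.
have [M [linM domM Ml _]] := hahn_banach (@bounded0 R X) (@boundedD R X) (@boundedRZ R X)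
  bounded_gelfand (@gelfand_addE R A) sZ (sup_norm_sublinear R x0) lin_l lr (@bounded0 R X).
have wr := weight_real ext_l linM domM Ml.
pose L a := complexify M (gelfand a).
have ReL a : complex.Re (L a) = l a by rewrite Re_complexify Ml.
have LD a b : L (a + b) = L a + L b.
  by rewrite /L gelfand_addE (complexifyD linM) //; exact: bounded_gelfand.
have LZ c a : L (c *: a) = c * L a.
  by rewrite /L gelfand_scaleE (complexifyZ linM) //; exact: bounded_gelfand.
have LM g : exists c : R[i], forall a, L (g * a) = c * L a.
  have [|c1 hc1] := wr (fun x => complex.Re (gelfand g x)) (r g).
    by move=> x; apply: le_trans (gelfand_le g x); exact: normRe_le.
  have [|c2 hc2] := wr (fun x => complex.Im (gelfand g x)) (r g).
    by move=> x; apply: le_trans (gelfand_le g x); exact: normIm_le.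
  (* Split [g * a] as [Re g * a + Im g * ('i a)] and apply [weight_real] to each part. *)
  have key a : l (g * a) = c1 * l a + c2 * l ('i%C *: a).
    rewrite -hc1 -hc2 -Ml.
    have [MD _] := linM; rewrite -MD; last 2 first.
    - apply: boundedM; last exact: bounded_gelfand.
      apply: (@weight_bounded _ _ _ (r g)) => x.
      by apply: le_trans (gelfand_le g x); exact: normRe_le.
    - apply: boundedM; last exact: bounded_gelfand.
      apply: (@weight_bounded _ _ _ (r g)) => x.
      by apply: le_trans (gelfand_le g x); exact: normIm_le.
    congr M; apply/funext => x; rewrite !pointwiseE gelfandM gelfandZ /weight.
    by rewrite {1}[gelfand g x]complexE; ring.
  exists (c1 +i* c2)%C => a.
  have LE b : L b = (l b)%:C%C - 'i%C * (l ('i%C *: b))%:C%C.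
    by rewrite /L /complexify Ml -gelfand_scaleE Ml.
  have lN b : l (- b) = - l b by exact: (rlinearN (D := setT) I (fun _ _ _ => I) lin_l I).
  rewrite !LE scalerAr !key scalerA -expr2 sqr_i scaleN1r lN.
  by simpc; congr (_ +i* _)%C; ring.
have L1 : L 1 != 0.
  apply/eqP => L10; apply: extreme_neq0 => g; have [c hc] := LM g.
  by rewrite -ReL -[g]mulr1 hc L10 mulr0.
have [] := @mk_char R A (fun a => L a / L 1).
- by move=> c a b; rewrite LD LZ mulrDl mulrA.
- split; first by rewrite divff.
  move=> a b; have [c hc] := LM a; rewrite hc.
  have -> : L a = c * L 1 by rewrite -hc mulr1.
  by field.
move=> x xE; exists x; pose mu := L 1.
have lE a : l a = complex.Re (mu * gelfand a x).
  by rewrite -ReL xE mulrCA divff // mulr1.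
have lmu : l ((mu^*)%:A) = modc mu ^+ 2.
  by rewrite lE gelfand_scalar mul_conjE.
have mu0 : 0 < modc mu by rewrite modc_gt0.
have mu1 : modc mu <= 1.
  have := @dom_l (mu^*)%:A I; rewrite lmu radiusZ radius1 mulr1 modc_conj.
  by rewrite expr2 -{3}[modc mu]mul1r ler_pM2r.
exists mu => //; apply/eqP; rewrite eq_le mu1 leNgt; apply/negP => lt1.
(* If [modc mu < 1], then [l] is a proper convex combination of [l / modc mu] and [0]. *)
have := @ext_l (fun a => complex.Re (((modc mu)^-1%:C%C * mu) * gelfand a x))
  (fun a => complex.Re (0 * gelfand a x)) (modc mu) (Re_eval_linear _ _) (Re_eval_linear _ _).
have h1 : dominated setT (fun a => complex.Re (((modc mu)^-1%:C%C * mu) * gelfand a x)) r.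
  move=> a _; apply: Re_eval_le.
  by rewrite modcM modcR gtr0_norm ?invr_gt0 // mulVf // gt_eqF.
have h2 : dominated setT (fun a => complex.Re (0 * gelfand a x)) r.
  by move=> a _; apply: Re_eval_le; rewrite modc0.
have h3 : 0 < modc mu < 1 by rewrite mu0.
have h4 a : l a = modc mu * complex.Re (((modc mu)^-1%:C%C * mu) * gelfand a x) +
    (1 - modc mu) * complex.Re (0 * gelfand a x).
  by rewrite mul0r mulr0 addr0 -mulrA Re_scale -lE mulrA mulfV ?gt_eqF // mul1r.
move=> /(_ h1 h2 h3 (fun a _ => h4 a) (mu^*)%:A I).
rewrite -mulrA Re_scale -lE lmu expr2 (mulKf (lt0r_neq0 mu0)) => e.
by have := lt1; rewrite -(ltr_pM2r mu0) mul1r -e ltxx.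
Qed.

(** Two states averaging to the evaluation at [x] give, through the real part of their multiple by
    [mu], two functionals averaging to [l], hence equal to [l]. Replacing [a] by ['i a] recovers the
    imaginary parts, and density carries the equality to [cl A]. *)
Lemma extreme_in_Ch x (mu : R[i]) : modc mu = 1 ->
  (forall a, l a = complex.Re (mu * gelfand a x)) -> choquet_boundary (cl A) x.
Proof.
move=> mu1 lE L1 L2 t sL1 sL2 /andP[t0 t1] h.
have [x0 _] := char_exists A.
have mun0 : mu != 0 by rewrite -modc_gt0 mu1.
have stL (L : (X -> R[i]) -> R[i]) : state (cl A) L ->
    rlinear setT (fun a => complex.Re (mu * L (gelfand a))) /\
    dominated setT (fun a => complex.Re (mu * L (gelfand a))) r.
  move=> sL; have [linL L_1 leL] := sL.
  split.
    split=> [a b _ _|u a _]; first by rewrite state_gelfandD // mulrDr raddfD.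
    by rewrite state_gelfandZ // mulrCA Re_scale.
  move=> a _; apply: le_trans (Re_le_modc _) _; rewrite modcM mu1 mul1r.
  by rewrite spectral_radiusE; apply: leL; exact: cl_gelfand.
have [lin1 dom1] := stL _ sL1; have [lin2 dom2] := stL _ sL2.
have eqA (L : (X -> R[i]) -> R[i]) : state (cl A) L ->
    (forall a, complex.Re (mu * L (gelfand a)) = l a) ->
    forall f, cl A f -> L f = f x.
  move=> sL hl; have [linL L_1 leL] := sL.
  have eA a : L (gelfand a) = gelfand a x.
    apply: (mulfI mun0).
    have e1 := hl a; have := hl ('i%C *: a); rewrite !lE in e1 *.
    rewrite state_gelfandZ // gelfandZ ![mu * ('i%C * _)]mulrCA.
    move: e1; case: (mu * L _) => u v; case: (mu * _) => u' v' /= -> .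
    by rewrite !mul0r !mul1r !sub0r => /oppr_inj ->.
  move=> f cf; apply/eqP; rewrite -subr_eq0 -modc_eq0 eq_le modc_ge0 andbT.
  apply/ler_addgt0Pr => e e0; rewrite add0r.
  have e20 : 0 < e / 2 by rewrite divr_gt0.
  have [a ha] := cl_approx cf e20.
  have cd := cl_ZD (-1) (cl_gelfand a) cf.
  have := leL _ cd; rewrite linL ?eA //; last exact: cl_gelfand.
  have : sup_norm (-1 \*: gelfand a \+ f) <= e / 2.
    by apply: (sup_norm_le x0) => y; rewrite combE mulN1r addrC ltW.
  have -> : L f - f x = (-1 * gelfand a x + L f) - (f x - gelfand a x) by ring.
  have := modcD (-1 * gelfand a x + L f) (- (f x - gelfand a x)); rewrite modcN.
  have := ha x; rewrite -/(modc _); lra.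
move=> f cf; split.
  apply: eqA => // a.
  apply: (@ext_l _ _ t lin1 lin2 dom1 dom2 _ _ a I); first by rewrite t0.
  move=> b _; rewrite lE h; last exact: cl_gelfand.
  by rewrite mulrDr raddfD /= !(mulrCA mu) !Re_scale.
apply: eqA => // a.
apply: (@ext_l _ _ (1 - t) lin2 lin1 dom2 dom1 _ _ a I).
  by rewrite subr_gt0 t1 gtrBl.
move=> b _; rewrite lE h; last exact: cl_gelfand.
by rewrite mulrDr raddfD /= !(mulrCA mu) !Re_scale subKr addrC.
Qed.

Lemma extreme_Ch : exists y : Ch A, exists2 mu : R[i], modc mu = 1 &
  forall a, l a = complex.Re (mu * gelfand a (\val y)).
Proof.
have [x [mu mu1 lE]] := extreme_char.
by exists (exist _ x (mem_set (extreme_in_Ch mu1 lE))), mu.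
Qed.

End ExtremePoint.

(** An extreme functional attaining [r a] at [a] is a rotated evaluation at a boundary point. *)
Lemma gelfand_boundary a (K : R) :
  (forall y : Ch A, modc (gelfand a (\val y)) <= K) -> r a <= K.
Proof.
move=> h.
have [l [lin dom la ext]] := extreme_dominated_exists (D := setT) I (fun _ _ _ _ => I)
  (fun _ _ _ => I) (radius_sublinear A) (I : setT a).
have [y [mu mu1 lE]] := extreme_Ch lin dom ext.
rewrite -la lE; apply: le_trans (Re_le_modc _) _.
by rewrite modcM mu1 mul1r.
Qed.

Lemma cl_boundary f (K : R) : cl A f ->
  (forall y : Ch A, modc (f (\val y)) <= K) -> forall x, modc (f x) <= K.
Proof.
move=> cf h x; apply/ler_addgt0Pr => e e0.
have e20 : 0 < e / 2 by rewrite divr_gt0.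
have [a ha] := cl_approx cf e20.
have := gelfand_le a x.
have : r a <= K + e / 2.
  apply: gelfand_boundary => y; have := h y; have := ha (\val y).
  have := modcD (f (\val y)) (gelfand a (\val y) - f (\val y)).
  rewrite addrCA subrr addr0 modcB; lra.
have := ha x; have := modcD (f x - gelfand a x) (gelfand a x); rewrite subrK; lra.
Qed.

Lemma cl_eq f g : cl A f -> cl A g -> (forall y : Ch A, f (\val y) = g (\val y)) -> f = g.
Proof.
move=> cf cg h; apply/funext => x; apply/eqP.
rewrite -subr_eq0 -modc_eq0 eq_le modc_ge0 andbT.
have := @cl_boundary _ 0 (cl_ZD (-1) cg cf) _ x.
rewrite combE mulN1r addrC; apply => y.
by rewrite combE h mulN1r addrC subrr modc0.
Qed.

End Choquet.

(** * Rotated boundary evaluations are extreme on dense real subspaces *)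

Section ChoquetExtreme.
Variables (R : realType) (A : comBanachAlgType R) (V : lmodType R[i]).

Local Notation X := (max_ideal_space A).
Local Notation D := (@fbounded R X).

Variable s : V -> X -> R[i].
Hypothesis s_cl : forall v, cl A (s v).
Hypothesis sD : forall u v, s (u + v) = s u + s v.
Hypothesis sZ : forall (t : R) v, s (t%:C%C *: v) = t%:C%C *: s v.
Hypothesis s_dense : forall f, cl A f -> forall e : R, 0 < e ->
  exists v, forall x, modc (f x - s v x) < e.

Lemma s_bounded v : D (s v).
Proof. by apply: cl_bounded. Qed.

Lemma dominated_dense m f (e : R) v : rlinear D m -> dominated D m (@sup_norm R X) ->
  D f -> (forall x, modc (f x - s v x) < e) -> `|m f - m (s v)| <= e.
Proof.
move=> lm dm Df h; have [x0 _] := char_exists A; have [mD _] := lm.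
have DN f' : D f' -> D (- f') by exact: (DN (@boundedRZ R X)).
have mN f' : D f' -> m (- f') = - m f' by exact: (rlinearN (@bounded0 R X) (@boundedRZ R X)).
have Ds := s_bounded v.
have mB f' g' : D f' -> D g' -> m (f' - g') = m f' - m g'.
  by move=> Df' Dg'; rewrite mD ?mN //; exact: DN.
have Db f' g' : D f' -> D g' -> D (f' - g').
  by move=> Df' Dg'; apply: boundedD => //; exact: DN.
rewrite ler_norml lerNl opprB -!mB //; apply/andP; split.
  apply: le_trans (dm _ (Db _ _ Ds Df)) _; apply: (sup_norm_le x0) => x.
  by rewrite modcB; exact/ltW/h.
apply: le_trans (dm _ (Db _ _ Df Ds)) _; apply: (sup_norm_le x0) => x.
exact/ltW/h.
Qed.

(** Since [s] is only real-linear, [l1] and [l2] are first extended to all bounded functions;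
    undoing the rotation by [la] and complexifying turns the extensions into states of [cl A] that
    average to the evaluation at [y]. *)
Lemma Ch_extreme (y : Ch A) (la : R[i]) : modc la = 1 ->
  extreme_dominated setT (fun v => sup_norm (s v))
    (fun v => complex.Re (la * s v (\val y))).
Proof.
move=> la1 l1 l2 t lin1 lin2 dom1 dom2 t01 h v _.
have [x0 _] := char_exists A; have [t0 t1] := andP t01.
have lan0 : la != 0 by rewrite -modc_gt0 la1.
have laV : modc la^-1 = 1 by rewrite modcV la1 invr1.
have ext l : rlinear setT l -> dominated setT l (fun v => sup_norm (s v)) ->
    exists M, [/\ rlinear D M, dominated D M (@sup_norm R X) & forall v, M (s v) = l v].
  move=> lin dom.
  have [M [linM domM Ml _]] := hahn_banach (@bounded0 R X) (@boundedD R X) (@boundedRZ R X)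
    s_bounded sD sZ (sup_norm_sublinear R x0) lin (fun v => dom v I) (@bounded0 R X).
  by exists M.
have [m1 [lm1 dm1 ml1]] := ext _ lin1 dom1.
have [m2 [lm2 dm2 ml2]] := ext _ lin2 dom2.
have comb g : cl A g -> t * m1 g + (1 - t) * m2 g = complex.Re (la * g (\val y)).
  move=> cg; apply/eqP; rewrite -subr_eq0 -normr_eq0 eq_le normr_ge0 andbT.
  apply/ler_addgt0Pr => e e0; rewrite add0r.
  have e20 : 0 < e / 2 by rewrite divr_gt0.
  have [u hu] := s_dense cg e20.
  have b1 := dominated_dense lm1 dm1 (cl_bounded cg) hu.
  have b2 := dominated_dense lm2 dm2 (cl_bounded cg) hu.
  have b3 : `|complex.Re (la * g (\val y)) - complex.Re (la * s u (\val y))| <= e / 2.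
    rewrite -raddfB -mulrBr; apply: le_trans (normRe_le _) _.
    by rewrite modcM la1 mul1r ltW.
  have := h u I; rewrite -ml1 -ml2 => hu'; move: b3; rewrite hu'.
  move: b1 b2; rewrite !ler_norml => /andP[a1 a2] /andP[a3 a4] /andP[a5 a6].
  have := ler_wpM2l (ltW t0) a1; have := ler_wpM2l (ltW t0) a2.
  have t1' : 0 <= 1 - t by rewrite subr_ge0 ltW.
  have := ler_wpM2l t1' a3; have := ler_wpM2l t1' a4.
  rewrite !mulrBr !mulrN => *; apply/andP; split; lra.
pose L (m : (X -> R[i]) -> R) f := complexify m (la^-1 *: f).
have Lcomb f : cl A f -> t%:C%C * L m1 f + (1 - t)%:C%C * L m2 f = f (\val y).
  move=> cf; rewrite /L /complexify.
  have c1 : cl A (la^-1 *: f).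
    have := cl_ZD la^-1 cf (cl_cst A 0); congr cl.
    by apply/funext => x; rewrite combE addr0.
  have c2 : cl A ('i%C *: (la^-1 *: f)).
    have := cl_ZD 'i%C c1 (cl_cst A 0); congr cl.
    by apply/funext => x; rewrite combE addr0.
  have := comb _ c1; have := comb _ c2; rewrite !pointwiseE mulrCA !(mulVKf lan0).
  case: (f (\val y)) => a b; simpc => /= e1 e2.
  by rewrite e2; congr (_ +i* _)%C; rewrite -[RHS]opprK -e1; ring.
have stL m : rlinear D m -> dominated D m (@sup_norm R X) ->
    (forall f, cl A f -> modc (L m f) <= sup_norm f) /\
    (forall c f g, cl A f -> cl A g -> L m (c \*: f \+ g) = c * L m f + L m g).
  move=> lm dm; split=> [f cf|c f g cf cg].
    apply: le_trans (complexify_le x0 lm dm (boundedZ _ (cl_bounded cf))) _.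
    apply: le_trans (sup_normZ x0 _ (cl_bounded cf)) _.
    by rewrite laV mul1r.
  rewrite /L.
  have -> : la^-1 *: (c \*: f \+ g) = c *: (la^-1 *: f) + la^-1 *: g.
    apply/funext => x; rewrite !pointwiseE combE; ring.
  by rewrite complexifyD ?complexifyZ //; do ?apply: boundedZ; apply: cl_bounded.
have [le1 cl1] := stL _ lm1 dm1; have [le2 cl2] := stL _ lm2 dm2.
have n1 : sup_norm (cst 1 : X -> R[i]) <= 1 by apply: (sup_norm_le x0) => x; rewrite modc1.
(* The point 1 is extreme in the closed unit disc; this gives both functionals the value 1 at the
   constant 1, as states require. *)
have one (z1 z2 : R[i]) u : 0 < u < 1 -> modc z1 <= 1 -> modc z2 <= 1 ->
    u%:C%C * z1 + (1 - u)%:C%C * z2 = 1 -> z1 = 1.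
  move=> /andP[u0 u1] hz1 hz2 e.
  have := congr1 (@complex.Re R) e; rewrite raddfD /= !Re_scale.
  have := Re_le_modc z1; have := Re_le_modc z2 => h2 h1 e'.
  have u1' : 0 <= 1 - u by rewrite subr_ge0 ltW.
  have := ler_wpM2l u1' (le_trans h2 hz2) => h3.
  have r1 : complex.Re z1 = 1.
    apply/eqP; rewrite eq_le (le_trans h1 hz1) /= -(ler_pM2l u0); lra.
  have := sqr_modc z1; rewrite r1 expr1n => h4.
  have : modc z1 ^+ 2 <= 1 by rewrite exprn_ile1 ?modc_ge0.
  rewrite h4 gerDl => h5.
  have i1 : complex.Im z1 = 0 by apply/eqP; rewrite -sqrf_eq0 eq_le h5 sqr_ge0.
  by rewrite [z1]complexE r1 i1 mulr0 addr0.
have e1 := Lcomb _ (cl_cst A 1).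
have L11 : L m1 (cst 1) = 1.
  apply: (one _ (L m2 (cst 1)) t) => //; first exact: le_trans (le1 _ (cl_cst _ _)) n1.
  exact: le_trans (le2 _ (cl_cst _ _)) n1.
have L21 : L m2 (cst 1) = 1.
  apply: (one _ (L m1 (cst 1)) (1 - t)) => //.
  - by rewrite subr_gt0 t1 gtrBl.
  - exact: le_trans (le2 _ (cl_cst _ _)) n1.
  - exact: le_trans (le1 _ (cl_cst _ _)) n1.
  by rewrite subKr addrC.
have Chy : choquet_boundary (cl A) (\val y) by exact: set_mem (valP y).
have [] := Chy (L m1) (L m2) t _ _ t01 _ (la *: s v).
- by split.
- by split.
- by move=> f cf; rewrite Lcomb.
- have := cl_ZD la (s_cl v) (cl_cst A 0); congr cl.
  by apply/funext => x; rewrite combE addr0.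
move=> e _; rewrite -ml1 -(Re_complexify m1).
have -> : s v = la^-1 *: (la *: s v) by rewrite scalerA mulVf // scale1r.
by rewrite -/(L m1 (la *: s v)) e !pointwiseE mulVKf.
Qed.

End ChoquetExtreme.

(** * Peaking elements at Choquet boundary points *)

Section Peak.
(** Writes [|z|^2] as real weights times complex-linear functions of [z], the form to which
    [weight_real] applies. *)
Lemma sq_ReIm (R : realType) (z : R[i]) : (complex.Re z ^+ 2 + complex.Im z ^+ 2)%:C%C =
  (complex.Re z)%:C%C * z + (complex.Im z)%:C%C * (- 'i%C * z).
Proof. by case: z => a b /=; simpc; congr (_ +i* _)%C; ring. Qed.

Variables (R : realType) (A : comBanachAlgType R).
Local Notation X := (max_ideal_space A).
Local Notation D := (@fbounded R X).
Local Notation r := (@spectral_radius R A).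

Lemma eval_extreme (y : Ch A) (la : R[i]) : modc la = 1 ->
  extreme_dominated setT r (fun a => complex.Re (la * gelfand a (\val y))).
Proof.
move=> la1; have := @Ch_extreme R A A (@gelfand R A) (@cl_gelfand R A) (@gelfand_addE R A)
   (fun t v => gelfand_scaleE t%:C%C v) (fun f cf e e0 => cl_approx cf e0) y la la1.
by congr extreme_dominated; apply/funext => a; rewrite spectral_radiusE.
Qed.

(** With [h = g - g(y)], [sq_ReIm] and [weight_real] show that an extension of the evaluation at [y]
    dominated by [sup_Re] kills [w0 = C |h|^2], as [h] vanishes at [y]. For the extension that is
    largest at [w0] this says that [sup_Re (w0 - v) + Re v(y)] is below [e] for some [v]; then
    [u = v(y) - v] works. *)
Lemma peak (y : Ch A) (g : A) (C e : R) : 0 < e ->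
  exists2 u, gelfand u (\val y) = 0 &
    forall x, complex.Re (gelfand u x) <= e - C * modc (gelfand g x - gelfand g (\val y)) ^+ 2.
Proof.
move=> e0; have [x0 _] := char_exists A.
pose l (a : A) := complex.Re (1 * gelfand a (\val y)).
have ext : extreme_dominated setT r l by apply: eval_extreme; rewrite modc1.
have lin : rlinear setT l by exact: Re_eval_linear.
pose h := g - (gelfand g (\val y))%:A.
have hy : gelfand h (\val y) = 0 by rewrite gelfandB gelfand_scalar subrr.
have hE x : gelfand h x = gelfand g x - gelfand g (\val y).
  by rewrite gelfandB gelfand_scalar.
pose w0 : X -> R[i] := fun x => (C * modc (gelfand h x) ^+ 2)%:C%C.
have Dw0 : D w0.
  exists (`|C| * r h ^+ 2) => x; rewrite modcR normrM ler_wpM2l //.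
  by rewrite ger0_norm ?sqr_ge0 // lerXn2r ?nnegrE ?modc_ge0 ?radius_ge0 ?gelfand_le.
have lP (a : A) : l a <= sup_Re (gelfand a).
  by rewrite /l mul1r; apply: sup_Re_ge; exact: gelfand_bounded.
have [M [linM domM Ml Mw0]] := hahn_banach (@bounded0 R X) (@boundedD R X) (@boundedRZ R X)
    (@bounded_gelfand R A) (@gelfand_addE R A) (fun t v => gelfand_scaleE t%:C%C v)
    (sup_Re_sublinear R x0) lin lP Dw0.
have domM' : dominated D M (@sup_norm R X).
  by move=> f Df; apply: le_trans (domM _ Df) _; exact: sup_Re_le_norm.
have M0 : M w0 = 0.
  have [|c1 hc1] := weight_real ext linM domM' Ml (w := fun x => complex.Re (gelfand h x)) (K := r h).
    by move=> x; apply: le_trans (gelfand_le h x); exact: normRe_le.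
  have [|c2 hc2] := weight_real ext linM domM' Ml (w := fun x => complex.Im (gelfand h x)) (K := r h).
    by move=> x; apply: le_trans (gelfand_le h x); exact: normIm_le.
  have [MD MZ] := linM.
  pose w1 := weight (fun x => complex.Re (gelfand h x)) * gelfand h.
  pose w2 := weight (fun x => complex.Im (gelfand h x)) * gelfand (- 'i%C *: h).
  have Dw1 : D w1.
    apply: boundedM; last exact: bounded_gelfand.
    apply: (@weight_bounded _ _ _ (r h)) => x.
    by apply: le_trans (gelfand_le h x); exact: normRe_le.
  have Dw2 : D w2.
    apply: boundedM; last exact: bounded_gelfand.
    apply: (@weight_bounded _ _ _ (r h)) => x.
    by apply: le_trans (gelfand_le h x); exact: normIm_le.
  have -> : w0 = C%:C%C *: (w1 + w2).
    apply/funext => x; rewrite !pointwiseE /w0 /w1 /w2 !pointwiseE /weight gelfandZ sqr_modc.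
    rewrite rmorphM; congr (_ * _).
    exact: sq_ReIm.
  rewrite MZ ?MD //; last exact: boundedD.
  have l0 : l h = 0 by rewrite /l hy mulr0.
  have l1 : l (- 'i%C *: h) = 0 by rewrite /l gelfandZ hy !mulr0.
  by rewrite /w1 /w2 hc1 hc2 l0 l1 !mulr0 addr0 mulr0.
have [v] := Mw0 e e0; rewrite M0 add0r => hv.
exists ((gelfand v (\val y))%:A - v).
  by rewrite gelfandB gelfand_scalar subrr.
move=> x; have Dd : D (w0 - gelfand v).
  by apply: boundedD => //; apply: (DN (@boundedRZ R X)); exact: bounded_gelfand.
have := le_lt_trans (lerD (sup_Re_ge x Dd) (lexx (l v))) hv.
have -> : complex.Re ((w0 - gelfand v) x) =
    C * modc (gelfand h x) ^+ 2 - complex.Re (gelfand v x).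
  by have -> : (w0 - gelfand v) x = w0 x - gelfand v x by []; rewrite raddfB.
have -> : complex.Re (gelfand ((gelfand v (\val y))%:A - v) x) =
    complex.Re (gelfand v (\val y)) - complex.Re (gelfand v x).
  by rewrite gelfandB gelfand_scalar raddfB.
rewrite -hE /l mul1r; lra.
Qed.

End Peak.

(** * The multiplicative metric on the units *)

Section Ratio.
Variables (R : realType) (A : comBanachAlgType R).
Implicit Types a b c f g h : A.

Local Notation r := (@spectral_radius R A).
Local Notation U := (@GRing.unit A).

Definition rdist f h : R := r (f / h - 1).

(* [1 + dist] is multiplicatively subadditive, so that [ln (1 + dist)] is
   a translation-invariant metric on the group of units. *)
Definition dist f h : R := Num.max (rdist f h) (rdist h f).

Lemma radiusV_le a (m : R) : 0 < m -> (forall x, m <= modc (gelfand a x)) ->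
  a \is a GRing.unit /\ r a^-1 <= m^-1.
Proof.
move=> m0 h; have au : a \is a GRing.unit.
  by apply: unit_char => x; rewrite -modc_gt0; exact: lt_le_trans (h x).
split=> //; apply: radius_le => x; rewrite gelfandV // modcV.
by rewrite lef_pV2 ?posrE // (lt_le_trans m0).
Qed.

Lemma rdist_ge0 f h : 0 <= rdist f h.
Proof. exact: radius_ge0. Qed.

Lemma dist_ge0 f h : 0 <= dist f h.
Proof. by rewrite le_max rdist_ge0. Qed.

Lemma dist_sym f h : dist f h = dist h f.
Proof. by rewrite /dist maxC. Qed.

Lemma rdist_le_dist f h : rdist f h <= dist f h.
Proof. by rewrite le_max lexx. Qed.

(** With [u = f / h - 1] and [v = h / k - 1], one has [f / k - 1 = u + v + u v]. *)
Lemma rdist_tri f h k : h \is a GRing.unit ->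
  1 + rdist f k <= (1 + rdist f h) * (1 + rdist h k).
Proof.
move=> hu; have -> : rdist f k = r ((f / h - 1) + (h / k - 1) + (f / h - 1) * (h / k - 1)).
  congr r; rewrite -[f / k](_ : (f / h) * (h / k) = _); last by rewrite mulrA divrK.
  ring.
have := radiusD ((f / h - 1) + (h / k - 1)) ((f / h - 1) * (h / k - 1)).
have := radiusD (f / h - 1) (h / k - 1).
have := radiusM (f / h - 1) (h / k - 1).
rewrite /rdist; lra.
Qed.

Lemma dist_tri f h k : h \is a GRing.unit ->
  1 + dist f k <= (1 + dist f h) * (1 + dist h k).
Proof.
move=> hu; rewrite -lerBrDl ge_max !lerBrDl.
have p u v : 0 <= 1 + rdist u v by rewrite addr_ge0 ?rdist_ge0.
apply/andP; split.
  apply: le_trans (rdist_tri _ _ hu) _; apply: ler_pM => //; rewrite lerD2l.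
    exact: rdist_le_dist.
  exact: rdist_le_dist.
apply: le_trans (rdist_tri _ _ hu) _; rewrite mulrC.
by apply: ler_pM => //; rewrite lerD2l dist_sym rdist_le_dist.
Qed.

Lemma rdistM c f h : c \is a GRing.unit -> h \is a GRing.unit ->
  rdist (c * f) (c * h) = rdist f h.
Proof.
move=> cu hu; congr r; congr (_ - _).
by rewrite invrM // [h^-1 * _]mulrC mulrA [c * f]mulrC mulrK.
Qed.

Lemma distM c f h : c \is a GRing.unit -> f \is a GRing.unit -> h \is a GRing.unit ->
  dist (c * f) (c * h) = dist f h.
Proof. by move=> cu fu hu; rewrite /dist !rdistM. Qed.

Lemma distV f h : f \is a GRing.unit -> h \is a GRing.unit -> dist f^-1 h^-1 = dist f h.
Proof. by move=> fu hu; rewrite /dist /rdist !invrK maxC ![_^-1 * _]mulrC. Qed.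

Lemma dist_reflection b f h : b \is a GRing.unit -> f \is a GRing.unit -> h \is a GRing.unit ->
  dist (b / f) (b / h) = dist f h.
Proof. by move=> bu fu hu; rewrite distM ?unitrV // distV. Qed.

(** For [u = f / h - 1] the ratio of the squares minus 1 is [2 u + u^2]: squaring nearly doubles
    small distances. This supplies the expansion in the reflection argument. *)
Lemma rdist_sqr f h : f \is a GRing.unit -> h \is a GRing.unit ->
  (2 - rdist f h) * rdist f h <= rdist (f ^+ 2) (h ^+ 2).
Proof.
move=> fu hu; set u := f / h - 1.
have -> : rdist (f ^+ 2) (h ^+ 2) = r (u * 2 + u * u).
  congr r; rewrite -expr2 /u -exprVn -exprMn; ring.
have := radius_le_sub (u * 2) (- (u * u)); rewrite opprK radiusN.
have -> : r (u * 2) = 2 * r u.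
  have -> : u * 2 = (2%:R : R[i]) *: u by rewrite scaler_nat; ring.
  rewrite radiusZ; congr (_ * _).
  by have := modcR (2 : R); rewrite rmorph_nat ger0_norm.
have := radiusM u u; rewrite /rdist -/u; lra.
Qed.

Lemma dist_sqr f h : f \is a GRing.unit -> h \is a GRing.unit ->
  (2 - dist f h) * dist f h <= dist (f ^+ 2) (h ^+ 2).
Proof.
move=> fu hu.
have : dist f h = rdist f h \/ dist f h = rdist h f.
  by rewrite /dist; case: leP => _; [right|left].
by case=> ->; apply: le_trans (rdist_sqr _ _) _ => //; rewrite le_max lexx ?orbT.
Qed.

Lemma dist_eq0 f h : semisimple A -> h \is a GRing.unit -> dist f h <= 0 -> f = h.
Proof.
move=> ss hu; rewrite ge_max => /andP[h1 _].
have : r (f / h - 1) = 0 by apply/eqP; rewrite eq_le radius_ge0 andbT.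
move=> /(radius_eq0 ss)/eqP; rewrite subr_eq0 => /eqP e.
by rewrite -(divrK hu f) e mul1r.
Qed.

(** Fixed-point iteration for [p = (t + p^2) / 2], that is, for [(1 - p)^2 = 1 - t]. For
    [r t <= 2^-1] it stays in the ball of radius one half, and successive differences are halved. *)
Fixpoint sqrt_iter (t : A) n : A :=
  if n is n'.+1 then 2^-1 *: (t + sqrt_iter t n' ^+ 2) else 0.

Lemma modc2 : modc 2 = 2 :> R.
Proof. by have := modcR (2 : R); rewrite rmorph_nat ger0_norm. Qed.

Lemma sqrt_iter_le t n : r t <= 2^-1 -> r (sqrt_iter t n) <= 2^-1.
Proof.
move=> ht; elim: n => [|n IH] /=; first by rewrite spectral_radius0 invr_ge0.
rewrite radiusZ modcV modc2.
have := radiusD t (sqrt_iter t n ^+ 2); have := radiusX (sqrt_iter t n) 2.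
have : r (sqrt_iter t n) ^+ 2 <= 2^-1 ^+ 2.
  by rewrite lerXn2r ?nnegrE ?radius_ge0 ?invr_ge0.
rewrite expr2; lra.
Qed.

Lemma sqrt_iter_step t n : r t <= 2^-1 ->
  r (sqrt_iter t n.+1 - sqrt_iter t n) <= 2^-1 ^+ n.+1.
Proof.
move=> ht; elim: n => [|n IH].
  rewrite /= expr0n addr0 subr0 radiusZ modcV modc2 expr1.
  have := radius_ge0 t; lra.
have -> : sqrt_iter t n.+2 - sqrt_iter t n.+1 =
    2^-1 *: ((sqrt_iter t n.+1 - sqrt_iter t n) * (sqrt_iter t n.+1 + sqrt_iter t n)).
  rewrite [sqrt_iter t n.+2]/= {2}/sqrt_iter -/sqrt_iter -scalerBr; congr (_ *: _).
  ring.
rewrite radiusZ modcV modc2 exprS ler_wpM2l ?invr_ge0 //.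
apply: le_trans (radiusM _ _) _; apply: le_trans (_ : 2^-1 ^+ n.+1 * 1 <= _); last by rewrite mulr1.
apply: ler_pM; rewrite ?radius_ge0 //.
have := radiusD (sqrt_iter t n.+1) (sqrt_iter t n).
have := sqrt_iter_le n.+1 ht; have := sqrt_iter_le n ht; lra.
Qed.

Lemma half_double a : 2^-1 *: (2 * a) = a.
Proof.
have h : (2%:R : R[i]) *: a = 2 * a by rewrite scaler_nat mulr_natl.
by rewrite -h scalerA mulVf ?pnatr_eq0 // scale1r.
Qed.

(** For [s = 1 - sqrt_iter t n] the error [s^2 - y] is exactly twice the next increment of the
    iteration, and the inverses of [s] and [y] have spectral radius at most 2. *)
Lemma approx_sqrt y (e : R) : r (y - 1) <= 2^-1 -> 0 < e ->
  exists2 s, s \is a GRing.unit & dist (s ^+ 2) y <= e.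
Proof.
move=> hy e0; pose t := 1 - y; have ht : r t <= 2^-1 by rewrite radiusB.
have lbd z : r z <= 2^-1 -> (1 - z) \is a GRing.unit /\ r (1 - z)^-1 <= 2.
  move=> hz; rewrite -[2]invrK; apply: radiusV_le; first by rewrite invr_gt0.
  move=> x; rewrite gelfandB gelfand1; have := modcNB 1 (gelfand z x).
  rewrite modc1; have := gelfand_le z x; lra.
have [yu ry] : y \is a GRing.unit /\ r y^-1 <= 2.
  by have := lbd _ ht; rewrite /t subKr.
have [|n hn] := exp_half_lt (e := e / 8); first by rewrite divr_gt0.
pose s := 1 - sqrt_iter t n.
have [su rs] := lbd _ (sqrt_iter_le n ht).
exists s => //.
have de : s ^+ 2 - y = 2 * (sqrt_iter t n.+1 - sqrt_iter t n).
  rewrite /= /s /t mulrBr -[2 * (_ *: _)]scalerAr.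
  rewrite half_double.
  ring.
have rd : r (s ^+ 2 - y) <= e / 4.
  rewrite de; have -> (z : A) : 2 * z = (2%:R : R[i]) *: z by rewrite scaler_nat mulr_natl.
  rewrite radiusZ modc2; have := sqrt_iter_step n ht; have := hn _ (leqnSn n); lra.
have rd0 := radius_ge0 (s ^+ 2 - y).
rewrite ge_max; apply/andP; split.
  have -> : rdist (s ^+ 2) y = r ((s ^+ 2 - y) / y) by rewrite mulrBl divrr.
  apply: le_trans (radiusM _ _) _.
  apply: le_trans (_ : e / 4 * 2 <= _); last lra.
  by apply: ler_pM; rewrite ?radius_ge0.
have -> : rdist y (s ^+ 2) = r ((s ^+ 2 - y) * (s^-1 * s^-1)).
  rewrite -radiusN -mulNr opprB mulrBl -expr2 exprVn divrr ?unitrX //.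
apply: le_trans (radiusM _ _) _.
apply: le_trans (_ : e / 4 * (2 * 2) <= _); last lra.
apply: ler_pM; rewrite ?radius_ge0 //; apply: le_trans (radiusM _ _) _.
by apply: ler_pM; rewrite ?radius_ge0.
Qed.

End Ratio.

Lemma small_power (R : realType) (d : R) n : 0 < d ->
  exists e : R, 0 < e /\ (1 + e) ^+ n <= 1 + d.
Proof.
move=> d0; pose e : R := Num.min 1 (d / 2 ^+ n).
have p0 : 0 < (2 : R) ^+ n by rewrite exprn_gt0.
have e0 : 0 < e by rewrite lt_min ltr01 divr_gt0.
have e1 : e <= 1 by rewrite ge_min lexx.
have e2 : e * 2 ^+ n <= d by rewrite -ler_pdivlMr // ge_min lexx orbT.
exists e; split=> //.
have h m : (1 + e) ^+ m <= 1 + (2 ^+ m - 1) * e.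
  elim: m => [|m IH]; first by rewrite !expr0 subrr mul0r addr0.
  rewrite exprSr; apply: le_trans (_ : (1 + (2 ^+ m - 1) * e) * (1 + e) <= _).
    by rewrite ler_wpM2r // addr_ge0 // ltW.
  have p1 : 0 <= (2 : R) ^+ m - 1 by rewrite subr_ge0 exprn_ege1 // ler1n.
  have : (2 ^+ m - 1) * (e * e) <= (2 ^+ m - 1) * (e * 1).
    by rewrite ler_wpM2l // ler_wpM2l // ltW.
  rewrite exprSr; lra.
by apply: le_trans (h n) _; rewrite mulrBl mul1r; lra.
Qed.

(** * The reflection argument: [T] preserves nearby multiplicative midpoints *)

Section MazurUlam.
Variables (R : realType) (A B : comBanachAlgType R).
Hypothesis ssB : semisimple B.
Variables (T : A -> B) (T' : B -> A).
Hypothesis Tu : forall f, f \is a GRing.unit -> T f \is a GRing.unit.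
Hypothesis T'u : forall g, g \is a GRing.unit -> T' g \is a GRing.unit.
Hypothesis TK : forall f, f \is a GRing.unit -> T' (T f) = f.
Hypothesis T'K : forall g, g \is a GRing.unit -> T (T' g) = g.
Hypothesis T_dist : forall f h, f \is a GRing.unit -> h \is a GRing.unit ->
  dist (T f) (T h) = dist f h.

Lemma T'_dist f h : f \is a GRing.unit -> h \is a GRing.unit -> dist (T' f) (T' h) = dist f h.
Proof. by move=> fu hu; rewrite -T_dist ?T'u // !T'K. Qed.

Section Midpoint.
Variables (a b : A).
Hypotheses (au : a \is a GRing.unit) (bu : b \is a GRing.unit).
Hypothesis ab : dist a b <= 8^-1.

(** The point reflection in [b], with [b] as the multiplicative midpoint of [a] and [c]. *)
Let reflect_b x := b ^+ 2 / x.
Let c := reflect_b a.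

Lemma reflect_b_unit x : x \is a GRing.unit -> reflect_b x \is a GRing.unit.
Proof. by move=> xu; rewrite unitrM unitrX ?unitrV. Qed.

Lemma reflect_bK x : x \is a GRing.unit -> reflect_b (reflect_b x) = x.
Proof.
move=> xu; rewrite /reflect_b invrM ?unitrX ?unitrV // invrK.
by rewrite [x * _]mulrC mulrA divrr ?unitrX // mul1r.
Qed.

Lemma reflect_b_dist x y : x \is a GRing.unit -> y \is a GRing.unit ->
  dist (reflect_b x) (reflect_b y) = dist x y.
Proof. by move=> xu yu; rewrite dist_reflection ?unitrX. Qed.

Lemma reflect_b_fix : reflect_b b = b.
Proof. by rewrite /reflect_b expr2 mulrK. Qed.

(** A bijective isometry of the units together with its inverse. *)
Definition isometry_pair (g : (A -> A) * (A -> A)) :=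
  forall x, x \is a GRing.unit ->
  [/\ g.1 x \is a GRing.unit, g.2 x \is a GRing.unit, g.2 (g.1 x) = x, g.1 (g.2 x) = x &
    forall y, y \is a GRing.unit -> dist (g.1 x) (g.1 y) = dist x y].

(** With [rho] the reflection in [b], this is [g -> rho g^-1 rho g], which magnifies the
    displacement of [b]. *)
Let step (g : (A -> A) * (A -> A)) : (A -> A) * (A -> A) :=
  (fun x => reflect_b (g.2 (reflect_b (g.1 x))), fun x => g.2 (reflect_b (g.1 (reflect_b x)))).

Lemma isometry_pair_inv g x y : isometry_pair g -> x \is a GRing.unit -> y \is a GRing.unit ->
  dist (g.2 x) (g.2 y) = dist x y.
Proof.
move=> ig xu yu; have [_ x2 _ x3 _] := ig _ xu; have [_ y2 _ y3 _] := ig _ yu.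
by have [_ _ _ _ h] := ig _ x2; rewrite -h // x3 y3.
Qed.

Lemma step_isometry g : isometry_pair g -> isometry_pair (step g).
Proof.
move=> ig; have ru := reflect_b_unit.
have g1u x : x \is a GRing.unit -> g.1 x \is a GRing.unit by move=> /ig[].
have g2u x : x \is a GRing.unit -> g.2 x \is a GRing.unit by move=> /ig[].
have g12 x : x \is a GRing.unit -> g.1 (g.2 x) = x by move=> /ig[].
have g21 x : x \is a GRing.unit -> g.2 (g.1 x) = x by move=> /ig[].
have gd x y : x \is a GRing.unit -> y \is a GRing.unit -> dist (g.1 x) (g.1 y) = dist x y.
  by move=> /ig[_ _ _ _ h] /h.
move=> x xu; split=> /=.
- by apply/ru/g2u/ru/g1u.
- by apply/g2u/ru/g1u/ru.
- by rewrite reflect_bK ?g12 ?reflect_bK ?g21 //; do ?[apply: ru|apply: g1u|apply: g2u].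
- have xr := ru _ xu; have x1 := g1u _ xr; have x2 := ru _ x1.
  by rewrite g12 // (reflect_bK x1) (g21 _ xr) reflect_bK.
move=> y yu; rewrite reflect_b_dist ?isometry_pair_inv ?reflect_b_dist ?gd //;
  by do ?[apply: ru|apply: g1u|apply: g2u].
Qed.

(** With [z = g.1 b], isometries carry the new displacement to
    [dist (b^2 / z) z = dist (b^2) (z^2)], which is at least [(2 - d) d] for [d = dist z b]. *)
Lemma step_expand g : isometry_pair g -> dist (g.1 b) b <= 2^-1 ->
  3 / 2 * dist (g.1 b) b <= dist ((step g).1 b) b.
Proof.
move=> ig gb; have [g1b g2b _ _ _] := ig _ bu.
have ru := reflect_b_unit.
have r1 := ru _ g1b; have [_ g2r _ g12 _] := ig _ r1.
rewrite /= -{4}reflect_b_fix reflect_b_dist //.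
have [_ _ _ _ <-] // := ig _ g2r; rewrite g12.
have -> : dist (reflect_b (g.1 b)) (g.1 b) = dist (b ^+ 2) (g.1 b ^+ 2).
  rewrite -(distM g1b) // /reflect_b mulrCA divrr // mulr1 -expr2 //.
rewrite dist_sym in gb *; apply: le_trans (dist_sqr bu g1b).
rewrite ler_wpM2r ?dist_ge0 //; lra.
Qed.

(** The reflection exchanges [a] and [c], so the new displacement of either point is bounded by the
    old displacements of both, multiplicatively. *)
Lemma step_drift g (q : R) : isometry_pair g -> 1 + dist (g.1 a) a <= q -> 1 + dist (g.1 c) c <= q ->
  1 + dist ((step g).1 a) a <= q ^+ 2 /\ 1 + dist ((step g).1 c) c <= q ^+ 2.
Proof.
move=> ig qa qc; have ru := reflect_b_unit; have cu : c \is a GRing.unit by exact: ru.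
have p1 x y : 0 <= 1 + dist x y :> R by rewrite addr_ge0 ?dist_ge0.
have key u v : u \is a GRing.unit -> v \is a GRing.unit -> reflect_b v = u -> 1 + dist (g.1 u) u <= q ->
    1 + dist (g.1 v) v <= q -> 1 + dist ((step g).1 u) u <= q ^+ 2.
  move=> uu vu vE qu qv; have [g1u _ _ _ _] := ig _ uu; have [g1v _ _ _ _] := ig _ vu.
  have r1 := ru _ g1u; have [_ g2r _ g12 _] := ig _ r1.
  rewrite /= -{2}vE reflect_b_dist //.
  have [_ _ _ _ <-] // := ig _ g2r; rewrite g12.
  apply: le_trans (dist_tri _ _ vu) _; rewrite expr2; apply: ler_pM => //.
    by rewrite -{1}[v]reflect_bK // vE reflect_b_dist.
  by rewrite dist_sym.
split; first by apply: (key a c) => //; exact: reflect_bK.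
exact: (key c a).
Qed.

Lemma iter_drift g k (q : R) : isometry_pair g -> 1 + dist (g.1 a) a <= q -> 1 + dist (g.1 c) c <= q ->
  [/\ isometry_pair (iter k step g), 1 + dist ((iter k step g).1 a) a <= q ^+ (2 ^ k) &
   1 + dist ((iter k step g).1 c) c <= q ^+ (2 ^ k)].
Proof.
move=> ig qa qc; elim: k => [|k [IH1 IH2 IH3]]; first by rewrite expn0 expr1.
rewrite iterS; split; first exact: step_isometry.
  by rewrite expnSr exprM; have [] := step_drift IH1 IH2 IH3.
by rewrite expnSr exprM; have [] := step_drift IH1 IH2 IH3.
Qed.

(** An isometry that nearly fixes [a] cannot move the nearby [b] far:
    [9/8 * 10/9 * 9/8 = 45/32 < 3/2]. *)
Lemma iter_near g k (q : R) : isometry_pair g -> 1 + dist (g.1 a) a <= q -> 1 + dist (g.1 c) c <= q ->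
  q ^+ (2 ^ k) <= 10 / 9 -> dist ((iter k step g).1 b) b <= 2^-1.
Proof.
move=> ig qa qc qk; have [ik ka _] := iter_drift k ig qa qc.
have [gb _ _ _ _] := ik _ bu; have [ga _ _ _ gab] := ik _ au.
have h1 := dist_tri ((iter k step g).1 b) b ga.
have h2 := dist_tri ((iter k step g).1 a) b au.
rewrite [dist ((iter k step g).1 b) ((iter k step g).1 a)]dist_sym gab // in h1.
have p1 x y : 0 <= 1 + dist x y :> R by rewrite addr_ge0 ?dist_ge0.
have h3 : (1 + dist ((iter k step g).1 a) a) * (1 + dist a b) <= 10 / 9 * (9 / 8).
  apply: ler_pM => //; first exact: le_trans ka qk.
  by have := ab; lra.
have h4 : (1 + dist a b) * (1 + dist ((iter k step g).1 a) b) <= 9 / 8 * (10 / 9 * (9 / 8)).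
  apply: ler_pM => //; last exact: le_trans h2 h3.
  by have := ab; lra.
lra.
Qed.

Lemma iter_expand g k (q : R) : isometry_pair g -> 1 <= q ->
  1 + dist (g.1 a) a <= q -> 1 + dist (g.1 c) c <= q ->
  q ^+ (2 ^ k) <= 10 / 9 -> (3 / 2) ^+ k * dist (g.1 b) b <= dist ((iter k step g).1 b) b.
Proof.
move=> ig q1 qa qc; elim: k => [|k IH] qk; first by rewrite expr0 mul1r.
have qk' : q ^+ (2 ^ k) <= 10 / 9.
  by apply: le_trans qk; rewrite ler_weXn2l // leq_exp2l.
have [ik _ _] := iter_drift k ig qa qc.
rewrite iterS; apply: le_trans (step_expand ik _); last exact: iter_near qk'.
by rewrite exprS -mulrA ler_wpM2l ?IH //; lra.
Qed.

(** The isometry [g] is [T] followed by [z -> m / z], the inverse of [T] and the reflection in [b],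
    where [m] is close to [T a * T c]. It nearly fixes [a] and [c], and moves [b] by
    [dist m (T b ^+ 2)]. The iterates of [step] magnify this distance geometrically but keep [b]
    within one half, so it is tiny. *)
Lemma mazur_ulam : T c = T b ^+ 2 / T a.
Proof.
have cu : c \is a GRing.unit by exact: reflect_b_unit.
have Tau := Tu au; have Tbu := Tu bu; have Tcu := Tu cu.
have p1 (C : comBanachAlgType R) (x y : C) : 0 <= 1 + dist x y :> R.
  by rewrite addr_ge0 ?dist_ge0.
have ac : rdist (T c) (T a) <= 2^-1.
  apply: le_trans (rdist_le_dist _ _) _; rewrite T_dist //.
  have cb : dist c b = dist a b by rewrite -[in LHS]reflect_b_fix reflect_b_dist.
  have := dist_tri c a bu; rewrite cb dist_sym [dist b a]dist_sym => h1.
  have h2 : (1 + dist a b) * (1 + dist a b) <= 9 / 8 * (9 / 8).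
    by apply: ler_pM; rewrite ?p1 //; have := ab; lra.
  have := le_trans h1 h2; rewrite dist_sym -lerBrDl => h3; apply: le_trans h3 _; lra.
suff h e : 0 < e -> dist (T a * T c) (T b ^+ 2) <= e.
  have /(dist_eq0 ssB) <- : dist (T a * T c) (T b ^+ 2) <= 0 => //.
  - by apply/ler_addgt0Pr => e e0; rewrite add0r; exact: h.
  - by rewrite [T a * _]mulrC mulrK.
  by rewrite unitrX.
move=> e0.
pose d := Num.min e 1.
have d0 : 0 < d by rewrite lt_min e0 ltr01.
have d1 : d <= 1 by rewrite ge_min lexx orbT.
have [|k0 /(_ k0 (leqnn _)) hk] := exp_half_lt (e := d / 16); first by rewrite divr_gt0.
(* Two steps more than double the displacement, since [(3/2)^2 >= 2]. *)
pose k := (2 * k0)%N.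
have hk3 : 2 ^+ k0 <= (3 / 2 : R) ^+ k.
  by rewrite exprM lerXn2r ?nnegrE ?sqr_ge0 //; lra.
have [|e1 [e10 he1]] := @small_power R 9^-1 (2 ^ k); first by rewrite invr_gt0.
(* [e1] keeps the drift of [a] and [c] below [10/9] after [k] steps; [d / 16] controls the error of
   [m]. *)
pose e2 := Num.min e1 (d / 16).
have e20 : 0 < e2 by rewrite lt_min e10 divr_gt0.
have he2 : (1 + e2) ^+ (2 ^ k) <= 10 / 9.
  apply: le_trans (_ : (1 + e1) ^+ (2 ^ k) <= _); last lra.
  by rewrite lerXn2r ?nnegrE ?addr_ge0 ?(ltW e20) ?(ltW e10) // lerD2l ge_min lexx.
have e2d : e2 <= d / 16 by rewrite ge_min lexx orbT.
have [s su hs] := approx_sqrt ac e20.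
pose m := (T a * s) ^+ 2; have mu : m \is a GRing.unit by rewrite unitrX // unitrM Tau.
have hm : dist m (T a * T c) <= e2.
  have -> : m = T a ^+ 2 * s ^+ 2 by rewrite /m exprMn.
  have -> : T a * T c = T a ^+ 2 * (T c / T a).
    by rewrite expr2 [T c / T a]mulrC mulrA mulrK.
  by rewrite distM ?unitrX // unitrM unitrV Tcu.
pose g : (A -> A) * (A -> A) := (fun x => reflect_b (T' (m / T x)), fun x => T' (m / T (reflect_b x))).
have mK z : z \is a GRing.unit -> m / (m / z) = z.
  by move=> zu; rewrite invrM ?unitrV // invrK [z * _]mulrC mulrA divrr // mul1r.
have mzu z : z \is a GRing.unit -> m / z \is a GRing.unit.
  by move=> zu; rewrite unitrM mu unitrV.
have ru := reflect_b_unit.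
have ig : isometry_pair g.
  move=> x xu; have xr := ru _ xu; have h1 := mzu _ (Tu xu); have h2 := mzu _ (Tu xr).
  split=> /=.
  - by apply/ru/T'u.
  - exact: T'u.
  - by rewrite reflect_bK ?T'u // T'K // mK ?Tu // TK.
  - by rewrite T'K // mK ?Tu // TK // reflect_bK.
  move=> y yu; have h3 := mzu _ (Tu yu).
  by rewrite reflect_b_dist ?T'u // T'_dist // dist_reflection ?Tu // T_dist.
have mzd z w : z \is a GRing.unit -> w \is a GRing.unit -> dist (m / z) w = dist m (z * w).
  by move=> zu wu; rewrite -(distM zu) ?mzu // mulrCA divrr // mulr1.
have gE u v : u \is a GRing.unit -> v \is a GRing.unit -> reflect_b v = u ->
    dist (g.1 u) u = dist m (T u * T v).
  move=> uu vu uvE; rewrite /= -{2}uvE reflect_b_dist ?T'u ?mzu ?Tu //.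
  by rewrite -T_dist ?T'u ?mzu ?Tu // T'K ?mzu ?Tu // mzd ?Tu.
have ga : 1 + dist (g.1 a) a <= 1 + e2.
  by rewrite (gE a c) ?lerD2l //; exact: reflect_bK.
have gc : 1 + dist (g.1 c) c <= 1 + e2.
  by rewrite (gE c a) // lerD2l mulrC.
have gb : dist (g.1 b) b = dist m (T b ^+ 2) by rewrite (gE b b) // reflect_b_fix.
have q1 : 1 <= 1 + e2 by rewrite lerDl ltW.
have h1 := iter_expand ig q1 ga gc he2; have h2 := iter_near ig ga gc he2.
have h3 : dist m (T b ^+ 2) <= d / 16.
  have h4 := le_trans h1 h2; rewrite gb in h4.
  have h5 : 2 ^+ k0 * dist m (T b ^+ 2) <= 2^-1.
    by apply: le_trans h4; rewrite ler_wpM2r ?dist_ge0.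
  have p0 : 0 < (2 : R) ^+ k0 by rewrite exprn_gt0.
  move: h5; rewrite -ler_pdivlMl // -exprVn => h5.
  by apply: le_trans h5 _; move: hk; set u := _ ^+ k0; lra.
have h4 := dist_tri (T a * T c) (T b ^+ 2) mu.
have h5 : (1 + dist (T a * T c) m) * (1 + dist m (T b ^+ 2)) <= (1 + d / 16) * (1 + d / 16).
  apply: ler_pM; rewrite ?p1 // lerD2l //.
  by rewrite dist_sym; exact: le_trans hm e2d.
have h6 : (1 + d / 16) * (1 + d / 16) <= 1 + d.
  have : d * d <= d * 1 by rewrite ler_wpM2l // ltW.
  lra.
have h7 := le_trans h4 (le_trans h5 h6).
have : d <= e by rewrite ge_min lexx.
lra.
Qed.

End Midpoint.

End MazurUlam.

(** * The subgroup of units generated by a neighbourhood of 1 *)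

Section NearOne.
Variables (R : realType) (A : comBanachAlgType R).
Local Notation r := (@spectral_radius R A).

(** The constant satisfies [(31/30)^3 <= 9/8], so that products of three such elements stay within
    the [8^-1] of [mazur_ulam]. *)
Definition near_one (a : A) := a \is a GRing.unit /\ dist a 1 <= 30^-1.

Lemma rdist1 (a : A) : rdist a 1 = r (a - 1).
Proof. by rewrite /rdist divr1. Qed.

Lemma radius_sub1_unit (w : A) : r w <= 2^-1 -> (1 + w) \is a GRing.unit /\ r (1 + w)^-1 <= 2.
Proof.
move=> hw; rewrite -[2]invrK; apply: radiusV_le; first by rewrite invr_gt0.
move=> x; rewrite gelfandD gelfand1; have := modcNB 1 (- gelfand w x).
rewrite modc1 modcN opprK; have := gelfand_le w x; lra.
Qed.

Lemma near_one_radius (w : A) : r w <= 60^-1 -> near_one (1 + w).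
Proof.
move=> hw; have [wu hr] : (1 + w) \is a GRing.unit /\ r (1 + w)^-1 <= 2.
  by apply: radius_sub1_unit; lra.
have e : 1 + w - 1 = w by rewrite addrC addKr.
split=> //; rewrite ge_max rdist1 e; apply/andP; split; first lra.
have -> : rdist 1 (1 + w) = r (- w / (1 + w)).
  have -> : - w = 1 - (1 + w) by rewrite opprD addNKr.
  by rewrite mulrBl divrr.
apply: le_trans (radiusM _ _) _; rewrite radiusN.
apply: le_trans (_ : 60^-1 * 2 <= _); last lra.
by apply: ler_pM; rewrite ?radius_ge0.
Qed.

(* The subgroup of the units generated by a neighbourhood of [1]. *)
Inductive unit_component : A -> Prop :=
| unit_component1 : unit_component 1
| unit_componentM g a : unit_component g -> near_one a -> unit_component (g * a).

Lemma unit_component_unit g : unit_component g -> g \is a GRing.unit.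
Proof. by elim=> [|h a _ hu [au _]]; rewrite ?unitr1 // unitrM hu. Qed.

Lemma near_one_component a : near_one a -> unit_component a.
Proof. by move=> na; rewrite -[a]mul1r; exact: unit_componentM unit_component1 na. Qed.

Lemma unit_component_mul g h : unit_component g -> unit_component h -> unit_component (g * h).
Proof.
by move=> Gg; elim=> [|k a _ IH na]; rewrite ?mulr1 // mulrA; exact: unit_componentM IH na.
Qed.

Lemma unit_componentX g n : unit_component g -> unit_component (g ^+ n).
Proof.
move=> Gg; elim: n => [|n IH]; first by rewrite expr0; exact: unit_component1.
by rewrite exprS; exact: unit_component_mul.
Qed.

Section Path.
Variables (b : A) (d : R).
Hypotheses (d0 : 0 < d) (bd : forall x, d <= complex.Re (gelfand b x)).

Lemma path_unit (t : R) : 0 <= t <= 1 ->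
  let a := 1 + t%:C%C *: (b - 1) in a \is a GRing.unit /\ r a^-1 <= (Num.min d 1)^-1.
Proof.
move=> /andP[t0 t1] a; apply: radiusV_le; first by rewrite lt_min d0 ltr01.
move=> x; apply: le_trans (Re_le_modc _); rewrite /a gelfandD gelfandZ gelfandB gelfand1.
have -> : complex.Re (1 + t%:C%C * (gelfand b x - 1)) = (1 - t) + t * complex.Re (gelfand b x).
  by case: (gelfand b x) => u v /=; rewrite mul0r subr0; ring.
have h1 : Num.min d 1 <= complex.Re (gelfand b x) by apply: le_trans (bd x); rewrite ge_min lexx.
have h2 : Num.min d 1 <= 1 by rewrite ge_min lexx orbT.
have h3 : 0 <= 1 - t by rewrite subr_ge0.
have := ler_wpM2l t0 h1; have := ler_wpM2l h3 h2; lra.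
Qed.

Lemma path_step (n k : nat) : (k < n)%N ->
  let a t := 1 + (t%:R / n%:R)%:C%C *: (b - 1) in
  [/\ a k \is a GRing.unit, a k.+1 \is a GRing.unit,
  a k.+1 = a k * (1 + n%:R^-1%:C%C *: ((b - 1) / a k)) &
  r (n%:R^-1%:C%C *: ((b - 1) / a k)) <= r (b - 1) * (Num.min d 1)^-1 / n%:R].
Proof.
move=> kn a; have n0 : 0 < n%:R :> R by rewrite ltr0n; exact: leq_ltn_trans kn.
have t01 (m : nat) : (m <= n)%N -> 0 <= (m%:R / n%:R : R) <= 1.
  by move=> mn; rewrite divr_ge0 ?ler0n //= ler_pdivrMr // mul1r ler_nat.
have [ku kr] := path_unit (t01 _ (ltnW kn)); have [ku' _] := path_unit (t01 _ kn).
split=> //.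
- rewrite mulrDr mulr1 -scalerAr mulrCA divrr // mulr1 /a -addrA -scalerDl.
  by congr (_ + _ *: _); rewrite -rmorphD -[k.+1]addn1 natrD mulrDl mul1r.
rewrite radiusZ modcR ger0_norm ?invr_ge0 ?(ltW n0) // mulrC.
rewrite ler_wpM2r ?invr_ge0 ?(ltW n0) //; apply: le_trans (radiusM _ _) _.
by rewrite ler_wpM2l ?radius_ge0.
Qed.

(** Positive real part keeps the segment from 1 to [b] away from 0 on the spectrum, so inverses
    along it are uniformly bounded and consecutive points of a fine subdivision have quotient near
    1. The 60 is that of [near_one_radius]. *)
Lemma unit_component_path : unit_component b.
Proof.
pose K := r (b - 1) * (Num.min d 1)^-1.
have K0 : 0 <= K by rewrite mulr_ge0 ?radius_ge0 // invr_ge0 le_min ltW // ler01.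
pose n := (Num.trunc (60 * K)).+1.
have hn : 60 * K < n%:R by exact: truncnS_gt.
have n0 : 0 < n%:R :> R by rewrite ltr0n.
suff h k : (k <= n)%N -> unit_component (1 + (k%:R / n%:R)%:C%C *: (b - 1)).
  by have := h n (leqnn n); rewrite divff ?gt_eqF // rmorph1 scale1r addrC subrK.
elim: k => [_|k IH kn]; first by rewrite mul0r rmorph0 scale0r addr0; exact: unit_component1.
have [_ _ -> hr] := path_step kn.
apply: unit_componentM; first exact: IH (ltnW kn).
apply: near_one_radius; apply: le_trans hr _; rewrite -/K ler_pdivrMr //.
rewrite ler_pdivlMl //; exact: ltW.
Qed.

End Path.

(** Scalars with positive real part are reached by the segment from 1; ['i = (1 + 'i)^2 / 2] and
    [-1 = 'i^2] give the others as products. *)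
Lemma unit_component_scalar (z : R[i]) : z != 0 -> unit_component z%:A.
Proof.
have pos (w : R[i]) : 0 < complex.Re w -> unit_component w%:A.
  move=> w0; apply: (@unit_component_path w%:A (complex.Re w)) => // x.
  by rewrite gelfand_scalar.
have scM (u v : R[i]) : (u * v)%:A = u%:A * v%:A :> A.
  by rewrite mulr_algl scalerA.
have hi : unit_component ('i%C : R[i])%:A.
  have -> : 'i%C = (1 +i* 1)%C * ((2^-1)%:C%C * (1 +i* 1)%C) :> R[i].
    by simpc; congr (_ +i* _)%C; lra.
  by rewrite scM; apply: unit_component_mul; apply: pos; simpc => /=; lra.
have hm1 : unit_component (-1 : R[i])%:A.
  by rewrite -(sqr_i R) expr2 scM; exact: unit_component_mul.
have re (w : R[i]) : complex.Re w != 0 -> unit_component w%:A.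
  move=> w0; have [h|h|e] := ltrgt0P (complex.Re w); last by rewrite e eqxx in w0.
    exact: pos.
  have -> : w = -1 * - w by rewrite mulN1r opprK.
  rewrite scM; apply: unit_component_mul => //; apply: pos.
  by rewrite raddfN oppr_gt0.
move=> z0; have [e|] := eqVneq (complex.Re z) 0; last exact: re.
have -> : z = 'i%C * (- 'i%C * z) by rewrite mulrA mulrN -expr2 sqr_i opprK mul1r.
rewrite scM; apply: unit_component_mul => //; apply: re.
move: z0 e; case: z => u v z0 /= e; rewrite e; simpc => /=.
by apply: contraNneq z0 => h; rewrite e h.
Qed.

End NearOne.

(** * Multiplicativity of the normalised map on this subgroup *)

Section LocalHomomorphism.
Variables (R : realType) (A B : comBanachAlgType R).
Hypothesis ssB : semisimple B.

(** [(z - 1) (z + 1) = 0] with [z + 1] a unit. This settles the sign when an identity is known only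
    after squaring. *)
Lemma radius_sqr1 (z : B) : z ^+ 2 = 1 -> dist z 1 < 1 -> z = 1.
Proof.
move=> z2 hz; have h : rdist z 1 < 1 by exact: le_lt_trans (rdist_le_dist _ _) hz.
rewrite rdist1 in h.
have u : (2 + (z - 1)) \is a GRing.unit.
  apply: unit_char => x; rewrite gelfandD.
  have -> : gelfand (2 : B) x = 2 by rewrite -[2](rmorph_nat (in_alg B)) gelfand_scalar.
  rewrite -modc_gt0; have := modcNB 2 (- gelfand (z - 1) x); rewrite modcN opprK modc2.
  have := gelfand_le (z - 1) x; lra.
have : (z - 1) * (2 + (z - 1)) = 0 * (2 + (z - 1)).
  have -> : (z - 1) * (2 + (z - 1)) = z ^+ 2 - 1 by ring.
  by rewrite z2 subrr mul0r.
by move/(mulIr u)/eqP; rewrite subr_eq0 => /eqP.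
Qed.

Section Normalized.
Variables (T : A -> B) (T' : B -> A).
Hypothesis Tu : forall f, f \is a GRing.unit -> T f \is a GRing.unit.
Hypothesis T'u : forall g, g \is a GRing.unit -> T' g \is a GRing.unit.
Hypothesis TK : forall f, f \is a GRing.unit -> T' (T f) = f.
Hypothesis T'K : forall g, g \is a GRing.unit -> T (T' g) = g.
Hypothesis T_dist : forall f h, f \is a GRing.unit -> h \is a GRing.unit ->
  dist (T f) (T h) = dist f h.
Hypothesis T1 : T 1 = 1.

Let MU := mazur_ulam ssB Tu T'u TK T'K T_dist.

Lemma normalizedV a : a \is a GRing.unit -> dist a 1 <= 8^-1 -> T a^-1 = (T a)^-1.
Proof. by move=> au /(MU au (unitr1 _)); rewrite T1 !expr1n !div1r. Qed.

Lemma normalized_sqr b : b \is a GRing.unit -> dist b 1 <= 8^-1 -> T (b ^+ 2) = T b ^+ 2.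
Proof.
by move=> bu hb; have := @MU 1 b (unitr1 _) bu; rewrite dist_sym T1 !divr1; exact.
Qed.

(** The reflection of [a^-1] in [b] is [b^2 * a]. *)
Lemma normalized_mul_sqr a b : a \is a GRing.unit -> b \is a GRing.unit -> dist a 1 <= 8^-1 ->
  dist a^-1 b <= 8^-1 -> T (b ^+ 2 * a) = T b ^+ 2 * T a.
Proof.
move=> au bu ha hab; have := @MU a^-1 b; rewrite unitrV invrK => ->//.
by rewrite normalizedV // invrK.
Qed.

Lemma dist_mul1 (a b : A) (p q : R) : a \is a GRing.unit -> b \is a GRing.unit -> 1 + dist a 1 <= p ->
  1 + dist b 1 <= q -> 1 + dist (a * b) 1 <= p * q.
Proof.
move=> au bu hp hq; apply: le_trans (dist_tri _ _ au) _.
have p1 (x y : A) : 0 <= 1 + dist x y by rewrite addr_ge0 ?dist_ge0.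
rewrite mulrC; apply: ler_pM => //.
by rewrite -{2}[a]mulr1 distM ?unitr1.
Qed.

(** Midpoints give [T (a b)^2 = T (b^2 a^2) = (T a * T b)^2]; the ratio of [T (a b)] and [T a * T b]
    squares to 1 and is close to 1. *)
Lemma normalized_mul a b : near_one a -> near_one b -> T (a * b) = T a * T b.
Proof.
move=> [au ha] [bu hb].
have ha' : 1 + dist a 1 <= 31 / 30 by lra.
have hb' : 1 + dist b 1 <= 31 / 30 by lra.
have abu : a * b \is a GRing.unit by rewrite unitrM au.
have hab : 1 + dist (a * b) 1 <= (31 / 30) * (31 / 30) by exact: dist_mul1.
have e : T (a * b) ^+ 2 = (T a * T b) ^+ 2.
  rewrite -normalized_sqr //; last lra.
  have a2u : a ^+ 2 \is a GRing.unit by rewrite unitrX.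
  have ha2 : 1 + dist (a ^+ 2) 1 <= (31 / 30) * (31 / 30) by rewrite expr2; exact: dist_mul1.
  rewrite exprMn mulrC normalized_mul_sqr //; [|lra|].
    by rewrite normalized_sqr // ?exprMn 1?mulrC //; lra.
  have iu : (a ^+ 2)^-1 \is a GRing.unit by rewrite unitrV.
  have := dist_tri (a ^+ 2)^-1 b (unitr1 A).
  rewrite -{1}(@invr1 A) distV ?unitr1 // [dist 1 b]dist_sym => h.
  have : (1 + dist (a ^+ 2) 1) * (1 + dist b 1) <= 31 / 30 * (31 / 30) * (31 / 30).
    by apply: ler_pM => //; rewrite addr_ge0 ?dist_ge0.
  by move=> /(le_trans h); rewrite -lerBrDl => h'; apply: le_trans h' _; lra.
have Tau := Tu au; have Tbu := Tu bu; have Tabu := Tu abu.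
have TTu : T a * T b \is a GRing.unit by rewrite unitrM Tau.
have : T (a * b) / (T a * T b) = 1.
  apply: radius_sqr1; first by rewrite exprMn e exprVn divrr ?unitrX.
  rewrite -(distM TTu) ?unitr1 //; last by rewrite unitrM unitrV Tabu.
  rewrite mulr1 mulrCA divrr // mulr1.
  have p1 (C : comBanachAlgType R) (x y : C) : 0 <= 1 + dist x y.
    by rewrite addr_ge0 ?dist_ge0.
  have h1 := dist_tri (T (a * b)) (T a * T b) (unitr1 B).
  have h2 := dist_tri 1 (T a * T b) Tau.
  have d1 x : x \is a GRing.unit -> dist (T x) 1 = dist x 1 by move=> xu; rewrite -T1 T_dist ?unitr1.
  have h3 : dist (T a) (T a * T b) = dist b 1.
    by rewrite -{1}[T a]mulr1 distM ?unitr1 // dist_sym d1.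
  rewrite h3 [dist 1 (T a)]dist_sym d1 // in h2; rewrite d1 // in h1.
  have h4 : (1 + dist a 1) * (1 + dist b 1) <= 31 / 30 * (31 / 30) by apply: ler_pM.
  have h5 : (1 + dist (a * b) 1) * (1 + dist 1 (T a * T b)) <= (31 / 30) * (31 / 30) * (31 / 30 * (31 / 30)).
    by apply: ler_pM => //; exact: le_trans h2 h4.
  have := le_trans h1 h5; rewrite -lerBrDl => h6; apply: le_lt_trans h6 _; lra.
by move=> e1; rewrite -[LHS](divrK TTu) e1 mul1r.
Qed.

End Normalized.

Variables (T : A -> B) (T' : B -> A).
Hypothesis Tu : forall f, f \is a GRing.unit -> T f \is a GRing.unit.
Hypothesis T'u : forall g, g \is a GRing.unit -> T' g \is a GRing.unit.
Hypothesis TK : forall f, f \is a GRing.unit -> T' (T f) = f.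
Hypothesis T'K : forall g, g \is a GRing.unit -> T (T' g) = g.
Hypothesis T_dist : forall f h, f \is a GRing.unit -> h \is a GRing.unit ->
  dist (T f) (T h) = dist f h.

(** [x -> T (f * x) / T f] is again an isometry fixing 1, so [normalized_mul] applies at any unit
    [f]. *)
Lemma local_mul f a b : f \is a GRing.unit -> near_one a -> near_one b ->
  T (f * a * b) * T f = T (f * a) * T (f * b).
Proof.
move=> fu na nb; have Tfu := Tu fu.
have := @normalized_mul (fun x => T (f * x) / T f) (fun y => T' (T f * y) / f).
have [au _] := na; have [bu _] := nb.
move=> /(_ _ _ _ _ _ _ a b na nb) h.
have {}h : T (f * (a * b)) / T f = T (f * a) / T f * (T (f * b) / T f).
  apply: h.
  - by move=> x xu; rewrite unitrM unitrV Tfu andbT Tu // unitrM fu.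
  - by move=> y yu; rewrite unitrM unitrV fu andbT T'u // unitrM Tfu.
  - move=> x xu; rewrite [T f * _]mulrC divrK // TK ?unitrM ?fu //.
    by rewrite [f * x]mulrC mulrK.
  - move=> y yu; rewrite [f * _]mulrC divrK // T'K ?unitrM ?Tfu //.
    by rewrite [T f * y]mulrC mulrK.
  - move=> x y xu yu; rewrite ![_ / T f]mulrC distM ?unitrV ?Tu ?unitrM ?fu //.
    by rewrite T_dist ?unitrM ?fu // distM.
  by rewrite mulr1 divrr.
rewrite -mulrA -[T (f * (a * b))](divrK Tfu) h.
have -> : T (f * a) / T f * (T (f * b) / T f) * T f * T f =
  T (f * a) * T (f * b) * ((T f)^-1 * T f) * ((T f)^-1 * T f) by ring.
by rewrite mulVr // !mulr1.
Qed.

(** Induction on the word representing [g], moving the base point of [local_mul] along it. *)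
Lemma component_mul_near f g b : f \is a GRing.unit -> unit_component g -> near_one b ->
  T (f * g * b) * T f = T (f * g) * T (f * b).
Proof.
move=> fu Gg; elim: Gg b => [|h a Gh IH na] b nb; first by rewrite mulr1 mulrC.
have hu := unit_component_unit Gh; have fhu : f * h \is a GRing.unit by rewrite unitrM fu.
apply: (mulIr (Tu fhu)).
have := local_mul fhu na nb; have := IH _ nb; rewrite !mulrA => e1 e2.
rewrite [LHS]mulrAC e2 -[LHS]mulrA e1; ring.
Qed.

Lemma component_mul f g h : f \is a GRing.unit -> unit_component g -> unit_component h ->
  T (f * g * h) * T f = T (f * g) * T (f * h).
Proof.
move=> fu Gg; elim=> [|k a Gk IH na]; first by rewrite !mulr1.
have Ggk := unit_component_mul Gg Gk.
have e1 := component_mul_near fu Ggk na; have e2 := component_mul_near fu Gk na.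
rewrite !mulrA in e1 e2 *; apply: (mulIr (Tu fu)).
rewrite e1 -[RHS]mulrA e2 mulrA -IH; ring.
Qed.

End LocalHomomorphism.

(** * Limits of sequences with geometric increments *)

Section GeometricLimit.
Variable R : realType.

(** The intervals of centre [u n] and radius [e n] are nested; the limit is the supremum of their
    left ends. *)
Lemma real_geometric_limit (u : nat -> R) (n0 : nat) (K : R) : 0 <= K ->
  (forall n, (n0 <= n)%N -> `|u n - u n.+1| <= K * 2^-1 ^+ n) ->
  exists l, forall n, (n0 <= n)%N -> `|u n - l| <= 2 * K * 2^-1 ^+ n.
Proof.
move=> K0 hu; pose e n : R := 2 * K * 2^-1 ^+ n.
have eS n : e n.+1 = e n - K * 2^-1 ^+ n by rewrite /e exprS; lra.
have e0 n : 0 <= e n by rewrite /e !mulr_ge0 ?exprn_ge0 ?invr_ge0.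
have mono n k : (n0 <= n)%N -> u n - e n <= u (n + k)%N - e (n + k)%N /\
    u (n + k)%N + e (n + k)%N <= u n + e n.
  move=> n0n; elim: k => [|k [IH1 IH2]]; first by rewrite addn0.
  have := hu _ (leq_trans n0n (leq_addr k n)); rewrite addnS ler_norml => /andP[h1 h2].
  by rewrite !eS; split; lra.
have lbub n m : (n0 <= n)%N -> (n0 <= m)%N -> u n - e n <= u m + e m.
  move=> hn hm; have [h1 _] := mono n m hn; have [_ h2] := mono m n hm.
  have := e0 (n + m)%N; rewrite addnC in h2; lra.
pose S := [set u n - e n | n in [set n | (n0 <= n)%N]].
exists (sup S) => n hn; rewrite ler_norml; apply/andP; split.
  rewrite lerBrDl -lerBrDr opprK; apply: ge_sup; first by exists (u n0 - e n0), n0 => /=.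
  by move=> _ [m /= hm <-]; apply: le_trans (lbub _ _ hm hn) _; rewrite /e; lra.
rewrite lerBlDl -lerBlDr; apply: ub_le_sup; last by exists n.
by exists (u n0 + e n0) => _ [m /= hm <-]; exact: lbub.
Qed.

Lemma complex_geometric_limit (u : nat -> R[i]) (n0 : nat) (K : R) : 0 <= K ->
  (forall n, (n0 <= n)%N -> modc (u n - u n.+1) <= K * 2^-1 ^+ n) ->
  exists l, forall n, (n0 <= n)%N -> modc (u n - l) <= 4 * K * 2^-1 ^+ n.
Proof.
move=> K0 hu.
have [n hn|a ha] := real_geometric_limit K0 (u := fun n => complex.Re (u n)) (n0 := n0).
  by apply: le_trans (hu n hn); rewrite -raddfB normRe_le.
have [n hn|b hb] := real_geometric_limit K0 (u := fun n => complex.Im (u n)) (n0 := n0).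
  by apply: le_trans (hu n hn); rewrite -raddfB normIm_le.
exists (a +i* b)%C => n hn; apply: le_trans (modc_le_ReIm _) _.
by rewrite !raddfB /=; have := ha n hn; have := hb n hn; lra.
Qed.

End GeometricLimit.

(** * The derivative of the normalised map at 1 *)

Section Derivative.
Variables (R : realType) (A B : comBanachAlgType R).
Hypothesis ssB : semisimple B.
Variables (T : A -> B) (T' : B -> A).
Hypothesis Tu : forall f, f \is a GRing.unit -> T f \is a GRing.unit.
Hypothesis T'u : forall g, g \is a GRing.unit -> T' g \is a GRing.unit.
Hypothesis TK : forall f, f \is a GRing.unit -> T' (T f) = f.
Hypothesis T'K : forall g, g \is a GRing.unit -> T (T' g) = g.
Hypothesis T_rdist : forall f h, f \is a GRing.unit -> h \is a GRing.unit ->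
  rdist (T f) (T h) = rdist f h.

Local Notation rA := (@spectral_radius R A).
Local Notation rB := (@spectral_radius R B).

Lemma T_dist f h : f \is a GRing.unit -> h \is a GRing.unit -> dist (T f) (T h) = dist f h.
Proof. by move=> fu hu; rewrite /dist !T_rdist. Qed.

Definition normalize (a : A) : B := T a / T 1.
Local Notation H := normalize.

Lemma T1u : T 1 \is a GRing.unit.
Proof. by rewrite Tu ?unitr1. Qed.

Lemma normalize1 : H 1 = 1.
Proof. by rewrite /H divrr ?T1u. Qed.

Lemma normalize_unit a : a \is a GRing.unit -> H a \is a GRing.unit.
Proof. by move=> au; rewrite unitrM unitrV T1u Tu. Qed.

Lemma normalize_rdist f h : f \is a GRing.unit -> h \is a GRing.unit ->
  rdist (H f) (H h) = rdist f h.
Proof.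
by move=> fu hu; rewrite /H ![_ / T 1]mulrC rdistM ?unitrV ?T1u ?Tu // T_rdist.
Qed.

Lemma normalizeM g h : unit_component g -> unit_component h -> H (g * h) = H g * H h.
Proof.
move=> Gg Gh; have := component_mul ssB Tu T'u TK T'K T_dist (unitr1 A) Gg Gh.
rewrite !mul1r => e; apply: (mulIr T1u); rewrite divrK ?T1u //; apply: (mulIr T1u).
rewrite e /H.
have -> : T g / T 1 * (T h / T 1) * T 1 * T 1 = T g * T h * ((T 1)^-1 * T 1) * ((T 1)^-1 * T 1) by ring.
by rewrite mulVr ?T1u // !mulr1.
Qed.

Lemma normalizeX g n : unit_component g -> H (g ^+ n) = H g ^+ n.
Proof.
move=> Gg; elim: n => [|n IH]; first by rewrite !expr0 normalize1.
by rewrite !exprS normalizeM ?IH //; exact: unit_componentX.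
Qed.

Definition increment (w : A) : B := H (1 + w) - 1.
Local Notation D := increment.

Lemma increment_radius w : 1 + w \is a GRing.unit -> rB (D w) = rA w.
Proof.
move=> wu; rewrite -rdist1 -normalize1 normalize_rdist ?unitr1 // rdist1.
by rewrite addrC addKr.
Qed.

(** [H] is multiplicative at [p = (1 + w) (1 + w')], and [p] differs from [q = 1 + w + w'] by
    [w w']. The constant is [1] for the product of increments plus [2 * 2] for replacing [p] by
    [q]. *)
Lemma increment_quasi_additive w w' : rA w <= 200^-1 -> rA w' <= 200^-1 ->
  rB (D (w + w') - D w - D w') <= 5 * (rA w * rA w').
Proof.
move=> hw hw'; have hww : rA (w + w') <= 100^-1.
  apply: le_trans (radiusD _ _) _; lra.
have nw : near_one (1 + w) by apply: near_one_radius; lra.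
have nw' : near_one (1 + w') by apply: near_one_radius; lra.
have [qu qr] : (1 + (w + w')) \is a GRing.unit /\ rA (1 + (w + w'))^-1 <= 2.
  by apply: radius_sub1_unit; lra.
set q := 1 + (w + w') in qu qr; pose p := (1 + w) * (1 + w').
have pu : p \is a GRing.unit by rewrite unitrM (proj1 nw) (proj1 nw').
have Hp : H p = H (1 + w) * H (1 + w') by rewrite normalizeM //; exact: near_one_component.
have e : D (w + w') - D w - D w' = D w * D w' - (H p - H q).
  by rewrite /D -/q Hp; ring.
have r0 := radius_ge0 w; have r0' := radius_ge0 w'.
have h1 : rB (D w * D w') <= rA w * rA w'.
  apply: le_trans (radiusM _ _) _.
  by rewrite !increment_radius ?(proj1 nw) ?(proj1 nw').
have h2 : rB (H p - H q) <= 4 * (rA w * rA w').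
  have -> : H p - H q = (H p / H q - 1) * H q.
    by rewrite mulrBl divrK ?mul1r // normalize_unit.
  apply: le_trans (radiusM _ _) _.
  have -> : rB (H p / H q - 1) = rA (p / q - 1) by rewrite -/(rdist _ _) normalize_rdist.
  have -> : p / q - 1 = w * w' / q.
    have -> : p = q + w * w' by rewrite /p /q; ring.
    by rewrite mulrDl divrr // addrC addKr.
  have h3 : rA (w * w' / q) <= rA w * rA w' * 2.
    apply: le_trans (radiusM _ _) _; apply: ler_pM; rewrite ?radius_ge0 ?radiusM //.
  have h4 : rB (H q) <= 2.
    have -> : H q = D (w + w') + 1 by rewrite /D subrK.
    apply: le_trans (radiusD _ _) _; rewrite radius1 increment_radius //; lra.
  apply: le_trans (_ : rA w * rA w' * 2 * 2 <= _); last lra.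
  by apply: ler_pM; rewrite ?radius_ge0.
rewrite e; apply: le_trans (radiusD _ _) _; rewrite radiusN; lra.
Qed.

(** The difference quotient at 1 in direction [u] with dyadic step, so that consecutive quotients
    are compared by quasi-additivity with [w = w']. *)
Definition dilate (u : A) (n : nat) : B := (2 ^+ n)%:C%C *: D ((2^-1 ^+ n)%:C%C *: u).

Lemma radius_dyadic (C : comBanachAlgType R) (u : C) (n : nat) :
  spectral_radius ((2^-1 ^+ n)%:C%C *: u) = 2^-1 ^+ n * spectral_radius u.
Proof. by rewrite radiusZ modcR ger0_norm // exprn_ge0 // invr_ge0. Qed.

Lemma radius_dyadic' (C : comBanachAlgType R) (u : C) (n : nat) :
  spectral_radius ((2 ^+ n)%:C%C *: u) = 2 ^+ n * spectral_radius u.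
Proof. by rewrite radiusZ modcR ger0_norm // exprn_ge0. Qed.

Lemma pow2K n : 2 ^+ n * 2^-1 ^+ n = 1 :> R.
Proof. by rewrite -exprMn mulfV ?expr1n ?pnatr_eq0. Qed.

Definition small (u : A) (n : nat) := 2^-1 ^+ n * rA u <= 400^-1.

Lemma smallS u n m : (n <= m)%N -> small u n -> small u m.
Proof.
move=> nm; apply: le_trans; rewrite ler_wpM2r ?radius_ge0 //.
by rewrite ler_wiXn2l ?invr_ge0 // invf_le1 ?ler1n.
Qed.

Lemma small_exists (u : A) : exists n, small u n.
Proof.
have [|n /(_ n (leqnn n)) hn] := exp_half_lt (e := (400 * (rA u + 1))^-1).
  by rewrite invr_gt0 mulr_gt0 // ltr_wpDl ?radius_ge0.
exists n; rewrite /small; have r0 := radius_ge0 u.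
apply: le_trans (ler_wpM2r r0 (ltW hn)) _.
rewrite invfM -mulrA ler_piMr ?invr_ge0 // mulrC ler_pdivrMr; lra.
Qed.

Lemma dilate_step u n : small u n ->
  rB (dilate u n - dilate u n.+1) <= 2 * rA u ^+ 2 * 2^-1 ^+ n.
Proof.
move=> hn; set w := (2^-1 ^+ n.+1)%:C%C *: u.
have r0 := radius_ge0 u.
have rw : rA w = 2^-1 ^+ n.+1 * rA u by rewrite radius_dyadic.
have hw : rA w <= 400^-1 by rewrite rw; exact: smallS hn.
have -> : dilate u n - dilate u n.+1 = (2 ^+ n)%:C%C *: (D (w + w) - D w - D w).
  have ww : (2^-1 ^+ n)%:C%C *: u = w + w.
    rewrite /w -scalerDl -rmorphD exprS; congr (_%:C%C *: _); lra.
  rewrite /dilate ww -/w.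
  have -> : (2 ^+ n.+1)%:C%C = (2 ^+ n)%:C%C + (2 ^+ n)%:C%C :> R[i].
    by rewrite -rmorphD exprS; congr (_%:C%C); lra.
  by rewrite scalerDl !scalerBr; ring.
rewrite radius_dyadic'.
have := increment_quasi_additive (w := w) (w' := w).
have h1 : rA w <= 200^-1 by lra.
move=> /(_ h1 h1) h; apply: le_trans (ler_wpM2l _ h) _; first by rewrite exprn_ge0.
rewrite rw expr2 exprS; have := pow2K n; set a := 2 ^+ n; set b := 2^-1 ^+ n; set ru := rA u => ab.
have -> : a * (5 * (2^-1 * b * ru * (2^-1 * b * ru))) = (5 / 4) * (a * b) * b * (ru * ru) by lra.
rewrite ab; have b0 : 0 <= b by rewrite exprn_ge0 // invr_ge0.
have : 0 <= b * (ru * ru) by rewrite !mulr_ge0.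
lra.
Qed.

(** The limit is taken pointwise, but with an error uniform in [y]. The 8 is the 4 of
    [complex_geometric_limit] times the 2 of [dilate_step]. *)
Lemma derivative_exists : exists S : A -> max_ideal_space B -> R[i],
  forall u n, small u n -> forall y,
    modc (gelfand (dilate u n) y - S u y) <= 8 * rA u ^+ 2 * 2^-1 ^+ n.
Proof.
have h u y : exists s : R[i], forall n, small u n ->
    modc (gelfand (dilate u n) y - s) <= 8 * rA u ^+ 2 * 2^-1 ^+ n.
  (* Starting at the least admissible index gives one limit with the estimate at all admissible
     [n]. *)
  have [n0 hn0 min_n0] : exists2 n0, small u n0 & forall n, small u n -> (n0 <= n)%N.
    have ex : exists n, `[< small u n >] by have [n hn] := small_exists u; exists n; apply/asboolP.
    have := ex_minnP ex; case: ex_minnP => n /asboolP hn hmin _.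
    by exists n => // m hm; apply: hmin; apply/asboolP.
  have [||l hl] := @complex_geometric_limit R (fun n => gelfand (dilate u n) y) n0 (2 * rA u ^+ 2).
  - by rewrite mulr_ge0 // sqr_ge0.
  - move=> n hn; rewrite -gelfandB; apply: le_trans (gelfand_le _ _) _.
    by apply: dilate_step; exact: smallS hn0.
  exists l => n hn; apply: le_trans (hl _ (min_n0 _ hn)) _.
  by rewrite !mulrA; lra.
have /choice[S hS] : forall u, exists s : max_ideal_space B -> R[i], forall y n, small u n ->
    modc (gelfand (dilate u n) y - s y) <= 8 * rA u ^+ 2 * 2^-1 ^+ n.
  by move=> u; have /choice[s hs] := h u; exists s.
by exists S => u n hn y; exact: hS.
Qed.

End Derivative.

(** * Elementary lemmas on real and complex numbers *)

Section Auxiliary.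
Variable R : realType.

Lemma le_geometric (x C : R) (n0 : nat) : (forall n, (n0 <= n)%N -> x <= C * 2^-1 ^+ n) -> x <= 0.
Proof.
move=> h; apply/ler_addgt0Pr => e e0; rewrite add0r.
have C0 : 0 < `|C| + 1 by rewrite ltr_wpDl.
have [|n1 hn] := exp_half_lt (e := e / (`|C| + 1)); first by rewrite divr_gt0.
apply: le_trans (h (n0 + n1)%N (leq_addr _ _)) _.
have := hn (n0 + n1)%N (leq_addl _ _); rewrite ltr_pdivlMr // => h2.
apply: le_trans (_ : (`|C| + 1) * 2^-1 ^+ (n0 + n1) <= _); last by rewrite mulrC ltW.
rewrite ler_wpM2r ?exprn_ge0 ?invr_ge0 //.
by apply: le_trans (ler_norm C) _; rewrite lerDl.
Qed.

(** For [q] the fractional part of [N t], additivity gives [N (f t - t f(1)) = f q - q f(1)], which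
    is bounded while [N] grows. *)
Lemma additive_bounded_linear (f : R -> R[i]) (C : R) :
  (forall s t, f (s + t) = f s + f t) -> (forall t, modc (f t) <= C * `|t|) ->
  forall t, f t = t%:C%C * f 1.
Proof.
move=> fD fb.
have f0 : f 0 = 0 by apply: (addrI (f 0)); rewrite -fD !addr0.
have fN t : f (- t) = - f t by apply: (addrI (f t)); rewrite -fD !subrr.
have fn (n : nat) t : f (n%:R * t) = n%:R * f t.
  elim: n => [|n IH]; first by rewrite !mul0r.
  by rewrite -[n.+1]addn1 !natrD !mulrDl !mul1r fD IH.
have C0 : 0 <= C by have := fb 1; rewrite normr1 mulr1; apply: le_trans; exact: modc_ge0.
have pos t : 0 <= t -> f t = t%:C%C * f 1.
  move=> t0; apply/eqP; rewrite -subr_eq0 -modc_eq0 eq_le modc_ge0 andbT.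
  apply: (@le_geometric _ (2 * C) 0) => n _.
  pose N : nat := (2 ^ n)%N; pose k := Num.trunc (N%:R * t).
  have Nt : 0 <= N%:R * t by rewrite mulr_ge0.
  have /andP[k1 k2] := truncn_itv Nt; rewrite -/k in k1 k2.
  pose q := N%:R * t - k%:R.
  have q01 : `|q| <= 1 by rewrite ger0_norm /q; [move: k2; rewrite -natr1; lra|lra].
  have e : N%:R * (f t - t%:C%C * f 1) = f q - q%:C%C * f 1.
    have -> : f q = N%:R * f t - k%:R * f 1.
      by rewrite /q fD fN fn -[k%:R in LHS]mulr1 fn.
    by rewrite /q rmorphB rmorphM /= !rmorph_nat; ring.
  have : modc (N%:R * (f t - t%:C%C * f 1)) <= C + C.
    rewrite e; apply: le_trans (modcD _ _) _; rewrite modcN modcM modcR; apply: lerD.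
      by apply: le_trans (fb q) _; rewrite ler_piMr.
    apply: le_trans (_ : 1 * modc (f 1) <= _); first by rewrite ler_wpM2r ?modc_ge0.
    by rewrite mul1r; have := fb 1; rewrite normr1 mulr1.
  have N0 : 0 < N%:R :> R by rewrite ltr0n expn_gt0.
  rewrite modcM; have -> : modc (N%:R : R[i]) = N%:R.
    by have := modcR (N%:R : R); rewrite rmorph_nat ger0_norm.
  rewrite -ler_pdivlMl // => h; apply: le_trans h _.
  by rewrite mulrC /N natrX -exprVn ler_wpM2r ?exprn_ge0 ?invr_ge0 //; lra.
move=> t; have [h|h] := leP 0 t; first exact: pos.
by have := pos (- t); rewrite oppr_ge0 ltW // fN rmorphN mulNr => /(_ isT)/oppr_inj.
Qed.

Lemma pow2_le1 (x C : R) : (forall k, 2 ^+ k * x <= C) -> x <= 0.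
Proof.
move=> h; apply: (@le_geometric x C 0) => n _.
by rewrite exprVn ler_pdivlMr ?exprn_gt0 // mulrC.
Qed.

(* If all [z ^ 2 ^ k] lie in the disc of centre and radius [1], then the argument
   and the excess over [1] of [z] vanish, since squaring at least doubles them. *)
Lemma disc_powers (z : R[i]) : (forall k, modc (z ^+ (2 ^ k) - 1) < 1) ->
  complex.Im z = 0 /\ complex.Re z <= 1.
Proof.
move=> h; pose w k := z ^+ (2 ^ k).
have wS k : w k.+1 = w k * w k by rewrite /w expnSr exprM expr2.
have hw k : 0 < complex.Re (w k) /\ complex.Re (w k) <= 2.
  have := le_lt_trans (normRe_le _) (h k); rewrite -/(w k) raddfB /= ltr_norml.
  by move=> /andP[h1 h2]; split; lra.
have ReM (u : R[i]) : complex.Re (u * u) = complex.Re u ^+ 2 - complex.Im u ^+ 2.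
  by case: u => a b /=; rewrite !expr2.
have ImM (u : R[i]) : complex.Im (u * u) = 2 * complex.Re u * complex.Im u.
  by case: u => a b /=; ring.
have w0 : w 0%N = z by rewrite /w expn0 expr1.
have z0 : 0 < complex.Re z by have [] := hw 0%N; rewrite w0.
have Imz : complex.Im z = 0.
  (* The tangent of the argument at least doubles at each squaring, yet stays below 1 since the next
     square has positive real part. *)
  have h1 k : 2 ^+ k * `|complex.Im z| * complex.Re (w k) <= `|complex.Im (w k)| * complex.Re z.
    elim: k => [|k IH]; first by rewrite expr0 mul1r w0.
    rewrite wS ReM ImM !normrM (gtr0_norm (proj1 (hw k))) ger0_norm //.
    have [wk0 _] := hw k.
    apply: le_trans (_ : 2 ^+ k.+1 * `|complex.Im z| * complex.Re (w k) ^+ 2 <= _).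
      by rewrite ler_wpM2l ?mulr_ge0 ?exprn_ge0 // gerBl sqr_ge0.
    have := ler_wpM2l (ltW wk0) IH; rewrite exprS expr2; lra.
  apply/eqP; rewrite -normr_eq0 eq_le normr_ge0 andbT; apply: (@pow2_le1 _ (complex.Re z)) => k.
  have [wk0 _] := hw k; rewrite -(ler_pM2r wk0).
  apply: le_trans (h1 k) _; rewrite mulrC; apply: ler_wpM2l; first exact: ltW.
  have [] := hw k.+1; rewrite wS ReM subr_gt0 -[X in X < _]real_normK ?num_real // => h2 _.
  by apply: ltW; rewrite -(ltr_pXn2r (n := 2)) ?nnegrE // ltW.
split=> //; rewrite -subr_le0; apply: (@pow2_le1 _ 1) => k.
have Imw m : complex.Im (w m) = 0.
  by elim: m => [|m IH]; rewrite ?w0 // wS ImM IH mulr0.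
apply: (@le_trans _ _ (complex.Re (w k) - 1)); last by have [_] := hw k; lra.
elim: k => [|k IH]; first by rewrite expr0 mul1r w0.
rewrite wS ReM Imw expr0n subr0 exprS -mulrA.
have := sqr_ge0 (complex.Re (w k) - 1); rewrite expr2; lra.
Qed.

End Auxiliary.

(** * The derivative is a real-linear isometry with dense range *)

Section DerivativeProperties.
Variables (R : realType) (A B : comBanachAlgType R).
Hypothesis ssB : semisimple B.
Variables (T : A -> B) (T' : B -> A).
Hypothesis Tu : forall f, f \is a GRing.unit -> T f \is a GRing.unit.
Hypothesis T'u : forall g, g \is a GRing.unit -> T' g \is a GRing.unit.
Hypothesis TK : forall f, f \is a GRing.unit -> T' (T f) = f.
Hypothesis T'K : forall g, g \is a GRing.unit -> T (T' g) = g.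
Hypothesis T_rdist : forall f h, f \is a GRing.unit -> h \is a GRing.unit ->
  rdist (T f) (T h) = rdist f h.

Local Notation rA := (@spectral_radius R A).
Local Notation rB := (@spectral_radius R B).
Local Notation H := (normalize T).
Local Notation D := (increment T).
Local Notation X := (dilate T).
Local Notation MB := (max_ideal_space B).

Variable S : A -> MB -> R[i].
Hypothesis S_approx : forall u n, small u n -> forall y,
    modc (gelfand (X u n) y - S u y) <= 8 * rA u ^+ 2 * 2^-1 ^+ n.

Lemma dilate_radius u n : small u n -> rB (X u n) = rA u.
Proof.
move=> hn; rewrite radius_dyadic' (increment_radius Tu T_rdist).
  by rewrite radius_dyadic mulrA pow2K mul1r.
by apply: radius_unit; rewrite radius_dyadic; apply: le_lt_trans hn _; lra.
Qed.

Lemma derivative_le u y : modc (S u y) <= rA u.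
Proof.
have [n0 hn0] := small_exists u; rewrite -subr_le0.
apply: (@le_geometric _ _ (8 * rA u ^+ 2) n0) => n hn.
have sn := smallS hn hn0; have := S_approx sn y.
have := gelfand_le (X u n) y; rewrite dilate_radius //.
have := modcD (gelfand (X u n) y) (- (gelfand (X u n) y - S u y)).
rewrite modcN opprB addrC subrK; lra.
Qed.

Lemma derivative_ge u (K : R) : (forall y, modc (S u y) <= K) -> rA u <= K.
Proof.
move=> h; have [n0 hn0] := small_exists u; rewrite -subr_le0.
apply: (@le_geometric _ _ (8 * rA u ^+ 2) n0) => n hn.
have sn := smallS hn hn0; rewrite -(dilate_radius sn) lerBlDr; apply: radius_le => y.
have := S_approx sn y; rewrite (dilate_radius sn); have := h y.
by have := modcD (gelfand (X u n) y - S u y) (S u y); rewrite subrK; lra.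
Qed.

Lemma derivative_cl u : cl B (S u).
Proof.
apply: clP => e e0; have [n0 hn0] := small_exists u.
have K0 : 0 < 8 * rA u ^+ 2 + 1 by rewrite ltr_wpDl // mulr_ge0 // sqr_ge0.
have [|n1 hn1] := exp_half_lt (e := e / (8 * rA u ^+ 2 + 1)); first by rewrite divr_gt0.
exists (X u (n0 + n1)%N) => y; rewrite modcB.
apply: le_lt_trans (S_approx (smallS (leq_addr _ _) hn0) y) _.
have := hn1 (n0 + n1)%N (leq_addl _ _); rewrite ltr_pdivlMr // => h.
apply: le_lt_trans h; rewrite mulrC ler_wpM2l ?exprn_ge0 ?invr_ge0 //.
by rewrite lerDl.
Qed.

Lemma derivativeD u v y : S (u + v) y = S u y + S v y.
Proof.
apply/eqP; rewrite -subr_eq0 -modc_eq0 eq_le modc_ge0 andbT.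
have [n1 h1] := small_exists u; have [n2 h2] := small_exists v.
have [n3 h3] := small_exists (u + v).
pose C := 8 * rA (u + v) ^+ 2 + 8 * rA u ^+ 2 + 8 * rA v ^+ 2 + 5 * (rA u * rA v).
apply: (@le_geometric _ _ C (n1 + n2 + n3)%N) => n hn.
have s1 : small u n by apply: smallS h1; lia.
have s2 : small v n by apply: smallS h2; lia.
have s3 : small (u + v) n by apply: smallS h3; lia.
have := S_approx s1 y; have := S_approx s2 y; have := S_approx s3 y.
set a1 := gelfand (X u n) y; set a2 := gelfand (X v n) y; set a3 := gelfand (X (u + v) n) y.
have : modc (a3 - a1 - a2) <= 5 * (rA u * rA v) * 2^-1 ^+ n.
  rewrite /a1 /a2 /a3 -!gelfandB; apply: le_trans (gelfand_le _ _) _.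
  rewrite /dilate -!scalerBr radius_dyadic' scalerDr.
  have := @increment_quasi_additive _ _ _ ssB _ _ Tu T'u TK T'K T_rdist
    ((2^-1 ^+ n)%:C%C *: u) ((2^-1 ^+ n)%:C%C *: v).
  rewrite !radius_dyadic => h.
  have {}h := h (le_trans s1 (_ : 400^-1 <= 200^-1)) (le_trans s2 (_ : 400^-1 <= 200^-1)).
  have l : (400^-1 : R) <= 200^-1 by lra.
  apply: le_trans (ler_wpM2l _ (h l l)) _; first by rewrite exprn_ge0.
  have := pow2K R n; set p := 2 ^+ n; set q := 2^-1 ^+ n => pq.
  have -> : p * (5 * (q * rA u * (q * rA v))) = (p * q) * (5 * (rA u * rA v) * q) by ring.
  by rewrite pq mul1r.
have -> : S (u + v) y - (S u y + S v y) =
   (a3 - a1 - a2) - (a3 - S (u + v) y) + ((a1 - S u y) + (a2 - S v y)) by ring.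
move=> e0 e3 e2 e1.
have := modcD (a3 - a1 - a2 - (a3 - S (u + v) y)) ((a1 - S u y) + (a2 - S v y)).
have := modcD (a1 - S u y) (a2 - S v y).
have := modcD (a3 - a1 - a2) (- (a3 - S (u + v) y)); rewrite modcN.
rewrite /C; move: e0 e1 e2 e3.
set t1 := modc _; set t2 := modc _; set t3 := modc _; set t4 := modc _.
lra.
Qed.

Lemma derivativeZ (t : R) u y : S (t%:C%C *: u) y = t%:C%C * S u y.
Proof.
rewrite (@additive_bounded_linear _ (fun t => S (t%:C%C *: u) y) (rA u)).
- by rewrite rmorph1 scale1r.
- by move=> s s'; rewrite rmorphD scalerDl derivativeD.
by move=> s; apply: le_trans (derivative_le _ _) _; rewrite radiusZ modcR mulrC.
Qed.

Lemma increment_derivative w y : rA w <= 400^-1 ->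
  modc (gelfand (D w) y - S w y) <= 8 * rA w ^+ 2.
Proof.
move=> hw; have s0 : small w 0 by rewrite /small expr0 mul1r.
have := S_approx s0 y; rewrite /dilate !expr0 rmorph1 !scale1r mulr1.
exact.
Qed.

(** For [b] in [B], surjectivity gives [a] with [H a = 1 + 2^-n b]. The direction [u = 2^n (a - 1)]
    has [b] itself as its [n]-th difference quotient, and has the spectral radius of [b], so the
    error tends to 0 with [n]. *)
Lemma derivative_dense f : cl B f -> forall e : R, 0 < e ->
  exists u, forall y, modc (f y - S u y) < e.
Proof.
move=> cf e e0; have e20 : 0 < e / 2 by rewrite divr_gt0.
have [b hb] := cl_approx cf e20.
have [n0 hn0] : exists n0, forall n, (n0 <= n)%N -> 2^-1 ^+ n * rB b <= 400^-1.
  have [|n hn] := exp_half_lt (e := (400 * (rB b + 1))^-1).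
    by rewrite invr_gt0 mulr_gt0 // ltr_wpDl ?radius_ge0.
  exists n => m hm; have r0 := radius_ge0 b.
  apply: le_trans (ler_wpM2r r0 (ltW (hn m hm))) _.
  rewrite invfM -mulrA ler_piMr ?invr_ge0 // mulrC ler_pdivrMr; lra.
have K0 : 0 < 8 * rB b ^+ 2 + 1 by rewrite ltr_wpDl // mulr_ge0 // sqr_ge0.
have [|n1 hn1] := exp_half_lt (e := e / 2 / (8 * rB b ^+ 2 + 1)); first by rewrite divr_gt0.
pose n := (n0 + n1)%N.
have hn : 2^-1 ^+ n * rB b <= 400^-1 by apply: hn0; exact: leq_addr.
pose c : B := 1 + (2^-1 ^+ n)%:C%C *: b.
have cu : c \is a GRing.unit by apply: radius_unit; rewrite radius_dyadic; lra.
pose a := T' (T 1 * c).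
have T1u := T1u Tu.
have T1cu : T 1 * c \is a GRing.unit by rewrite unitrM T1u.
have au : a \is a GRing.unit by exact: T'u.
have Ha : H a = c by rewrite /normalize T'K // [T 1 * c]mulrC mulrK.
pose w := a - 1.
have aE : a = 1 + w by rewrite /w addrC subrK.
have rw : rA w = 2^-1 ^+ n * rB b.
  rewrite -rdist1 -(normalize_rdist Tu T_rdist) ?unitr1 // normalize1 // Ha rdist1.
  by rewrite /c addrC addKr radius_dyadic.
pose u := (2 ^+ n)%:C%C *: w.
have ru : rA u = rB b by rewrite radius_dyadic' rw mulrA pow2K mul1r.
have wE : (2^-1 ^+ n)%:C%C *: u = w.
  by rewrite scalerA -rmorphM mulrC pow2K rmorph1 scale1r.
have su : small u n by rewrite /small ru.
have Xu : X u n = b.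
  rewrite /dilate wE /increment -aE Ha /c addrC addKr scalerA -rmorphM pow2K.
  by rewrite rmorph1 scale1r.
exists u => y; have := S_approx su y; rewrite Xu ru => h.
have h2 : 8 * rB b ^+ 2 * 2^-1 ^+ n < e / 2.
  have := hn1 n (leq_addl _ _); rewrite ltr_pdivlMr // => h3.
  apply: le_lt_trans h3; rewrite mulrC ler_wpM2l ?exprn_ge0 ?invr_ge0 //.
  by rewrite lerDl.
have := modcD (f y - gelfand b y) (gelfand b y - S u y); rewrite addrA subrK.
have := hb y; lra.
Qed.

End DerivativeProperties.

(** * Real-linear isometries at a Choquet boundary point *)

Section ChoquetMap.
Variables (R : realType) (A B : comBanachAlgType R).

Local Notation rA := (@spectral_radius R A).
Local Notation MB := (max_ideal_space B).

Lemma char_sep2 (x y z : max_ideal_space A) : x <> y -> x <> z ->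
  exists a, [/\ gelfand a x = 1, gelfand a y = 0 & gelfand a z = 0].
Proof.
move=> /char_sep[a [ax ay]] /char_sep[b [bx bz]]; exists (a * b).
by rewrite !gelfandM ax ay bx bz mul0r mulr0 mulr1.
Qed.

Section Isometry.
Variable S : A -> MB -> R[i].
Hypothesis S_cl : forall u, cl B (S u).
Hypothesis SD : forall u v y, S (u + v) y = S u y + S v y.
Hypothesis SZ : forall (t : R) u y, S (t%:C%C *: u) y = t%:C%C * S u y.
Hypothesis S_le : forall u y, modc (S u y) <= rA u.
Hypothesis S_ge : forall u (K : R), (forall y, modc (S u y) <= K) -> rA u <= K.
Hypothesis S_dense : forall f, cl B f -> forall e : R, 0 < e ->
  exists u, forall y, modc (f y - S u y) < e.

Lemma isometry_sup_norm u : sup_norm (S u) = rA u.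
Proof.
have [y0 _] := char_exists B; apply/eqP; rewrite eq_le; apply/andP; split.
  by apply: (sup_norm_le y0) => y; exact: S_le.
by apply: S_ge => y; apply: sup_norm_ge; apply: cl_bounded.
Qed.

(** The sup norm of [S u] is [r u], so extremality of a boundary evaluation on the range of [S] is
    extremality below the spectral radius of [A]. *)
Lemma isometry_eval (y : Ch B) (la : R[i]) : modc la = 1 ->
  exists x : Ch A, exists2 mu : R[i], modc mu = 1 &
    forall u, complex.Re (la * S u (\val y)) = complex.Re (mu * gelfand u (\val x)).
Proof.
move=> la1; apply: (@extreme_Ch R A (fun u => complex.Re (la * S u (\val y)))).
- split=> [u v _ _|t u _]; first by rewrite SD mulrDr raddfD.
  by rewrite SZ mulrCA Re_scale.
- move=> u _; apply: le_trans (Re_le_modc _) _.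
  by rewrite modcM la1 mul1r S_le.
have SD' u v : S (u + v) = S u + S v by apply/funext => z; exact: SD.
have SZ' (t : R) u : S (t%:C%C *: u) = t%:C%C *: S u by apply/funext => z; exact: SZ.
have := @Ch_extreme R B A S S_cl SD' SZ' S_dense y la la1.
by congr extreme_dominated; apply/funext => u; exact: isometry_sup_norm.
Qed.

(* The points given by [isometry_eval] for [la = 1], ['i] and [(3 + 4 'i) / 5]
   coincide, and comparing the coefficients shows that [S u y] is [k * u x]
   or the conjugate of it. *)
Lemma isometry_point (y : Ch B) : exists x : Ch A, exists2 k : R[i], modc k = 1 &
  (forall u, S u (\val y) = k * gelfand u (\val x)) \/
  (forall u, S u (\val y) = (k * gelfand u (\val x))^*).
Proof.
pose la3 : R[i] := ((3 / 5) +i* (4 / 5))%C.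
have la3_1 : modc la3 = 1.
  apply/eqP; rewrite -(@pexpr_eq1 _ _ 2) ?modc_ge0 // sqr_modc /=; apply/eqP; lra.
have [x1 [m1 m1_1 h1]] := isometry_eval y (modc1 R).
have [x2 [m2 m2_1 h2]] := isometry_eval y (modc_i R).
have [x3 [m3 m3_1 h3]] := isometry_eval y la3_1.
have lin u : complex.Re (m3 * gelfand u (\val x3)) =
    3 / 5 * complex.Re (m1 * gelfand u (\val x1)) + 4 / 5 * complex.Re (m2 * gelfand u (\val x2)).
  rewrite -h1 -h2 -h3; case: (S u _) => a b /=; ring.
have mm (m : R[i]) : modc m = 1 -> m * m^* = 1 by move=> e; rewrite mul_conjE e expr1n.
have Re1 : complex.Re (1 : R[i]) = 1 by [].
have Re0 : complex.Re (0 : R[i]) = 0 by [].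
(* An element equal to 1 at one point and 0 at the others, rotated, makes one side of [lin] vanish
   and not the other. *)
have x31 : \val x3 = \val x1.
  apply: contrapT => ne.
  have [e21|ne21] := pselect (\val x2 = \val x1).
    have [u [u3 u1 _]] := char_sep2 ne ne; have := lin (m3^* *: u).
    by rewrite e21 !gelfandZ u3 u1 !mulr0 mulr1 mm // Re1 ?Re0; lra.
  have ne13 : \val x1 <> \val x3 by move/esym.
  have ne12 : \val x1 <> \val x2 by move/esym.
  have [u [u1 u2 u3]] := char_sep2 ne12 ne13; have := lin (m1^* *: u).
  by rewrite !gelfandZ u1 u2 u3 !mulr0 mulr1 mm // Re1 ?Re0; lra.
have x32 : \val x3 = \val x2.
  apply: contrapT => ne.
  have [e21|ne21] := pselect (\val x1 = \val x2).
    have [u [u3 u1 _]] := char_sep2 ne ne; have := lin (m3^* *: u).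
    by rewrite e21 !gelfandZ u3 u1 !mulr0 mulr1 mm // Re1 ?Re0; lra.
  have ne13 : \val x2 <> \val x3 by move/esym.
  have ne12 : \val x2 <> \val x1 by move/esym.
  have [u [u2 u1 u3]] := char_sep2 ne12 ne13; have := lin (m2^* *: u).
  by rewrite !gelfandZ u1 u2 u3 !mulr0 mulr1 mm // Re1 ?Re0; lra.
have x12 : \val x2 = \val x1 by rewrite -x31.
have lin' (z : R[i]) : complex.Re (m3 * z) = 3 / 5 * complex.Re (m1 * z) + 4 / 5 * complex.Re (m2 * z).
  by have := lin z%:A; rewrite !gelfand_scalar.
have hS u : S u (\val y) = ((complex.Re (m1 * gelfand u (\val x1))) -i*
    (complex.Re (m2 * gelfand u (\val x1))))%C.
  rewrite -h1 -{1}x12 -h2; case: (S u _) => a b /=; congr (_ +i* _)%C; ring.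
(* By [lin'], [m3 = (3 m1 + 4 m2) / 5]; as all three have modulus 1, [m1] and [m2] are orthogonal in
   the plane. *)
have m12 : m2 = 'i%C * m1 \/ m2 = - 'i%C * m1.
  have := sqr_modc m1; have := sqr_modc m2; have := sqr_modc m3.
  rewrite m1_1 m2_1 m3_1 !expr1n.
  have := lin' 1; have := lin' 'i%C; rewrite !mulr1.
  case: m1 {m1_1 h1 lin lin' hS} => a b; case: m2 {m2_1 h2} => c d; case: m3 {m3_1 h3} => e f /=.
  rewrite !mulr0 !mulr1 !sub0r => h4 h5 h6 h7 h8.
  have ef : f = 3 / 5 * b + 4 / 5 * d by lra.
  have ac : a * c + b * d = 0.
    rewrite h5 ef in h6; move: h6; rewrite !expr2 in h7 h8 * => h6; nra.
  have : (a * d - b * c) ^+ 2 = 1.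
    have -> : (a * d - b * c) ^+ 2 = (a ^+ 2 + b ^+ 2) * (c ^+ 2 + d ^+ 2) - (a * c + b * d) ^+ 2 by ring.
    by rewrite -h7 -h8 ac; ring.
  move=> /eqP; rewrite sqrf_eq1 => /orP[/eqP q|/eqP q]; [left|right].
    simpc; congr (_ +i* _)%C.
      have -> : c = c * (a ^+ 2 + b ^+ 2) by rewrite -h8 mulr1.
      have -> : - b = - b * (a * d - b * c) by rewrite q mulr1.
      have -> : c * (a ^+ 2 + b ^+ 2) = a * (a * c + b * d) - b * (a * d - b * c) by ring.
      by rewrite ac mulr0 sub0r mulNr.
    have -> : d = d * (a ^+ 2 + b ^+ 2) by rewrite -h8 mulr1.
    have -> : d * (a ^+ 2 + b ^+ 2) = b * (a * c + b * d) + a * (a * d - b * c) by ring.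
    by rewrite ac q mulr0 add0r mulr1.
  simpc; congr (_ +i* _)%C.
    have -> : c = c * (a ^+ 2 + b ^+ 2) by rewrite -h8 mulr1.
    have -> : c * (a ^+ 2 + b ^+ 2) = a * (a * c + b * d) - b * (a * d - b * c) by ring.
    by rewrite ac q mulr0 sub0r mulrN1 opprK.
  have -> : d = d * (a ^+ 2 + b ^+ 2) by rewrite -h8 mulr1.
  have -> : d * (a ^+ 2 + b ^+ 2) = b * (a * c + b * d) + a * (a * d - b * c) by ring.
  by rewrite ac q mulr0 add0r mulrN1.
exists x1, m1 => //; case: m12 => m2E; [left|right] => u; rewrite hS m2E -mulrA.
  by case: (m1 * _) => a b; simpc.
by rewrite conjE; case: (m1 * _) => a b; simpc.
Qed.

End Isometry.

End ChoquetMap.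

(** * Identity or conjugation, and estimates on discs *)

Section Twist.
Variable R : realType.
Implicit Types z w : R[i].

Definition twist (s : bool) z : R[i] := if s then z else z^*.

Lemma twistD s z w : twist s (z + w) = twist s z + twist s w.
Proof. by case: s => //=; rewrite rmorphD. Qed.
Lemma twistB s z w : twist s (z - w) = twist s z - twist s w.
Proof. by case: s => //=; rewrite rmorphB. Qed.
Lemma twistM s z w : twist s (z * w) = twist s z * twist s w.
Proof. by case: s => //=; rewrite rmorphM. Qed.
Lemma twist0 s : twist s 0 = 0.
Proof. by case: s => //=; rewrite rmorph0. Qed.
Lemma twist1 s : twist s 1 = 1.
Proof. by case: s => //=; rewrite rmorph1. Qed.
Lemma twistV s z : twist s z^-1 = (twist s z)^-1.
Proof. by case: s => //=; rewrite fmorphV. Qed.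
Lemma modc_twist s z : modc (twist s z) = modc z.
Proof. by case: s => //=; rewrite modc_conj. Qed.
Lemma twist_eq0 s z : (twist s z == 0) = (z == 0).
Proof. by rewrite -!modc_eq0 modc_twist. Qed.

(* The hypotheses say that [|z|^2] and [|w|^2] are at most [Re (w^* z)]. *)
Lemma half_discs z w : modc (z - w / 2) <= modc w / 2 -> modc (w - z / 2) <= modc z / 2 -> z = w.
Proof.
move=> h1 h2; apply/eqP; rewrite -subr_eq0 -modc_eq0 -sqrf_eq0 eq_le sqr_ge0 andbT.
have sq (u v : R[i]) : modc (u - v / 2) <= modc v / 2 ->
    modc (u - v / 2) ^+ 2 <= (modc v ^+ 2) / 4.
  move=> h; have -> : modc v ^+ 2 / 4 = (modc v / 2) ^+ 2 by rewrite expr_div_n; lra.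
  by rewrite lerXn2r ?nnegrE ?modc_ge0 // divr_ge0 ?modc_ge0.
have e2 (u : R[i]) : u / 2 = (complex.Re u / 2 +i* (complex.Im u / 2))%C.
  have -> : (2 : R[i])^-1 = (2^-1)%:C%C by rewrite fmorphV rmorph_nat.
  by case: u => a b; simpc.
have := sq _ _ h1; have := sq _ _ h2.
rewrite !sqr_modc !e2; case: z {h1 h2} => a b; case: w => c d /=.
rewrite !expr2; lra.
Qed.

(* The choice of [C] makes AM-GM absorb the terms linear in [k - 1]. *)
Lemma peak_disc (k b : R[i]) (e : R) : 0 < e -> e <= 1 ->
  1 - e / 32 + (32 / e + 1 + e^-1) * modc (k - 1) ^+ 2 <= complex.Re b ->
  modc (2 * k - b) <= (1 + e) * modc b.
Proof.
move=> e0 e1 h; rewrite -(ler_pXn2r (n := 2)) ?nnegrE ?modc_ge0 //; last first.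
  by rewrite mulr_ge0 ?modc_ge0 // addr_ge0 // ltW.
rewrite exprMn !sqr_modc in h *.
have -> : 2 * k = (2 * complex.Re k +i* (2 * complex.Im k))%C.
  have -> : (2 : R[i]) = 2%:C%C by rewrite rmorph_nat.
  by case: (k) => a c; simpc.
case: k h => p q; case: b => m n /=; rewrite subr0 => h.
have en : e != 0 by rewrite gt_eqF.
have ei : 0 < e^-1 by rewrite invr_gt0.
have p1 : 0 <= (p - 1) ^+ 2 by exact: sqr_ge0.
have q1 : 0 <= q ^+ 2 by exact: sqr_ge0.
have ee : e * e^-1 = 1 by rewrite divff // gt_eqF.
have mb : 2^-1 <= m.
  apply: le_trans (_ : 1 - e / 32 <= _); first lra.
  apply: le_trans h; rewrite lerDl mulr_ge0 ?addr_ge0 // ?divr_ge0 ?(ltW e0) //.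
  exact: ltW.
have a1 : - ((p - 1) * m) <= (p - 1) ^+ 2 * e^-1 + e / 4 * m ^+ 2.
  have := mulr_ge0 (ltW ei) (sqr_ge0 ((p - 1) + e / 2 * m)).
  have -> : e^-1 * (p - 1 + e / 2 * m) ^+ 2 =
    (p - 1) ^+ 2 * e^-1 + (e * e^-1) * (p - 1) * m + (e * e^-1) * (e / 4 * m ^+ 2) by field; exact: en.
  by rewrite ee; lra.
have a2 : - (q * n) <= q ^+ 2 * e^-1 + e / 4 * n ^+ 2.
  have := mulr_ge0 (ltW ei) (sqr_ge0 (q + e / 2 * n)).
  have -> : e^-1 * (q + e / 2 * n) ^+ 2 =
    q ^+ 2 * e^-1 + (e * e^-1) * q * n + (e * e^-1) * (e / 4 * n ^+ 2) by field; exact: en.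
  by rewrite ee; lra.
have a3 : 2 * (p - 1) <= e / 32 + 32 / e * (p - 1) ^+ 2.
  have e32 : 0 <= 32 / e by rewrite divr_ge0 // ltW.
  have := mulr_ge0 e32 (sqr_ge0 ((p - 1) - e / 32)).
  have -> : 32 / e * (p - 1 - e / 32) ^+ 2 =
    32 / e * (p - 1) ^+ 2 - (e * e^-1) * (2 * (p - 1)) + (e * e^-1) * (e / 32) by field; exact: en.
  by rewrite ee; lra.
have a4 : e / 16 <= e / 4 * (m ^+ 2 + n ^+ 2).
  have m2 : 4^-1 <= m ^+ 2 by have : 2^-1 ^+ 2 <= m ^+ 2 by [rewrite lerXn2r ?nnegrE //; lra]; rewrite expr2; lra.
  have n2 := sqr_ge0 n.
  have : e / 4 * 4^-1 <= e / 4 * (m ^+ 2 + n ^+ 2) by rewrite ler_wpM2l; lra.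
  lra.
have a5 : 0 <= 32 / e * q ^+ 2 by rewrite mulr_ge0 // divr_ge0 // ltW.
have a6 : p ^+ 2 + q ^+ 2 - (p * m + q * n) <= e / 2 * (m ^+ 2 + n ^+ 2).
  have -> : p ^+ 2 = 1 + 2 * (p - 1) + (p - 1) ^+ 2 by ring.
  have -> : p * m = m + (p - 1) * m by ring.
  rewrite !mulrDr !mulrDl in h a4 *; lra.
have a7 : 0 <= e ^+ 2 * (m ^+ 2 + n ^+ 2) by rewrite mulr_ge0 ?sqr_ge0 // addr_ge0 ?sqr_ge0.
have -> : (1 + e) ^+ 2 * (m ^+ 2 + n ^+ 2) =
  (m ^+ 2 + n ^+ 2) + 4 * (e / 2 * (m ^+ 2 + n ^+ 2)) + e ^+ 2 * (m ^+ 2 + n ^+ 2) by field.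
have -> : (2 * p - m) ^+ 2 + (2 * q - n) ^+ 2 =
  4 * (p ^+ 2 + q ^+ 2 - (p * m + q * n)) + (m ^+ 2 + n ^+ 2) by ring.
lra.
Qed.

End Twist.

(** * The value of [T] at a Choquet boundary point *)

Section PointEvaluation.
Variables (R : realType) (A B : comBanachAlgType R).
Hypothesis ssB : semisimple B.
Variables (T : A -> B) (T' : B -> A).
Hypothesis Tu : forall f, f \is a GRing.unit -> T f \is a GRing.unit.
Hypothesis T'u : forall g, g \is a GRing.unit -> T' g \is a GRing.unit.
Hypothesis TK : forall f, f \is a GRing.unit -> T' (T f) = f.
Hypothesis T'K : forall g, g \is a GRing.unit -> T (T' g) = g.
Hypothesis T_rdist : forall f h, f \is a GRing.unit -> h \is a GRing.unit ->
  rdist (T f) (T h) = rdist f h.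

Local Notation rA := (@spectral_radius R A).
Local Notation rB := (@spectral_radius R B).
Local Notation H := (normalize T).
Local Notation D := (increment T).
Local Notation MB := (max_ideal_space B).

Let HX := normalizeX ssB Tu T'u TK T'K T_rdist.
Let HM := normalizeM ssB Tu T'u TK T'K T_rdist.
Let H_rdist := normalize_rdist Tu T_rdist.

Section Derivative.
Variable S : A -> MB -> R[i].
Hypothesis S_approx : forall u n, small u n -> forall y,
    modc (gelfand (dilate T u n) y - S u y) <= 8 * rA u ^+ 2 * 2^-1 ^+ n.

Let SZ := derivativeZ ssB Tu T'u TK T'K T_rdist S_approx.

(* The powers of [H (1 - t)] stay in the unit disc centred at [1]. *)
Lemma normalize_scalar_real (t : R) (y : MB) : 0 < t -> t < 1 ->
  complex.Im (gelfand (H (1 - t)%:C%C%:A) y) = 0 /\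
  complex.Re (gelfand (H (1 - t)%:C%C%:A) y) <= 1.
Proof.
move=> t0 t1; apply: disc_powers => k.
have nz (s : R) : 0 < s -> s%:C%C != 0 :> R[i].
  by move=> s0; rewrite -modc_gt0 modcR gtr0_norm.
have s0 : 0 < 1 - t by rewrite subr_gt0.
have Gs : unit_component ((1 - t)%:C%C%:A : A) by apply: unit_component_scalar; exact: nz.
have e : (1 - t)%:C%C%:A ^+ (2 ^ k) = ((1 - t) ^+ (2 ^ k))%:C%C%:A :> A.
  by rewrite rmorphXn -(rmorphXn (in_alg A)).
rewrite -gelfandX -HX // e -(gelfand1 y) -gelfandB; apply: le_lt_trans (gelfand_le _ _) _.
have p0 : 0 < (1 - t) ^+ (2 ^ k) by rewrite exprn_gt0.
have p1 : (1 - t) ^+ (2 ^ k) <= 1 by rewrite exprn_ile1 //; lra.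
have cu : ((1 - t) ^+ (2 ^ k))%:C%C%:A \is a (@GRing.unit A) by apply: scalar_unit; exact: nz.
rewrite -rdist1 -(normalize1 Tu) H_rdist ?unitr1 // rdist1.
have -> : ((1 - t) ^+ (2 ^ k))%:C%C%:A - 1 = ((1 - t) ^+ (2 ^ k) - 1)%:C%C *: (1 : A).
  by rewrite rmorphB scalerBl rmorph1 scale1r.
rewrite radiusZ radius1 mulr1 modcR ler0_norm; lra.
Qed.

(** [H (1 - t)] equals [1 - t * S 1 y] up to [8 t^2], while its value at [y] is real and at most 1.
    Divide by [t] and let [t] tend to 0. *)
Lemma derivative_one_ge0 (y : MB) :
  complex.Im (S 1 y) = 0 /\ 0 <= complex.Re (S 1 y).
Proof.
have key n : let t : R := 400^-1 * 2^-1 ^+ n in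
    `|complex.Im (S 1 y)| <= 8 * t /\ - complex.Re (S 1 y) <= 8 * t.
  move=> t; have p0 : 0 < (2^-1 : R) ^+ n by rewrite exprn_gt0 // invr_gt0.
  have p1 : (2^-1 : R) ^+ n <= 1 by rewrite exprn_ile1 //; lra.
  have t0 : 0 < t by rewrite mulr_gt0 // invr_gt0.
  have t4 : t <= 400^-1 by rewrite /t ler_piMr // invr_ge0.
  have [zi zr] : complex.Im (gelfand (H (1 - t)%:C%C%:A) y) = 0 /\
    complex.Re (gelfand (H (1 - t)%:C%C%:A) y) <= 1 by apply: normalize_scalar_real; lra.
  have rw : rA ((- t)%:C%C *: 1) = t by rewrite radiusZ radius1 mulr1 modcR normrN gtr0_norm.
  have := increment_derivative S_approx (w := (- t)%:C%C *: 1) y; rewrite rw => /(_ t4).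
  have -> : gelfand (D ((- t)%:C%C *: 1)) y = gelfand (H (1 - t)%:C%C%:A) y - 1.
    rewrite /increment gelfandB gelfand1; congr (gelfand (H _) y - 1).
    by rewrite rmorphB scalerBl rmorph1 scale1r rmorphN scaleNr.
  rewrite SZ; set z := gelfand _ _; set s := S 1 y => h.
  have := le_trans (normIm_le _) h; have := le_trans (Re_le_modc _) h.
  have := le_trans (normRe_le _) h.
  move: zi zr; rewrite -/z; case: z {h} => a b; case: s => c d /= -> a1.
  rewrite !mul0r !subr0 ?addr0 ?sub0r !mulNr !opprK normrM gtr0_norm // => /ler_normlP[h0 _] _ h2.
  split.
    by rewrite -(ler_pM2l t0); lra.
  by rewrite -(ler_pM2l t0); lra.
split; last first.
  rewrite -oppr_le0; apply: (@le_geometric _ _ (8 * 400^-1) 0) => n _.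
  by rewrite -mulrA; exact: (proj2 (key n)).
apply/eqP; rewrite -normr_le0; apply: (@le_geometric _ _ (8 * 400^-1) 0) => n _.
by rewrite -mulrA; exact: (proj1 (key n)).
Qed.

(** The unimodular factor of [isometry_point] is [S 1 y] or its conjugate, hence 1 by positivity. *)
Lemma derivative_point (y : Ch B) : exists (x : Ch A) (s : bool),
  forall u, S u (\val y) = twist s (gelfand u (\val x)).
Proof.
have [x [k k1 hk]] := isometry_point (derivative_cl S_approx)
  (derivativeD ssB Tu T'u TK T'K T_rdist S_approx) SZ
  (derivative_le Tu T_rdist S_approx) (derivative_ge Tu T_rdist S_approx)
  (derivative_dense Tu T'u T'K T_rdist S_approx) y.
have [i1 r1] := derivative_one_ge0 (\val y).
have kE : k = 1.
  have [i2 r2] : complex.Im k = 0 /\ 0 <= complex.Re k.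
    case: hk => /(_ 1) e; move: i1 r1; rewrite e gelfand1 mulr1 ?conjE //=.
    by move=> /eqP; rewrite oppr_eq0 => /eqP.
  have := sqr_modc k; rewrite k1 i2 expr1n expr0n addr0 => /esym/eqP.
  rewrite sqrf_eq1 => /orP[] /eqP e; last by move: r2; rewrite e oppr_ge0 ler10.
  by case: (k) i2 e => a b /= -> ->.
exists x; rewrite kE in hk; case: hk => h; [exists true|exists false] => u.
  by rewrite h mul1r.
by rewrite h mul1r.
Qed.

Variables (y : Ch B) (x : Ch A) (s : bool).
Hypothesis Sy : forall u, S u (\val y) = twist s (gelfand u (\val x)).

Local Notation evB f := (gelfand f (\val y)).
Local Notation evA f := (twist s (gelfand f (\val x))).

(** The relative error is quadratic in the step, so it sums to order [1 / n] over [n] steps of size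
    [1 / n]. *)
Lemma small_quotient (w : A) (q : R) : rA w <= q -> q <= 400^-1 ->
  exists d, evB (H (1 + w)) = evA (1 + w) * (1 + d) /\ modc d <= 16 * q ^+ 2.
Proof.
move=> hw hq; have := increment_derivative S_approx (\val y) (le_trans hw hq).
rewrite Sy /increment gelfandB gelfand1 => h.
have r0 := radius_ge0 w; have q0 : 0 <= q by exact: le_trans hw.
have h2 : 2^-1 <= modc (evA (1 + w)).
  rewrite modc_twist gelfandD gelfand1; have := modcNB 1 (- gelfand w (\val x)).
  rewrite modc1 modcN opprK; have := gelfand_le w (\val x); lra.
have nz : evA (1 + w) != 0 by rewrite -modc_gt0; lra.
exists (evB (H (1 + w)) / evA (1 + w) - 1); split.
  by rewrite addrCA subrr addr0 mulrC divfK.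
have -> : evB (H (1 + w)) / evA (1 + w) - 1 = (evB (H (1 + w)) - 1 - evA w) / evA (1 + w).
  have tE : evA (1 + w) = 1 + evA w by rewrite gelfandD gelfand1 twistD twist1.
  by rewrite -addrA -opprD -tE mulrBl divff.
rewrite modcM modcV ler_pdivrMr ?modc_gt0 //; apply: le_trans h _.
have hs : rA w ^+ 2 <= q ^+ 2 by rewrite lerXn2r ?nnegrE.
have : 8 * q ^+ 2 <= 16 * q ^+ 2 * modc (evA (1 + w)).
  by have := ler_wpM2l (sqr_ge0 q) h2; lra.
lra.
Qed.

(** Along the subdivided segment from 1 to [b] the relative errors multiply; after [n = 2 ^ m] steps
    they amount to at most [2 / n], for every large [m]. *)
Lemma near_one_eval (b : A) : near_one b -> evB (H b) = evA b.
Proof.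
move=> [bu]; rewrite ge_max => /andP[hb _]; rewrite rdist1 in hb.
have bd z : 2^-1 <= complex.Re (gelfand b z).
  have := le_trans (normRe_le _) (le_trans (gelfand_le (b - 1) z) hb).
  by rewrite gelfandB gelfand1 raddfB /= ler_norml => /andP[]; lra.
have d0 : 0 < 2^-1 :> R by rewrite invr_gt0.
have m2 : (Num.min (2^-1 : R) 1)^-1 = 2.
  by rewrite min_l ?invrK //; lra.
have nz : evA b != 0.
  by rewrite twist_eq0 -modc_gt0; apply: lt_le_trans (Re_le_modc _); exact: lt_le_trans (bd _).
suff h : evB (H b) / evA b - 1 = 0.
  by move/eqP: h; rewrite subr_eq0 => /eqP e; rewrite -[LHS](divfK nz) e mul1r.
apply/eqP; rewrite -modc_eq0 eq_le modc_ge0 andbT.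
(* From [m = 6] on, a step has radius at most [2/30 * 2^-m = 2^-m / 15], which is below [400^-1] as
   [small_quotient] demands. *)
apply: (@le_geometric _ _ 2 6) => m hm.
pose n := (2 ^ m)%N; pose p : R := 2^-1 ^+ m.
have n64 : (64 <= n)%N by rewrite (leq_pexp2l (m := 2) (n1 := 6)).
have nE : n%:R^-1 = p by rewrite /n natrX /p exprVn.
have n0 : 0 < n%:R :> R by rewrite ltr0n; lia.
have p0 : 0 < p by rewrite -nE invr_gt0.
have pn : p * n%:R = 1 by rewrite -nE mulVf // gt_eqF.
have p64 : p <= 64^-1 by rewrite -nE lef_pV2 ?posrE // ler_nat.
pose a (k : nat) : A := 1 + (k%:R / n%:R)%:C%C *: (b - 1).
suff key k : (k <= n)%N -> unit_component (a k) /\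
    exists2 d, evB (H (a k)) = evA (a k) * (1 + d) & modc d <= 2 * k%:R * p ^+ 2.
  have [_ [d]] := key n (leqnn n).
  have -> : a n = b by rewrite /a divff ?gt_eqF // rmorph1 scale1r addrC subrK.
  move=> -> h; rewrite mulrAC divff // mul1r addrC addKr; apply: le_trans h _.
  have -> : 2 * n%:R * p ^+ 2 = 2 * p * (p * n%:R) by ring.
  by rewrite pn mulr1.
elim: k => [_|k IH kn].
  rewrite /a mul0r rmorph0 scale0r addr0; split; first exact: unit_component1.
  exists 0; last by rewrite modc0 mulr0 mul0r.
  by rewrite (normalize1 Tu) !gelfand1 twist1 addr0 mulr1.
have [Gk [d dE hd]] := IH (ltnW kn).
have [_ _] := path_step d0 bd kn; rewrite -/(a k) -/(a k.+1).
set w := n%:R^-1%:C%C *: _; rewrite m2 nE => aE hw.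
have hw' : rA w <= 15^-1 * p.
  by apply: le_trans hw _; rewrite ler_wpM2r ?(ltW p0) //; lra.
have hq : 15^-1 * p <= 400^-1 by lra.
have nw : near_one (1 + w) by apply: near_one_radius; lra.
have Gw := near_one_component nw.
have [d' [dE' hd']] := small_quotient hw' hq.
rewrite aE; split; first exact: unit_component_mul.
exists (d + d' + d * d').
  by rewrite HM // gelfandM [gelfand (a k * _) _]gelfandM twistM dE dE'; ring.
apply: le_trans (modcD _ _) _; apply: le_trans (lerD (modcD _ _) (lexx _)) _.
have p2 : 0 <= p ^+ 2 by exact: sqr_ge0.
have hd2 : modc d' <= 2^-1 * p ^+ 2.
  by apply: le_trans hd' _; rewrite exprMn; lra.
have d1 : modc d <= 1.
  apply: le_trans hd _; apply: le_trans (_ : 2 * n%:R * p ^+ 2 <= _).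
    by rewrite ler_wpM2r // ler_wpM2l // ler_nat ltnW.
  have -> : 2 * n%:R * p ^+ 2 = 2 * p * (p * n%:R) by ring.
  by rewrite pn; lra.
have : modc (d * d') <= modc d'.
  by rewrite modcM ler_piMl ?modc_ge0.
rewrite -[k.+1]addn1 natrD; lra.
Qed.

Lemma component_eval g : unit_component g -> evB (H g) = evA g.
Proof.
elim=> [|h a Gh IH na]; first by rewrite (normalize1 Tu) !gelfand1 twist1.
rewrite HM //; last exact: near_one_component.
by rewrite gelfandM [gelfand (h * a) _]gelfandM twistM IH near_one_eval.
Qed.

(** The comparison element is [c = (f(x) / 2) b] with [b = 1 - u]. Where [b] is large, [f / c - 1]
    is close to [-1], so [rdist f c] cannot be expected below 1; the factor one half gives
    [f / c - 1] the value 1 at [x], the largest that this bound tolerates. Since [H c] is known at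
    [y], preservation of [rdist] yields the disc. *)
Lemma half_disc f : f \is a GRing.unit ->
  modc (evB (H f) - evA f / 2) <= modc (evA f) / 2.
Proof.
move=> fu; set f0 := gelfand f (\val x).
have f00 : f0 != 0 by exact: gelfand_unit.
have nz2 : (2 : R[i]) != 0 by rewrite pnatr_eq0.
have f2 : modc (evA f / 2) = modc (evA f) / 2 by rewrite modcM modcV modc2.
rewrite -subr_le0; apply: (@le_geometric _ _ (modc (evA f) / 2) 0) => n _.
rewrite lerBlDr; set e : R := 2^-1 ^+ n.
have e0 : 0 < e by rewrite exprn_gt0 // invr_gt0.
have e1 : e <= 1 by rewrite exprn_ile1 //; lra.
pose k := f0^-1 *: f; have kx : gelfand k (\val x) = 1 by rewrite gelfandZ mulVf.
have e32 : 0 < e / 32 by rewrite divr_gt0.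
have [u ux hu] := peak x k (32 / e + 1 + e^-1) e32.
pose b := 1 - u.
have hb z : 1 - e / 32 + (32 / e + 1 + e^-1) * modc (gelfand k z - 1) ^+ 2 <= complex.Re (gelfand b z).
  by have := hu z; rewrite kx /b gelfandB gelfand1 raddfB /=; lra.
have C0 : 0 <= 32 / e + 1 + e^-1 by rewrite !addr_ge0 ?divr_ge0 ?invr_ge0 // ltW.
have hb2 z : 2^-1 <= complex.Re (gelfand b z).
  have := hb z; have := mulr_ge0 C0 (sqr_ge0 (modc (gelfand k z - 1))); lra.
have Gb : unit_component b by apply: unit_component_path hb2; rewrite invr_gt0.
pose c := (f0 / 2)%:A * b.
have f2nz : f0 / 2 != 0 by rewrite mulf_neq0 ?invr_eq0.
have Gc : unit_component c by apply: unit_component_mul => //; exact: unit_component_scalar.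
have cu := unit_component_unit Gc.
have cx : evA c = evA f / 2.
  rewrite /c gelfandM gelfand_scalar /b gelfandB gelfand1 ux subr0 mulr1 twistM twistV.
  by congr (_ / _); case: (s) => //=; rewrite rmorph_nat.
have rfc : rdist f c <= 1 + e.
  apply: radius_le => z; rewrite gelfandB gelfand1 gelfandM gelfandV //.
  have bz : gelfand b z != 0 by apply: gelfand_unit; exact: unit_component_unit.
  have cz : gelfand c z = f0 / 2 * gelfand b z by rewrite gelfandM gelfand_scalar.
  have fz : gelfand f z = f0 * gelfand k z by rewrite gelfandZ mulrA divff ?mul1r.
  have -> : gelfand f z / gelfand c z - 1 = (2 * gelfand k z - gelfand b z) / gelfand b z.
    by rewrite cz fz; field; rewrite bz f00.
  rewrite modcM modcV ler_pdivrMr ?modc_gt0 //; exact: peak_disc.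
rewrite -H_rdist // in rfc; have := le_trans (gelfand_le _ (\val y)) rfc.
have Hcu : H c \is a GRing.unit by exact: (normalize_unit Tu).
rewrite gelfandB gelfand1 gelfandM gelfandV // (component_eval Gc) cx.
have nz : evA f / 2 != 0 by rewrite mulf_neq0 ?invr_eq0 ?twist_eq0.
have -> : evB (H f) / (evA f / 2) - 1 = (evB (H f) - evA f / 2) / (evA f / 2).
  by rewrite mulrBl divff.
rewrite modcM modcV ler_pdivrMr ?modc_gt0 // f2; lra.
Qed.

Variable alpha : R[i].
Hypothesis alpha0 : alpha != 0.
Hypothesis T_alpha : forall f, f \is a GRing.unit -> T f * T (alpha *: f^-1) = alpha%:A.

Lemma unit_eval f : f \is a GRing.unit -> evB (H f) = evA f.
Proof.
move=> fu; apply: half_discs; first exact: half_disc.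
have fiu : alpha *: f^-1 \is a GRing.unit.
  by rewrite -mulr_algl unitrM unitrV fu scalar_unit.
have Hfu := normalize_unit Tu fu.
have F0 : evB (H f) != 0 by exact: gelfand_unit.
have f0 : evA f != 0 by rewrite twist_eq0; exact: gelfand_unit.
have HH : H f * H (alpha *: f^-1) = H alpha%:A.
  have := T_alpha (unitr1 A); rewrite invr1 => h.
  by rewrite /normalize mulrACA T_alpha // -h; rewrite mulrACA divrr ?mul1r ?(T1u Tu).
have F1 : evB (H (alpha *: f^-1)) = twist s alpha / evB (H f).
  apply: (mulfI F0); rewrite -gelfandM HH component_eval ?gelfand_scalar.
    by rewrite mulrC divfK.
  exact: unit_component_scalar.
have f1 : evA (alpha *: f^-1) = twist s alpha / evA f.
  by rewrite gelfandZ gelfandV // twistM twistV.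
have a0 : twist s alpha != 0 by rewrite twist_eq0.
have nz2 : (2 : R[i]) != 0 by rewrite pnatr_eq0.
have := half_disc fiu; rewrite F1 f1.
set F := evB (H f) in F0 *; set g := evA f in f0 *; set a := twist s alpha in a0 *.
(* The disc for [alpha / f], rescaled by [a / (F g)], is the second hypothesis of [half_discs]. *)
have -> : a / F - a / g / 2 = a / (F * g) * (g - F / 2) by field; rewrite F0 f0.
have -> : modc (a / g) / 2 = modc (a / (F * g)) * (modc F / 2).
  by rewrite mulrA -modcM; congr (modc _ / 2); field; rewrite F0 f0.
by rewrite modcM ler_pM2l // modc_gt0 mulf_neq0 ?invr_eq0 ?mulf_neq0.
Qed.

End Derivative.

Variable alpha : R[i].
Hypothesis alpha0 : alpha != 0.
Hypothesis T_alpha : forall f, f \is a GRing.unit -> T f * T (alpha *: f^-1) = alpha%:A.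

Theorem point_evaluation (y : Ch B) : exists (x : Ch A) (s : bool),
  forall f, f \is a GRing.unit ->
    gelfand (T f) (\val y) = gelfand (T 1) (\val y) * twist s (gelfand f (\val x)).
Proof.
have [S S_approx] := derivative_exists ssB Tu T'u TK T'K T_rdist.
have [x [s Sy]] := derivative_point S_approx y; exists x, s => f fu.
rewrite -(unit_eval S_approx Sy alpha0 T_alpha fu) -gelfandM.
by rewrite /normalize mulrC divrK // (T1u Tu).
Qed.

End PointEvaluation.

(** * Extension from the units to [cl A] *)

Section Transport.
Variables (R : realType) (A B : comBanachAlgType R).
Variables (v : B) (phi : Ch B -> Ch A) (s : Ch B -> bool).

(** A relation because the formula prescribes [g] on the boundary only; membership in [cl B] then
    determines [g] everywhere. *)
Definition transported f g := cl B g /\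
  forall y : Ch B, g (\val y) = gelfand v (\val y) * twist (s y) (f (\val (phi y))).

Lemma transported_uniq f g h : transported f g -> transported f h -> g = h.
Proof. by move=> [cg eg] [ch eh]; apply: cl_eq => // y; rewrite eg eh. Qed.

(** Transport is isometric up to the factor [r v], and the boundary is norming, so lifts of elements
    approximating [f] converge uniformly on the whole of the maximal ideal space. *)
Lemma transported_exists f :
  (forall a : A, exists b : B, transported (gelfand a) (gelfand b)) -> cl A f ->
  exists g, transported f g.
Proof.
move=> lift cf; set M := spectral_radius v.
have M0 : 0 <= M by exact: radius_ge0.
have p0 n : 0 < (2^-1 : R) ^+ n by rewrite exprn_gt0 // invr_gt0.
have /choice[a ha] : forall n : nat, exists a, forall x, modc (f x - gelfand a x) < 2^-1 ^+ n.
  by move=> n; exact: cl_approx.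
have /choice[b hb] : forall n : nat, exists b : B, transported (gelfand (a n)) (gelfand b).
  by move=> n; exact: lift.
have step n x : modc (gelfand (b n) x - gelfand (b n.+1) x) <= 2 * M * 2^-1 ^+ n.
  rewrite -gelfandB; apply: le_trans (gelfand_le _ _) _; apply: gelfand_boundary => y.
  rewrite gelfandB !(proj2 (hb _)) -mulrBr -twistB modcM modc_twist.
  rewrite [2 * M]mulrC -mulrA ler_pM ?modc_ge0 ?gelfand_le //.
  set z := f (\val (phi y)); have h1 := ha n (\val (phi y)); have h2 := ha n.+1 (\val (phi y)).
  have := modcD (z - gelfand (a n.+1) (\val (phi y))) (- (z - gelfand (a n) (\val (phi y)))).
  rewrite modcN opprB addrC addrA subrK; move: h1 h2; rewrite -/z exprS; have := p0 n; lra.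
have K0 : 0 <= 2 * M by rewrite mulr_ge0.
have /choice[g hg] : forall x, exists l, forall n, (0 <= n)%N ->
    modc (gelfand (b n) x - l) <= 4 * (2 * M) * 2^-1 ^+ n.
  by move=> x; apply: complex_geometric_limit => // n _; exact: step.
exists g; split=> [|y].
  apply: cl_limit (fun n => cl_gelfand (b n)) _ => e e0.
  have K1 : 0 < 4 * (2 * M) + 1 by rewrite ltr_wpDl // mulr_ge0.
  have [|n /(_ n (leqnn n)) hn] := exp_half_lt (e := e / (4 * (2 * M) + 1)).
    by rewrite divr_gt0.
  exists n => x; rewrite modcB; apply: le_lt_trans (hg x n isT) _.
  rewrite ltr_pdivlMr // in hn; apply: le_lt_trans hn.
  by rewrite mulrC ler_wpM2l ?lerDl // ltW.
apply/eqP; rewrite -subr_eq0 -modc_eq0 eq_le modc_ge0 andbT.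
apply: (@le_geometric _ _ (9 * M) 0) => n _.
have h1 := hg (\val y) n isT; have h2 := ha n (\val (phi y)).
have h3 : modc (gelfand (b n) (\val y) - gelfand v (\val y) * twist (s y) (f (\val (phi y))))
    <= M * 2^-1 ^+ n.
  rewrite (proj2 (hb _)) -mulrBr -twistB modcM modc_twist modcB.
  by rewrite ler_pM ?modc_ge0 ?gelfand_le // ltW.
have := modcD (- (gelfand (b n) (\val y) - g (\val y)))
  (gelfand (b n) (\val y) - gelfand v (\val y) * twist (s y) (f (\val (phi y)))).
rewrite modcN opprB addrA subrK; lra.
Qed.

(** On the boundary [g g' = v^2], so the inverse of [g] is [g' / v^2]. *)
Lemma transported_invertible f f' g g' : v \is a GRing.unit ->
  transported f g -> transported f' g' -> f \* f' = cst 1 ->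
  fun_invertibles (cl B) g.
Proof.
move=> vu [cg eg] [cg' eg'] ff; split=> //.
exists (gelfand (v ^- 2) \* g'); first by apply: cl_M => //; exact: cl_gelfand.
apply: cl_eq => [||y]; [|exact: cl_cst|].
  by apply: cl_M => //; apply: cl_M => //; exact: cl_gelfand.
have := congr1 (fun h => twist (s y) (h (\val (phi y)))) ff; rewrite /= twistM twist1 => e.
rewrite eg eg' gelfandV ?unitrX // gelfandX -[RHS]e.
have := gelfand_unit (\val y) vu; set t := gelfand v _ => t0.
by field.
Qed.

End Transport.

(** The shift is real so that conjugation leaves it unchanged; it reduces statements on arbitrary
    elements to units. *)
Lemma unit_shift (R : realType) (A : comBanachAlgType R) (a : A) :
  exists2 c : R, c != 0 & a + c%:C%C%:A \is a GRing.unit.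
Proof.
have r0 := radius_ge0 a; exists (spectral_radius a + 1); first by rewrite gt_eqF // ltr_wpDl.
apply: unit_char => x; rewrite gelfandD gelfand_scalar -modc_gt0.
have := modcNB (spectral_radius a + 1)%:C%C (- gelfand a x).
rewrite modcN opprK modcR ger0_norm ?addr_ge0 // [_ + gelfand a x]addrC.
have := gelfand_le a x; lra.
Qed.

(** * The boundary maps of [T] and of its inverse are mutually inverse *)

Section Composition.
Variables (R : realType) (A B : comBanachAlgType R).
Variables (T : A -> B) (T' : B -> A).
Hypothesis T'u : forall g, g \is a GRing.unit -> T' g \is a GRing.unit.
Hypothesis T'K : forall g, g \is a GRing.unit -> T (T' g) = g.
Variables (phi : Ch B -> Ch A) (s : Ch B -> bool) (psi : Ch A -> Ch B) (s' : Ch A -> bool).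
Hypothesis TE : forall (y : Ch B) f, f \is a GRing.unit ->
  gelfand (T f) (\val y) = gelfand (T 1) (\val y) * twist (s y) (gelfand f (\val (phi y))).
Hypothesis T'E : forall (x : Ch A) g, g \is a GRing.unit ->
  gelfand (T' g) (\val x) = gelfand (T' 1) (\val x) * twist (s' x) (gelfand g (\val (psi x))).

(** This is [T (T' z) = z] for scalars [z]; it isolates the twists and factors from the boundary
    points. *)
Lemma composed_scalar (y : Ch B) z :
  gelfand (T 1) (\val y) * twist (s y) (gelfand (T' 1) (\val (phi y)) * twist (s' (phi y)) z) = z.
Proof.
have [->|z0] := eqVneq z 0.
  by rewrite twist0 mulr0 twist0 mulr0.
have zu : z%:A \is a (@GRing.unit B) by exact: scalar_unit.
have := TE y (T'u zu); rewrite T'K // T'E // !gelfand_scalar => /esym; exact.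
Qed.

Lemma composed_unit (y : Ch B) g : g \is a GRing.unit ->
  gelfand g (\val y) = gelfand g (\val (psi (phi y))).
Proof.
by move=> gu; rewrite -[RHS](composed_scalar y) -T'E // -TE ?T'u // T'K.
Qed.

Lemma composed_point (y : Ch B) : psi (phi y) = y.
Proof.
apply: val_inj; apply: contrapT => /char_sep[b [b1 b0]].
have [c c0 cu] := unit_shift b.
have := composed_unit y cu.
rewrite !gelfandD b0 b1 !gelfand_scalar => /addIr/eqP.
by rewrite eq_sym oner_eq0.
Qed.

Lemma lift_gelfand (a : A) : exists b : B,
  transported (T 1) phi s (gelfand a) (gelfand b).
Proof.
have [c c0 cu] := unit_shift a.
exists (T (a + c%:C%C%:A) - c%:C%C *: T 1); split; first exact: cl_gelfand.
move=> y; rewrite gelfandB TE // gelfandZ gelfandD gelfand_scalar twistD mulrDr.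
have -> : twist (s y) c%:C%C = c%:C%C by case: (s y) => //=; rewrite conjE /= oppr0.
by rewrite [c%:C%C * _]mulrC addrK.
Qed.

End Composition.

(** * From the spectral hypothesis to an isometry of the units *)

Section Preserver.
Variables (R : realType) (A B : comBanachAlgType R) (T : A -> B) (alpha : R[i]).
Hypothesis A_semisimple : semisimple A.
Hypothesis T_onto : T @` invertibles A = invertibles B.
Hypothesis alpha0 : alpha != 0.
Hypothesis T_radius : forall f g, invertibles A f -> invertibles A g ->
  spectral_radius (T f * T g - alpha%:A) = spectral_radius (f * g - alpha%:A).

Lemma preserver_unit f : f \is a GRing.unit -> T f \is a GRing.unit.
Proof. by move=> fu; have : invertibles B (T f) by [rewrite -T_onto; exists f]. Qed.

Lemma preserver_onto g : g \is a GRing.unit -> exists2 f, f \is a GRing.unit & T f = g.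
Proof. by move=> gu; have : invertibles B g by []; rewrite -T_onto. Qed.

Lemma scaleV_unit (C : comBanachAlgType R) (f : C) : f \is a GRing.unit -> alpha *: f^-1 \is a GRing.unit.
Proof. by move=> fu; rewrite -mulr_algl unitrM unitrV fu scalar_unit. Qed.

Lemma mul_scaleV (C : comBanachAlgType R) (f : C) : f \is a GRing.unit -> f * (alpha *: f^-1) = alpha%:A.
Proof. by move=> fu; rewrite -scalerAr divrr. Qed.

(** Only transforms of images are compared, as [B] is not yet known to be semisimple. With
    [g = alpha / f], the radius of [T f' * T g - alpha] is that of [T f * T g - alpha], which is 0;
    hence [f' * g = alpha]. *)
Lemma preserver_gelfand f f' : f \is a GRing.unit -> f' \is a GRing.unit ->
  (forall x, gelfand (T f) x = gelfand (T f') x) -> f = f'.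
Proof.
move=> fu f'u e; have gu := scaleV_unit fu; apply: (mulIr gu); rewrite mul_scaleV //.
apply/esym/eqP; rewrite -subr_eq0; apply/eqP/(radius_eq0 A_semisimple).
rewrite -T_radius //; have := T_radius fu gu.
rewrite mul_scaleV // subrr spectral_radius0 => e0.
apply/eqP; rewrite eq_le radius_ge0 andbT; apply: radius_le => x.
rewrite gelfandB gelfandM -e -gelfandM -gelfandB -e0; exact: gelfand_le.
Qed.

Lemma preserver_inj f f' : f \is a GRing.unit -> f' \is a GRing.unit -> T f = T f' -> f = f'.
Proof. by move=> fu f'u e; apply: preserver_gelfand => // x; rewrite e. Qed.

Lemma preserver_semisimple : semisimple B.
Proof.
apply/semisimpleP => b b0.
have bu : 1 + b \is a GRing.unit.
  by apply: unit_char => x; rewrite gelfandD gelfand1 b0 addr0 oner_eq0.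
have [f fu Tf] := preserver_onto (unitr1 B); have [f' f'u Tf'] := preserver_onto bu.
have e : f = f'.
  by apply: preserver_gelfand => // x; rewrite Tf Tf' gelfandD b0 addr0.
by have := congr1 T e; rewrite Tf Tf' => /esym/eqP; rewrite addrC -subr_eq0 addrK => /eqP.
Qed.

Lemma preserver_alpha f : f \is a GRing.unit -> T f * T (alpha *: f^-1) = alpha%:A.
Proof.
move=> fu; apply/eqP; rewrite -subr_eq0; apply/eqP/(radius_eq0 preserver_semisimple).
by rewrite T_radius ?mul_scaleV ?subrr ?spectral_radius0 //; exact: scaleV_unit.
Qed.

Lemma preserver_rdist f h : f \is a GRing.unit -> h \is a GRing.unit ->
  rdist (T f) (T h) = rdist f h.
Proof.
move=> fu hu; have hu' := scaleV_unit hu; have Thu := preserver_unit hu.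
have eT : T f / T h = alpha^-1 *: (T f * T (alpha *: h^-1)).
  apply: (mulIr Thu); rewrite divrK // -scalerAl -mulrA [_ * T h]mulrC preserver_alpha //.
  by rewrite -scalerAr mulr1 scalerA mulVf // scale1r.
have eA : f / h = alpha^-1 *: (f * (alpha *: h^-1)).
  by rewrite -scalerAr scalerA mulVf // scale1r.
have e1 (C : comBanachAlgType R) : 1 = alpha^-1 *: alpha%:A :> C.
  by rewrite scalerA mulVf // scale1r.
by rewrite /rdist eT eA {1}(e1 B) {1}(e1 A) -!scalerBr !radiusZ T_radius.
Qed.

Lemma preserver_inverse : exists T' : B -> A,
  [/\ forall g, g \is a GRing.unit -> T' g \is a GRing.unit,
      forall f, f \is a GRing.unit -> T' (T f) = f
    & forall g, g \is a GRing.unit -> T (T' g) = g].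
Proof.
have /choice[T' hT'] : forall g, exists f, g \is a GRing.unit -> f \is a GRing.unit /\ T f = g.
  move=> g; have [gu|] := boolP (g \is a GRing.unit); last by exists 1.
  by have [f fu Tf] := preserver_onto gu; exists f.
exists T'; split=> [g /hT'[]//|f fu|g /hT'[]//].
have [T'u TT'] := hT' _ (preserver_unit fu).
exact: preserver_inj.
Qed.

Lemma preserver_Ch : exists (phi : Ch B -> Ch A) (s : Ch B -> bool) (T' : B -> A)
    (psi : Ch A -> Ch B) (s' : Ch A -> bool),
  [/\ forall g, g \is a GRing.unit -> T' g \is a GRing.unit,
      forall f, f \is a GRing.unit -> T' (T f) = f,
      forall g, g \is a GRing.unit -> T (T' g) = g,
      forall (y : Ch B) f, f \is a GRing.unit -> gelfand (T f) (\val y) =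
        gelfand (T 1) (\val y) * twist (s y) (gelfand f (\val (phi y)))
    & forall (x : Ch A) g, g \is a GRing.unit -> gelfand (T' g) (\val x) =
        gelfand (T' 1) (\val x) * twist (s' x) (gelfand g (\val (psi x)))].
Proof.
have [T' [T'u TK T'K]] := preserver_inverse.
have T'_rdist g h : g \is a GRing.unit -> h \is a GRing.unit -> rdist (T' g) (T' h) = rdist g h.
  by move=> gu hu; rewrite -preserver_rdist ?T'u // !T'K.
have T'_alpha g : g \is a GRing.unit -> T' g * T' (alpha *: g^-1) = alpha%:A.
  move=> gu; have T'gu := T'u _ gu.
  have -> : alpha *: g^-1 = T (alpha *: (T' g)^-1).
    apply: (mulrI gu); rewrite mul_scaleV // -{1}(T'K _ gu) preserver_alpha //.
  by rewrite TK ?mul_scaleV //; exact: scaleV_unit.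
have /choice[p hp] : forall y : Ch B, exists q : Ch A * bool, forall f, f \is a GRing.unit ->
    gelfand (T f) (\val y) = gelfand (T 1) (\val y) * twist q.2 (gelfand f (\val q.1)).
  move=> y; have [x [s h]] := point_evaluation preserver_semisimple preserver_unit T'u TK T'K
    preserver_rdist alpha0 preserver_alpha y.
  by exists (x, s).
have /choice[p' hp'] : forall x : Ch A, exists q : Ch B * bool, forall g, g \is a GRing.unit ->
    gelfand (T' g) (\val x) = gelfand (T' 1) (\val x) * twist q.2 (gelfand g (\val q.1)).
  move=> x; have [y [s h]] := point_evaluation A_semisimple T'u preserver_unit T'K TK
    T'_rdist alpha0 T'_alpha x.
  by exists (y, s).
by exists (fst \o p), (snd \o p), T', (fst \o p'), (snd \o p').
Qed.

End Preserver.

(** * The clopen set, continuity of the boundary map, and [eta] *)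

Section Representation.
Variables (R : realType) (A B : comBanachAlgType R) (T : A -> B).
Hypothesis Tu : forall f, f \is a GRing.unit -> T f \is a GRing.unit.
Variables (phi : Ch B -> Ch A) (s : Ch B -> bool).
Hypothesis TE : forall (y : Ch B) f, f \is a GRing.unit ->
  gelfand (T f) (\val y) = gelfand (T 1) (\val y) * twist (s y) (gelfand f (\val (phi y))).

Let T1u : T 1 \is a GRing.unit := Tu (unitr1 A).

Lemma normalized_representation (y : Ch B) f : f \is a GRing.unit ->
  gelfand (T f / T 1) (\val y) = twist (s y) (gelfand f (\val (phi y))).
Proof.
by move=> fu; rewrite gelfandM gelfandV // TE // mulrAC divff ?mul1r // gelfand_unit.
Qed.

(** [T 'i / T 1] takes the value ['i] where [s] holds and [- 'i] elsewhere. *)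
Lemma sign_idempotent : exists e : B, forall y : Ch B, gelfand e (\val y) = (s y)%:R.
Proof.
have i0 : 'i%C != 0 :> R[i] by rewrite -modc_eq0 modc_i oner_eq0.
have iu : 'i%C%:A \is a (@GRing.unit A) by exact: scalar_unit.
exists (2^-1 *: (1 - 'i%C *: (T 'i%C%:A / T 1))) => y.
rewrite gelfandZ gelfandB gelfand1 gelfandZ normalized_representation // gelfand_scalar.
have ii : 'i%C * 'i%C = -1 :> R[i] by rewrite -expr2 sqr_i.
case: (s y) => /=; first by rewrite ii opprK -[1 + 1]/(2%:R) mulVf // pnatr_eq0.
have -> : ('i%C : R[i])^* = - 'i%C by rewrite conjE; simpc.
by rewrite mulrN ii opprK subrr mulr0.
Qed.

Definition linear_part : set (Ch B) := [set y | s y].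

Lemma linear_part_mem y : (y \in linear_part) = s y.
Proof. by apply/idP/idP; rewrite inE. Qed.

Lemma linear_part_clopen : clopen linear_part.
Proof.
have [e he] := sign_idempotent.
have ce : continuous (fun y : Ch B => gelfand e (\val y) : R[i]^o).
  by apply: Ch_val_continuous; exact: gelfand_continuous.
have cl1 (z : R[i]^o) : closed [set z].
  by apply: accessible_closed_set1; apply: hausdorff_accessible; exact: norm_hausdorff.
have /continuousP/(_ (~` [set 0])) o := ce; have /continuous_closedP/(_ [set 1]) c := ce.
split.
  have -> : linear_part = (fun y : Ch B => gelfand e (\val y) : R[i]^o) @^-1` (~` [set 0]).
    apply/funext => y; rewrite /linear_part /= he; apply/propext.
    by case: (s y) => /=; split => // _; exact/eqP/oner_neq0.
  by apply: o; apply: closed_openC.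
have -> : linear_part = (fun y : Ch B => gelfand e (\val y) : R[i]^o) @^-1` [set 1].
  apply/funext => y; rewrite /linear_part /= he; apply/propext.
  by case: (s y) => /=; split => // /esym/eqP; rewrite oner_eq0.
exact: c.
Qed.

(** The sign is locally constant, so continuity of [T (a + c) / T 1] passes to the transform of [a]
    composed with [phi]. *)
Lemma representation_continuous : continuous phi.
Proof.
apply: continuous_Ch => a y; have FF : Filter (nbhs (y : Ch B)) by exact: nbhs_filter.
apply/cvgrPdist_lt => d d0; have [c _ cu] := unit_shift a.
have near_s : \forall z \near y, s z = s y.
  have [oK cK] := linear_part_clopen; have [sy|sy] := boolP (s y).
    by have := open_nbhs_nbhs (conj oK sy); apply: filterS => z; rewrite /linear_part /= => ->.
  have oC : open (~` linear_part) by exact: closed_openC.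
  have := open_nbhs_nbhs (conj oC (negP sy)).
  by apply: filterS => z; rewrite /linear_part /= => /negP/negbTE.
have cq : continuous (fun z : Ch B => gelfand (T (a + c%:C%C%:A) / T 1) (\val z) : R[i]^o).
  by apply: Ch_val_continuous; exact: gelfand_continuous.
have /cvgrPdist_lt/(_ d d0) near_q := cq y.
apply: filterS2 near_s near_q => z sz.
rewrite !normalized_representation // sz -twistB -!modcE modc_twist.
by rewrite !gelfandD opprD addrACA !gelfand_scalar subrr addr0.
Qed.

Variable alpha : R[i].
Hypothesis alpha0 : alpha != 0.
Hypothesis T_alpha : forall f, f \is a GRing.unit -> T f * T (alpha *: f^-1) = alpha%:A.

Lemma sqr_alpha (y : Ch B) : gelfand (T 1) (\val y) ^+ 2 * twist (s y) alpha = alpha.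
Proof.
have := T_alpha (unitr1 A); rewrite invr1 => /(congr1 (fun b => gelfand b (\val y))).
have au : alpha%:A \is a (@GRing.unit A) by exact: scalar_unit.
by rewrite gelfandM (TE y au) !gelfand_scalar mulrA -expr2.
Qed.

Lemma modc_T1 (y : Ch B) : modc (gelfand (T 1) (\val y)) = 1.
Proof.
have /(congr1 (@modc R)) := sqr_alpha y; rewrite modcM modc_twist modcX.
have a0 : modc alpha != 0 by rewrite modc_eq0.
move=> /(congr1 (fun t => t / modc alpha)); rewrite mulfK // divff // => /eqP.
by rewrite pexpr_eq1 ?modc_ge0 // => /eqP.
Qed.

(** By [sqr_alpha], [T 1] squares to 1 where [s] holds and to [(alpha / |alpha|)^2] elsewhere. The
    idempotent [e] allows division by [alpha / |alpha|] on the second part only. *)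
Lemma eta_exists : semisimple B -> exists2 eta : B, eta ^+ 2 = 1 &
  forall y : Ch B, gelfand (T 1) (\val y) = gelfand eta (\val y) *
    (if s y then 1 else alpha / `|alpha|).
Proof.
move=> ssB; have [e he] := sign_idempotent.
have n0 : `|alpha| != 0 by rewrite normr_eq0.
have aa : alpha * alpha^* = `|alpha| * `|alpha| by rewrite -expr2 normCK.
have ac : alpha^* != 0 by rewrite conjC_eq0.
exists (T 1 * (e + (alpha^* / `|alpha|) *: (1 - e))).
  apply: gelfand_inj => // x; rewrite gelfand1.
  suff : gelfand ((T 1 * (e + (alpha^* / `|alpha|) *: (1 - e))) ^+ 2) = cst 1.
    by move=> ->.
  apply: cl_eq => [||y]; [exact: cl_gelfand|exact: cl_cst|].
  rewrite -[RHS]/1; have := sqr_alpha y; rewrite gelfandX gelfandM gelfandD gelfandZ gelfandB gelfand1 he.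
  set t := gelfand _ _; case: (s y) => /= h.
    rewrite subrr mulr0 addr0 mulr1; apply: (mulIf alpha0); rewrite h mul1r //.
  rewrite add0r subr0 mulr1 exprMn expr_div_n.
  have -> : t ^+ 2 = alpha / alpha^* by apply: (mulIf ac); rewrite divfK.
  rewrite [`|alpha| ^+ 2]expr2 -aa expr2; field; by rewrite alpha0 ac.
move=> y; rewrite gelfandM gelfandD gelfandZ gelfandB gelfand1 he.
case: (s y) => /=; first by rewrite subrr mulr0 addr0 !mulr1.
rewrite add0r subr0 mulr1 -mulrA mulrACA [alpha^* * _]mulrC aa.
by rewrite -invfM divff ?mulr1 // mulf_neq0.
Qed.

End Representation.

Theorem corollary5p18 (R : realType) (A B : comBanachAlgType R)
    (T : A -> B) (alpha : R[i])
    (A_semisimple : semisimple A)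
    (T_onto : T @` invertibles A = invertibles B)
    (alpha_neq0 : alpha != 0)
    (T_radius : forall f g, invertibles A f -> invertibles A g ->
       spectral_radius (T f * T g - alpha%:A)
       = spectral_radius (f * g - alpha%:A)) :
  semisimple B /\
  exists (TE : (max_ideal_space A -> R[i]) -> (max_ideal_space B -> R[i]))
         (eta : B) (phi : Ch B -> Ch A) (K : set (Ch B)),
    (* TE is an extension of T from cl A onto cl B, with TE A = B *)
    (forall f, invertibles A f -> TE (gelfand f) = gelfand (T f)) /\
    TE @` cl A = cl B /\
    TE @` range gelfand = range gelfand /\
    (* eta, phi and K *)
    invertibles B eta /\ eta ^+ 2 = 1 /\
    homeomorphism phi /\
    clopen K /\
    (* the representation of TE *)
    (forall f, cl A f -> forall y : Ch B,
       TE f (\val y) = gelfand eta (\val y) *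
         (if y \in K then f (\val (phi y))
          else alpha / `|alpha| * (f (\val (phi y)))^*)) /\
    (T 1 = 1 -> forall f, cl A f -> forall y : Ch B,
       TE f (\val y) =
         (if y \in K then f (\val (phi y)) else (f (\val (phi y)))^*)) /\
    (* norm equality and invertible elements *)
    (forall f g, cl A f -> cl A g ->
       sup_norm (fun y => TE f y * TE g y - alpha)
       = sup_norm (fun x => f x * g x - alpha)) /\
    TE @` fun_invertibles (cl A) = fun_invertibles (cl B) /\
    (* the complex-linear case *)
    (T 1 = 1 ->
     alpha \isn't Num.real \/
       (exists2 lambda : R[i], lambda \isn't Num.real
          & T lambda%:A = lambda%:A) ->
     (forall f, cl A f -> forall y : Ch B,
        TE f (\val y) = f (\val (phi y))) /\
     complex_algebra_isomorphism (cl A) (cl B) TE /\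
     TE @` range gelfand = range gelfand).
Proof.
have ssB := preserver_semisimple A_semisimple T_onto alpha_neq0 T_radius.
split=> //.
have Tu := preserver_unit T_onto.
have Talpha := preserver_alpha A_semisimple T_onto alpha_neq0 T_radius.
have [phi [s [T' [psi [s' [T'u TK T'K TE T'E]]]]]] :=
  preserver_Ch A_semisimple T_onto alpha_neq0 T_radius.
have phiK : cancel phi psi by move=> y; exact: (composed_point T'u T'K TE T'E).
have psiK : cancel psi phi by move=> x; exact: (composed_point Tu TK T'E TE).
have [eta eta2 T1E] := eta_exists Tu TE alpha_neq0 Talpha ssB.
have lift := lift_gelfand TE; have lift' := lift_gelfand T'E.
have /choice[E hE] : forall f, exists g, cl A f -> transported (T 1) phi s f g.
  (* The value [cst 0] outside [cl A] is arbitrary. *)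
  move=> f; have [cf|] := pselect (cl A f); last by exists (cst 0).
  by have [g hg] := transported_exists lift cf; exists g.
have E_uniq f g : cl A f -> transported (T 1) phi s f g -> E f = g.
  by move=> cf; apply: transported_uniq; exact: hE.
have E_gelfand f : f \is a GRing.unit -> E (gelfand f) = gelfand (T f).
  move=> fu; apply: E_uniq; first exact: cl_gelfand.
  by split; [exact: cl_gelfand|move=> y; exact: TE].
have E_inv f g : transported (T' 1) psi s' g f -> cl A f -> cl B g -> E f = g.
  move=> [_ fE] cf cg; apply: E_uniq => //; split=> // y.
  by rewrite fE -[in LHS](phiK y) -[LHS](composed_scalar T'u T'K TE T'E y) phiK.
have E_range : E @` range gelfand = range gelfand.
  apply/seteqP; split => [_ [_ [a _ <-] <-]|_ [b _ <-]].
    have [b hb] := lift a; exists b => //.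
    by rewrite (E_uniq _ _ (cl_gelfand a) hb).
  have [a ha] := lift' b; exists (gelfand a); first by exists a.
  by apply: (E_inv _ _ ha); exact: cl_gelfand.
have E_cl f : cl A f -> cl B (E f) by move=> /hE[].
have E_val f (y : Ch B) : cl A f ->
    E f (\val y) = gelfand (T 1) (\val y) * twist (s y) (f (\val (phi y))).
  by move=> /hE[].
have E_onto g : cl B g -> exists2 f, cl A f & E f = g.
  move=> cg; have [f hf] := transported_exists lift' cg.
  by exists f; [exact: (proj1 hf)|exact: (E_inv _ _ hf (proj1 hf) cg)].
have mem y : (y \in linear_part s) = s y by exact: linear_part_mem.
have E_one : T 1 = 1 -> forall f, cl A f -> forall y : Ch B,
    E f (\val y) = twist (s y) (f (\val (phi y))).
  by move=> T1 f cf y; rewrite E_val // T1 gelfand1 mul1r.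
exists E, eta, phi, (linear_part s).
split; first exact: E_gelfand.
split.
  apply/seteqP; split => [_ [f cf <-]|g cg]; first exact: E_cl.
  by have [f cf <-] := E_onto g cg; exists f.
split; first exact: E_range.
split; first by apply/unitrP; exists eta; rewrite -expr2.
split; first exact: eta2.
split.
  split; first exact: (representation_continuous Tu TE).
  by exists psi; split=> //; exact: (representation_continuous T'u T'E).
split; first exact: (linear_part_clopen Tu TE).
split.
  move=> f cf y; rewrite mem E_val // T1E -mulrA; congr (_ * _).
  by case: (s y) => /=; rewrite ?mul1r.
split.
  by move=> T1 f cf y; rewrite mem E_one //; case: (s y).
split.
  move=> f g cf cg.
  have cA (c : R[i]) : cl A (fun x => f x * g x - c).
    have := cl_ZD 1 (cl_M cf cg) (cl_cst A (- c)); congr (cl A).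
    by apply/funext => x; rewrite combE mul1r.
  have cB (c : R[i]) : cl B (fun y => E f y * E g y - c).
    have := cl_ZD 1 (cl_M (E_cl _ cf) (E_cl _ cg)) (cl_cst B (- c)); congr (cl B).
    by apply/funext => x; rewrite combE mul1r.
  have e (y : Ch B) : modc (E f (\val y) * E g (\val y) - alpha) =
      modc (f (\val (phi y)) * g (\val (phi y)) - alpha).
    (* Writing [alpha] as [T 1 ^+ 2] times its twist factors out [T 1 ^+ 2], of modulus 1 on the
       boundary. *)
    rewrite !E_val // -{1}(sqr_alpha TE alpha_neq0 Talpha y) mulrACA -expr2 -twistM.
    by rewrite -mulrBr -twistB modcM modcX (modc_T1 TE alpha_neq0 Talpha) expr1n mul1r modc_twist.
  have [x0 _] := char_exists A; have [y0 _] := char_exists B.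
  apply/eqP; rewrite eq_le; apply/andP; split; [apply: (sup_norm_le y0)|apply: (sup_norm_le x0)].
    apply: (cl_boundary (cB alpha)) => y; rewrite e.
    exact: (sup_norm_ge (\val (phi y)) (cl_bounded (cA alpha))).
  apply: (cl_boundary (cA alpha)) => x; rewrite -(psiK x) -e.
  exact: (sup_norm_ge (\val (psi x)) (cl_bounded (cB alpha))).
split.
  apply/seteqP; split => [_ [f [cf [f' cf' ff]] <-]|g [cg [g' cg' gg]]].
    exact: (transported_invertible (Tu _ (unitr1 A)) (hE _ cf) (hE _ cf') ff).
  have [f hf] := transported_exists lift' cg; have [f' hf'] := transported_exists lift' cg'.
  exists f; last by exact: (E_inv _ _ hf (proj1 hf) cg).
  exact: (transported_invertible (T'u _ (unitr1 B)) hf hf' gg).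
move=> T1 nonreal.
have s1 y : s y.
  (* At a point where [s] fails, a scalar fixed by [T] equals its conjugate. *)
  have tw (la : R[i]) : la \isn't Num.real -> T la%:A = la%:A -> s y.
    move=> lr Tla; have la0 : la != 0 by apply: contraNneq lr => ->; exact: real0.
    have := TE y _ (scalar_unit A la0); rewrite Tla T1 gelfand1 mul1r !gelfand_scalar.
    by case: (s y) => //= /esym/eqP; rewrite -CrealE (negbTE lr).
  case: nonreal => [ar|[la lr]]; last exact: tw lr.
  apply: tw ar _.
  (* [T 1 * T alpha = alpha], so [T] fixes [alpha]. *)
  by have := Talpha 1 (unitr1 A); rewrite T1 mul1r invr1.
have Ephi f : cl A f -> forall y : Ch B, E f (\val y) = f (\val (phi y)).
  by move=> cf y; rewrite E_one // s1.
split=> //; split=> //; split.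
- split.
  + by move=> f; exact: E_cl.
  + move=> f g; rewrite !inE => cf cg e; apply: cl_eq => // x.
    by rewrite -(psiK x) -!Ephi // e.
  + by move=> g /E_onto[f cf <-]; exists f.
- move=> c f g cf cg; apply: cl_eq => [||y].
  + by apply/E_cl/cl_ZD.
  + by apply: cl_ZD; exact: E_cl.
  + by rewrite Ephi ?combE ?Ephi //; exact: cl_ZD.
- move=> f g cf cg; apply: cl_eq => [||y].
  + by apply/E_cl/cl_M.
  + by apply: cl_M; exact: E_cl.
  + by rewrite /= !Ephi //; exact: cl_M.
- apply: cl_eq => [||y]; [exact/E_cl/cl_cst|exact: cl_cst|].
  by rewrite Ephi //; exact: cl_cst.
Qed.
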